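(* Let $D$ be the combinatorial type of some $\Gamma$-complete simplicial Quantum Fan in $\mathbb R^d$ with $p$ one-dimensional cones. The moduli space $\mathscr M^{D,d}_{\mathrm{toric}}$ of $\Gamma$-complete simplicial Quantum Toric Varieties of combinatorial type equivalent to $D$ can be endowed with a structure of a real orbifold of dimension $d(p-d)$.
   Context: Let $\Gamma\subset\mathbb R^d$ be a finitely generated additive subgroup spanning $\mathbb R^d$. A Quantum Fan $(\Delta,v)$ in $\Gamma$ is a collection $\Delta$ of strongly convex cones generated by elements of $\Gamma$, containing $0$ and closed under intersections and faces, with a generator $v_i\in\Gamma\setminus\{0\}$ of each $1$-cone, $v=(v_1,\dots,v_p)$. It is simplicial if every cone is over a simplex and $\Gamma$-complete if $\Gamma=\mathbb Zv_1+\dots+\mathbb Zv_p$. An isomorphism $(\Delta,v)\to(\Delta',v')$ is a linear isomorphism $L$ with $L(\Gamma)=\Gamma'$, mapping cones of $\Delta$ to cones of $\Delta'$, its inverse doing the same, and mapping $(v_1,\dots,v_p)$ to a permutation of $(v'_1,\dots,v'_p)$. The combinatorial type $\mathrm{comb}(\Delta)$ is the poset of subsets $I\subset\{1,\dots,p\}$ such that $(v_i)_{i\in I}$ generates a cone of $\Delta$ (with these rays); two Quantum Fans are combinatorially equivalent ($\simeq$) if they have the same number $p$ of $1$-cones and some bijection of $\{1,\dots,p\}$ maps one combinatorial type bijectively onto the other. Isomorphism classes of simplicial Quantum Toric Varieties correspond to isomorphism classes of simplicial Quantum Fans, and $$\mathscr M^{D,d}_{\mathrm{toric}}=\{(\Delta,v)\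 \Gamma\text{-complete simplicial Quantum Fan in }\mathbb R^d\mid\mathrm{comb}(\Delta)\simeq D\}/\text{isomorphism}.$$ Every such fan is isomorphic to a standard one ($v_1=e_1,\dots,v_d=e_d$), hence is described by $\underline v=(v_{d+1},\dots,v_p)\in(\mathbb R^d)^{p-d}$; the set of $D$-realizable $\underline v$ (those arising from a standard fan in $\Gamma=\mathbb Z^d+\mathbb Zv_{d+1}+\dots+\mathbb Zv_p$ of combinatorial type $D$) is open in $(\mathbb R^d)^{p-d}$ and $\mathscr M^{D,d}_{\mathrm{toric}}$ has the quotient topology. A real orbifold is a stack over the category of $C^\infty$-manifolds (with usual euclidean coverings) with only finite isotropy groups. *)

(* Defs.v *)
From HB Require Import structures.
From mathcomp Require Import all_boot all_order all_algebra all_fingroup.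
From mathcomp Require Import all_classical all_reals all_analysis.

Set Implicit Arguments.
Unset Strict Implicit.
Unset Printing Implicit Defensive.

Import Order.TTheory GRing.Theory Num.Theory.
Import numFieldNormedType.Exports.

Local Open Scope classical_set_scope.
Local Open Scope ring_scope.
Local Open Scope quotient_scope.

Definition final_topology {T Q : Type} (f : T -> Q) : Type := Q.

Section final_topology.
Context {T : topologicalType} {Q : choiceType} (f : T -> Q).
Local Notation W := (final_topology f).

Definition final_open (A : set W) : Prop := open (f @^-1` A).

Lemma final_openT : final_open setT.
Proof. exact: (@openT T). Qed.

Lemma final_openI : setI_closed final_open.
Proof. by move=> A B; exact: (@openI T). Qed.

Lemma final_open_bigU (I : Type) (g : I -> set W) :
  (forall i, final_open (g i)) -> final_open (\bigcup_i g i).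
Proof.
move=> og; rewrite /final_open preimage_bigcup.
by apply: bigcup_open => i _; exact: og.
Qed.

HB.instance Definition _ := Choice.on W.
HB.instance Definition _ :=
  isOpenTopological.Build W final_openT final_openI final_open_bigU.
End final_topology.

Definition homeomorphic (T T' : topologicalType) : Prop :=
  exists (f : T -> T') (g : T' -> T),
    [/\ continuous f, continuous g, cancel f g & cancel g f].

(* Used with [A] open: [C^(k+1)] means differentiable with all directional
   derivatives of class [C^k]. *)
Fixpoint Ck (R : realType) (m n k : nat) (A : set 'rV[R]_m)
    (f : 'rV[R]_m -> 'rV[R]_n) : Prop :=
  if k is k'.+1 then
    (forall x, A x -> differentiable f x) /\
    (forall v, Ck k' A (fun x => 'D_v f x))
  else forall x, A x -> {for x, continuous f}.

Definition Cinfty (R : realType) (m n : nat) (A : set 'rV[R]_m)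
    (f : 'rV[R]_m -> 'rV[R]_n) : Prop := forall k, Ck k A f.

(* [cinv] is only meaningful on the open set [cmap @` cdom]. *)
Record chart (R : realType) (T : topologicalType) (n : nat) := Chart {
  cdom : set T;
  cmap : T -> 'rV[R]_n;
  cinv : 'rV[R]_n -> T;
  cdom_open : open cdom;
  cmap_open : open (cmap @` cdom);
  cmapK : forall x, cdom x -> cinv (cmap x) = x;
  cmap_cont : forall x, cdom x -> {for x, continuous cmap};
  cinv_cont : forall y, (cmap @` cdom) y -> {for y, continuous cinv}
}.

Record manifold (R : realType) := Manifold {
  carrier :> topologicalType;
  mdim : nat;
  atlas : set (chart R carrier mdim);
  manifold_hausdorff : hausdorff_space carrier;
  manifold_second_countable : @second_countable carrier;
  atlas_cover : forall x : carrier, exists2 c, atlas c & cdom c x;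
  atlas_compat : forall c c', atlas c -> atlas c' ->
    Cinfty (cmap c @` (cdom c `&` cdom c')) (cmap c' \o cinv c)
}.

Definition smooth_on (R : realType) (S T : manifold R) (A : set S)
    (f : S -> T) : Prop :=
  (forall x, A x -> {for x, continuous f}) /\
  (forall c c', atlas c -> atlas c' ->
    Cinfty (cmap c @` (A `&` cdom c `&` f @^-1` cdom c'))
           (cmap c' \o f \o cinv c)).

Definition smooth (R : realType) (S T : manifold R) (f : S -> T) : Prop :=
  smooth_on setT f.

Definition etale (R : realType) (S T : manifold R) (f : S -> T) : Prop :=
  smooth f /\
  forall x, exists (A : set S) (g : T -> S),
    [/\ open A /\ A x, open (f @` A), smooth_on (f @` A) g &
        forall y, A y -> g (f y) = y].

Definition covering (R : realType) (S : manifold R) (I : Type)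
    (U : I -> manifold R) (f : forall i, U i -> S) : Prop :=
  (forall i, etale (f i) /\ injective (f i)) /\
  (forall x : S, exists i y, f i y = x).

Section cst.
Variable R : realType.

Lemma Ck_cst (m n k : nat) (A : set 'rV[R]_m) (a : 'rV[R]_n) :
  Ck k A (fun=> a).
Proof.
elim: k a => [|k IHk] a /=; first by move=> x _; exact: cst_continuous.
split=> [x _|v]; first exact: differentiable_cst.
have -> : (fun x => 'D_v (fun=> a) x) = (fun=> 0) :> ('rV[R]_m -> 'rV[R]_n).
  by apply/funext => x; exact: derive_cst.
exact: IHk.
Qed.

Lemma smooth_cst (S T : manifold R) (t : T) : smooth (fun _ : S => t).
Proof.
split=> [x _|c c' _ _ k]; first exact: cst_continuous.
exact: (Ck_cst _ _ (cmap c' t)).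
Qed.
End cst.

Section point_manifold.
Variable R : realType.

Lemma rV0_all (x y : 'rV[R]_0) : x = y.
Proof. by rewrite thinmx0 (thinmx0 y). Qed.

Lemma rV0_cont (T : topologicalType) (f : 'rV[R]_0 -> T) : continuous f.
Proof.
suff -> : f = (fun=> f 0) by move=> x; exact: cst_continuous.
by apply/funext => x; rewrite (rV0_all x 0).
Qed.

Lemma image_rV0 : id @` [set: 'rV[R]_0] = setT.
Proof. exact: image_id. Qed.

Lemma chart_rV0_open : open ((id : 'rV[R]_0 -> 'rV[R]_0) @` setT).
Proof. rewrite image_rV0; exact: openT. Qed.

Definition point_chart : chart R 'rV[R]_0 0 :=
  @Chart R 'rV[R]_0 0 setT id id openT chart_rV0_open
    (fun _ _ => erefl) (fun _ _ => @rV0_cont _ id _)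
    (fun _ _ => @rV0_cont _ id _).

Lemma rV0_hausdorff : hausdorff_space 'rV[R]_0.
Proof. by move=> x y _; exact: rV0_all. Qed.

Lemma rV0_second_countable : @second_countable 'rV[R]_0.
Proof.
exists [set setT]; first exact: finite_set_countable.
split=> [_ ->|x A /nbhs_singleton Ax]; first exact: openT.
by exists setT => // y _; rewrite (rV0_all y x).
Qed.

Lemma point_compat (c c' : chart R 'rV[R]_0 0) :
  [set point_chart] c -> [set point_chart] c' ->
  Cinfty (cmap c @` (cdom c `&` cdom c')) (cmap c' \o cinv c).
Proof.
move=> _ _ k; set f := (_ \o _).
suff -> : f = (fun=> f 0) by exact: Ck_cst.
by apply/funext => x; rewrite (rV0_all x 0).
Qed.

Definition point_manifold : manifold R :=
  @Manifold R 'rV[R]_0 0 [set point_chart] rV0_hausdorff rV0_second_countable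
    (fun x => ex_intro2 _ _ point_chart erefl Logic.I) point_compat.
End point_manifold.

(* A category fibred in groupoids: [ob X S] are the objects above [S], and
   [base u] is the smooth map below the arrow [u].  Composition is written in
   diagrammatic order. *)
Record cfg (R : realType) := Cfg {
  ob : manifold R -> Type;
  hom : forall S T, ob S -> ob T -> Type;
  idm : forall S (x : ob S), hom x x;
  comp : forall S T V (x : ob S) (y : ob T) (z : ob V),
    hom x y -> hom y z -> hom x z;
  comp1m : forall S T (x : ob S) (y : ob T) (u : hom x y),
    comp (idm x) u = u;
  compm1 : forall S T (x : ob S) (y : ob T) (u : hom x y),
    comp u (idm y) = u;
  compA : forall S T V W (x : ob S) (y : ob T) (z : ob V) (t : ob W)
    (u : hom x y) (v : hom y z) (w : hom z t),
    comp u (comp v w) = comp (comp u v) w;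
  base : forall S T (x : ob S) (y : ob T), hom x y -> S -> T;
  base_smooth : forall S T (x : ob S) (y : ob T) (u : hom x y),
    smooth (base u);
  base_id : forall S (x : ob S), base (idm x) = id;
  base_comp : forall S T V (x : ob S) (y : ob T) (z : ob V)
    (u : hom x y) (v : hom y z), base (comp u v) = base v \o base u;
  pullback : forall (S T : manifold R) (f : S -> T) (y : ob T), smooth f ->
    exists (x : ob S) (u : hom x y), base u = f;
  cartesian : forall S T V (x : ob S) (y : ob T) (z : ob V)
    (u : hom y z) (v : hom x z) (f : S -> T),
    smooth f -> base v = base u \o f ->
    exists! w : hom x y, base w = f /\ comp w u = v
}.

Arguments hom {R} c {S T}.
Arguments idm {R c S}.
Arguments comp {R c S T V x y z}.
Arguments base {R c S T x y}.

(* Isomorphisms form a sheaf.  The arrows [u i] exhibit [x' i] as the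
   restriction of [x] to [U i]. *)
Definition glue_arrows (R : realType) (X : cfg R) : Prop :=
  forall (S : manifold R) (I : Type) (U : I -> manifold R)
    (f : forall i, U i -> S) (x y : ob X S) (x' : forall i, ob X (U i))
    (u : forall i, hom X (x' i) x) (v : forall i, hom X (x' i) y),
  covering f ->
  (forall i, base (u i) = f i) -> (forall i, base (v i) = f i) ->
  (forall i j (T : manifold R) (z : ob X T)
     (a : hom X z (x' i)) (b : hom X z (x' j)),
     comp a (u i) = comp b (u j) -> comp a (v i) = comp b (v j)) ->
  exists! w : hom X x y, base w = id /\ forall i, comp (u i) w = v i.

(* A descent datum on [x i : ob X (U i)] is presented by the graph of its
   transition isomorphisms on generalized points of the overlaps:
   [E i j T z a b] means that, for [a : z -> x i] and [b : z -> x j] lying over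
   the two components of a map from [T] to the fibre product of [U i] and [U j]
   over [S], the transition isomorphism carries [a] to [b]. *)
Record descent_datum (R : realType) (X : cfg R) (S : manifold R) (I : Type)
    (U : I -> manifold R) (f : forall i, U i -> S) (x : forall i, ob X (U i))
    (E : forall i j (T : manifold R) (z : ob X T),
       hom X z (x i) -> hom X z (x j) -> Prop) : Prop := {
  descent_base : forall i j T (z : ob X T)
    (a : hom X z (x i)) (b : hom X z (x j)),
    E i j T z a b -> f i \o base a = f j \o base b;
  descent_fun : forall i j T (z : ob X T) (a : hom X z (x i)) (g : T -> U j),
    smooth g -> f i \o base a = f j \o g ->
    exists! b : hom X z (x j), base b = g /\ E i j T z a b;
  descent_natural : forall i j T T' (z : ob X T) (z' : ob X T')
    (c : hom X z' z) (a : hom X z (x i)) (b : hom X z (x j)),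
    E i j T z a b -> E i j T' z' (comp c a) (comp c b);
  descent_refl : forall i T (z : ob X T) (a : hom X z (x i)), E i i T z a a;
  descent_sym : forall i j T (z : ob X T)
    (a : hom X z (x i)) (b : hom X z (x j)),
    E i j T z a b -> E j i T z b a;
  descent_cocycle : forall i j k T (z : ob X T)
    (a : hom X z (x i)) (b : hom X z (x j)) (c : hom X z (x k)),
    E i j T z a b -> E j k T z b c -> E i k T z a c
}.

Definition glue_objects (R : realType) (X : cfg R) : Prop :=
  forall (S : manifold R) (I : Type) (U : I -> manifold R)
    (f : forall i, U i -> S) (x : forall i, ob X (U i))
    (E : forall i j (T : manifold R) (z : ob X T),
       hom X z (x i) -> hom X z (x j) -> Prop),
  covering f -> descent_datum f E ->
  exists (y : ob X S) (u : forall i, hom X (x i) y),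
    (forall i, base (u i) = f i) /\
    (forall i j T (z : ob X T) (a : hom X z (x i)) (b : hom X z (x j)),
       E i j T z a b -> comp a (u i) = comp b (u j)).

Definition is_stack (R : realType) (X : cfg R) : Prop :=
  glue_arrows X /\ glue_objects X.

(* [u : ob X U] is the same as a map from [U] to [X].  It is an etale atlas if,
   for all [x : ob X S], the 2-fibre product of [S] and [U] over [X] is a
   manifold [P] whose projection [base a] to [S] is etale and surjective.
   Maps from [T] to this 2-fibre product are the spans [x <- t -> u] with [t]
   over [T], so [P] represents it iff some [z] over [P] is a product of [x] and
   [u] in the total category of [X]. *)
Definition etale_atlas (R : realType) (X : cfg R) (U : manifold R)
    (u : ob X U) : Prop :=
  forall (S : manifold R) (x : ob X S),
  exists (P : manifold R) (z : ob X P) (a : hom X z x) (b : hom X z u),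
    [/\ etale (base a), (forall s : S, exists q : P, base a q = s) &
        forall (T : manifold R) (t : ob X T) (a' : hom X t x) (b' : hom X t u),
          exists! h : hom X t z, comp h a = a' /\ comp h b = b'].

Definition isotropy (R : realType) (X : cfg R) (x : ob X (point_manifold R)) :
  set (hom X x x) := [set u | base u = id].

(* The etale atlas is what makes the stack differentiable and gives it a
   dimension; no separation condition is imposed on the diagonal. *)
Record orbifold (R : realType) (n : nat) := Orbifold {
  ostack :> cfg R;
  ostack_stack : is_stack ostack;
  oatlas : manifold R;
  oatlas_dim : mdim oatlas = n;
  oatlas_ob : ob ostack oatlas;
  oatlas_etale : etale_atlas oatlas_ob;
  oisotropy_finite : forall x, finite_set (@isotropy R ostack x)
}.

Section coarse_space.
Variables (R : realType) (n : nat) (X : orbifold R n).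

Definition opoint : Type := ob X (point_manifold R).
HB.instance Definition _ := gen_eqMixin opoint.
HB.instance Definition _ := gen_choiceMixin opoint.

Definition opoint_iso (x y : opoint) : bool :=
  `[< exists u : hom X x y, base u = id >].

Lemma opoint_iso_refl : reflexive opoint_iso.
Proof. by move=> x; apply/asboolP; exists (idm x); rewrite base_id. Qed.

Lemma opoint_iso_sym1 x y : opoint_iso x y -> opoint_iso y x.
Proof.
move=> /asboolP[u ub]; apply/asboolP.
have [||w [[wb _] _]] := @cartesian _ X _ _ _ y x y u (idm y) id.
- by rewrite -(@base_id _ X _ x); exact: base_smooth.
- by rewrite ub base_id.
by exists w.
Qed.

Lemma opoint_iso_sym : symmetric opoint_iso.
Proof. by move=> x y; apply/idP/idP; exact: opoint_iso_sym1. Qed.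

Lemma opoint_iso_trans : transitive opoint_iso.
Proof.
move=> y x z /asboolP[u ub] /asboolP[v vb]; apply/asboolP.
by exists (comp u v); rewrite base_comp ub vb.
Qed.

Canonical opoint_equiv :=
  EquivRel opoint_iso opoint_iso_refl opoint_iso_sym opoint_iso_trans.

Lemma ofibre_ex (t : oatlas X) :
  exists x : opoint, exists u : hom X x (oatlas_ob X), base u = (fun=> t).
Proof. exact: (pullback (oatlas_ob X) (smooth_cst _ t)). Qed.

Definition ofibre (t : oatlas X) : opoint := sval (cid (ofibre_ex t)).

Definition oclass (t : oatlas X) : {eq_quot opoint_equiv} :=
  \pi_{eq_quot opoint_equiv} (ofibre t).

Definition coarse_space := final_topology oclass.
HB.instance Definition _ := Topological.on coarse_space.
End coarse_space.

Section cones.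
Variables (R : realType) (d : nat).
Local Notation V := 'rV[R]_d.

Definition zspan (m : nat) (w : 'I_m -> V) : set V :=
  [set x | exists c : 'I_m -> int, x = \sum_i w i *~ c i].

Definition spanning (G : set V) : Prop :=
  forall x : V, exists (m : nat) (w : 'I_m -> V) (a : 'I_m -> R),
    (forall i, G (w i)) /\ x = \sum_i a i *: w i.

Definition cone (m : nat) (w : 'I_m -> V) (I : {set 'I_m}) : set V :=
  [set x | exists2 a : 'I_m -> R,
     (forall i, 0 <= a i) & x = \sum_(i in I) a i *: w i].

Definition ray (w : V) : set V := [set x | exists2 a : R, 0 <= a & x = a *: w].

Definition is_ray (s : set V) : Prop := exists2 w, w != 0 & s = ray w.

Definition strongly_convex (s : set V) : Prop :=
  forall x, s x -> s (- x) -> x = 0.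

Definition is_face (t s : set V) : Prop :=
  exists2 u : 'cV[R]_d, (forall x, s x -> 0 <= (x *m u) 0 0) &
    t = [set x | s x /\ x *m u = 0].
End cones.

(* "Closed under intersections" has the usual meaning for fans: the intersection
   of two cones is a face of each of them, hence again in the fan.  The
   generators [qgen i] are arbitrary nonzero group elements on their rays. *)
Record qfan (R : realType) (d p : nat) := QFan {
  qgroup : set 'rV[R]_d;
  qcones : set (set 'rV[R]_d);
  qgen : 'I_p -> 'rV[R]_d;
  qgroup_fg : exists (m : nat) (w : 'I_m -> 'rV[R]_d), qgroup = zspan w;
  qgroup_span : spanning qgroup;
  qcones_gen : forall s, qcones s ->
    exists (m : nat) (w : 'I_m -> 'rV[R]_d),
      (forall i, qgroup (w i)) /\ s = cone w finset.setT;
  qcones_strong : forall s, qcones s -> strongly_convex s;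
  qcones0 : qcones [set 0];
  qcones_face : forall s t, qcones s -> is_face t s -> qcones t;
  qcones_inter : forall s t, qcones s -> qcones t ->
    is_face (s `&` t) s /\ is_face (s `&` t) t;
  qgen_group : forall i, qgroup (qgen i);
  qgen_neq0 : forall i, qgen i != 0;
  qgen_ray : forall s, (qcones s /\ is_ray s) <-> exists i, s = ray (qgen i);
  qgen_inj : forall i j, ray (qgen i) = ray (qgen j) -> i = j
}.

Section quantum_fans.
Variables (R : realType) (d p : nat).
Implicit Types F G H : qfan R d p.

HB.instance Definition _ := gen_eqMixin (qfan R d p).
HB.instance Definition _ := gen_choiceMixin (qfan R d p).

Definition simplicial F : Prop :=
  forall s, qcones F s -> exists (m : nat) (w : 'I_m -> 'rV[R]_d),
    row_free (\matrix_i w i) /\ s = cone w finset.setT.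

Definition gcomplete F : Prop := qgroup F = zspan (qgen F).

Definition comb F : {set {set 'I_p}} :=
  finset (fun I : {set 'I_p} => `[<
    qcones F (cone (qgen F) I) /\
    forall s, (is_face s (cone (qgen F) I) /\ is_ray s) <->
              exists2 i, i \in I & s = ray (qgen F i) >]).

Definition comb_equiv (D D' : {set {set 'I_p}}) : Prop :=
  exists s : 'S_p, [set s @: (I : {set 'I_p}) | I in D]%SET = D'.

Definition fan_iso F G : Prop :=
  exists A : 'M[R]_d, [/\ A \in unitmx,
    mulmxr A @` qgroup F = qgroup G,
    (forall s, qcones F s -> qcones G (mulmxr A @` s)),
    (forall s, qcones G s -> qcones F (mulmxr (invmx A) @` s)) &
    exists s : 'S_p, forall i, qgen F i *m A = qgen G (s i)].

Lemma mulmxr_image1 (s : set 'rV[R]_d) : mulmxr (1%:M : 'M[R]_d) @` s = s.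
Proof.
rewrite eqEsubset; split=> [_ [x sx <-]|x sx] /=; first by rewrite mulmx1.
by exists x; rewrite //= mulmx1.
Qed.

Lemma mulmxr_imageM (A B : 'M[R]_d) (s : set 'rV[R]_d) :
  mulmxr (A *m B) @` s = mulmxr B @` (mulmxr A @` s).
Proof.
rewrite eqEsubset; split=> [_ [x sx <-]|_ [_ [x sx <-] <-]] /=.
  by exists (x *m A); [exists x | rewrite /= mulmxA].
by exists x; rewrite //= mulmxA.
Qed.

Lemma fan_iso_refl F : fan_iso F F.
Proof.
exists 1%:M; split; rewrite ?unitmx1 ?mulmxr_image1 //.
- by move=> s; rewrite mulmxr_image1.
- by move=> s; rewrite invmx1 mulmxr_image1.
by exists 1%g => i; rewrite mulmx1 perm1.
Qed.

Lemma fan_iso_sym F G : fan_iso F G -> fan_iso G F.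
Proof.
move=> [A [uA AF cF cG [s sE]]]; exists (invmx A); split.
- by rewrite unitmx_inv.
- by rewrite -AF -mulmxr_imageM mulmxV// mulmxr_image1.
- exact: cG.
- by rewrite invmxK.
by exists s^-1%g => i; rewrite -{1}(permKV s i) -sE mulmxK.
Qed.

Lemma fan_iso_trans F G H : fan_iso F G -> fan_iso G H -> fan_iso F H.
Proof.
move=> [A [uA AF cF cG [s sE]]] [B [uB BG cG' cH [t tE]]].
exists (A *m B); split.
- by rewrite unitmx_mul uA.
- by rewrite mulmxr_imageM AF.
- by move=> c /cF /cG'; rewrite mulmxr_imageM.
- move=> c /cH /cG; rewrite -mulmxr_imageM.
  suff -> : invmx (A *m B) = invmx B *m invmx A by [].
  have uAB : A *m B \in unitmx by rewrite unitmx_mul uA.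
  by rewrite -[RHS](mulKmx uAB) -mulmxA (mulmxA B) mulmxV// mul1mx mulmxV// mulmx1.
by exists (s * t)%g => i; rewrite mulmxA sE tE permM.
Qed.

Lemma tail_ltn (j : 'I_(p - d)) : (d + j < p)%N.
Proof. by rewrite -ltn_subRL. Qed.

(* [p >= d] holds for every fan since [qgroup F] spans. *)
Definition standard F : Prop :=
  forall (i : 'I_p) (k : 'I_d), i = k :> nat -> qgen F i = delta_mx 0 k.

(* The vectors [v_(d+1), ..., v_p], as the rows of a matrix. *)
Definition tail F : 'M[R]_(p - d, d) :=
  \matrix_(j < p - d) qgen F (Ordinal (tail_ltn j)).
End quantum_fans.

Section moduli.
Variables (R : realType) (d p : nat) (D : {set {set 'I_p}}).

Definition mfan : Type :=
  {F : qfan R d p | [/\ simplicial F, gcomplete F & comb_equiv (comb F) D]}.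
HB.instance Definition _ := gen_eqMixin mfan.
HB.instance Definition _ := gen_choiceMixin mfan.

Definition mfan_iso (F G : mfan) : bool := `[< fan_iso (sval F) (sval G) >].

Lemma mfan_iso_refl : reflexive mfan_iso.
Proof. by move=> F; apply/asboolP; exact: fan_iso_refl. Qed.

Lemma mfan_iso_sym : symmetric mfan_iso.
Proof.
by move=> F G; apply/idP/idP => /asboolP/fan_iso_sym/asboolP.
Qed.

Lemma mfan_iso_trans : transitive mfan_iso.
Proof.
by move=> G F H /asboolP FG /asboolP GH; apply/asboolP; exact: fan_iso_trans GH.
Qed.

Canonical mfan_equiv :=
  EquivRel mfan_iso mfan_iso_refl mfan_iso_sym mfan_iso_trans.

Definition std_mfan : Type := {F : mfan | standard (sval F)}.
HB.instance Definition _ := gen_eqMixin std_mfan.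
HB.instance Definition _ := gen_choiceMixin std_mfan.

(* A standard fan is determined by [tail] and its labelled combinatorial type.
   For a fixed labelled type, this is the space of realizable parameters with
   its topology as a subset of [(R^d)^(p-d)].  All the (finitely many) labelled
   types equivalent to [D] are needed in general, e.g. because the first [d]
   generators need not be independent in all fans of type exactly [D]. *)
Definition std_param (F : std_mfan) :
    discrete_topology {set {set 'I_p}} * 'M[R]_(p - d, d) :=
  (comb (sval (sval F)), tail (sval (sval F))).

Definition std_space := initial_topology std_param.
HB.instance Definition _ := Topological.on std_space.

Definition std_class (F : std_space) : {eq_quot mfan_equiv} :=
  \pi_{eq_quot mfan_equiv} (sval (F : std_mfan)).

Definition moduli_space := final_topology std_class.
HB.instance Definition _ := Topological.on moduli_space.
End moduli.

(* Main.v *)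
Require Import Defs.
From HB Require Import structures.
From mathcomp Require Import all_boot all_order all_algebra all_fingroup.
From mathcomp Require Import all_classical all_reals all_analysis.

(** A fan with generators [v_1, ..., v_p] is simplicial of combinatorial type
    [D] iff [D] is a simplicial complex and no nonzero [c] whose positive and
    negative supports both lie in [D] satisfies [sum_i c_i v_i = 0].  After
    normalising [|c| = 1] this is an open condition on the [v_i], by
    compactness, so the standard fans form a manifold [M] of dimension
    [d (p - d)].  An isomorphism of standard fans is determined by its source
    and the permutation of the rays it induces, and for a fixed permutation its
    target is a rational function of its source: [M] is the base of an etale
    groupoid whose arrows are labelled by the finite group ['S_p].

    The orbifold is the quotient stack of [M] by this groupoid.  As the labels
    are discrete, a torsor under the groupoid over [S] can be trivialised by a
    possibly discontinuous section.  Hence a map from [S] to the quotient is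
    given by an arbitrary function [S -> M] together with, near each point, the
    class of labellings of [S] that move it to a smooth function.  Descent then
    needs no quotient construction: choose one preimage of each point of [S]. *)

Set Implicit Arguments.
Unset Strict Implicit.
Unset Printing Implicit Defensive.

Import Order.TTheory GRing.Theory Num.Theory.
Import numFieldNormedType.Exports.

Local Open Scope classical_set_scope.
Local Open Scope ring_scope.
Local Open Scope quotient_scope.

(** * Differential calculus *)

Section calculus.
Variable R : realType.

(** A permutation [g] does not act on all of [M]: an arrow labelled [g] leaves a standard fan only
    if the generators that [g] moves to the first [d] places form a basis. So [M] is not simply
    divided by an action of ['S_p]; the groupoid is a partial action with open domains, and the
    condition [arrow_from] accompanies labels throughout. Where [g] is defined, its linear part is
    forced: it is the inverse of the matrix of those [d] generators, and Cramer's rule makes it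
    smooth. An automorphism over a point is determined by its label, whence finite isotropy. The
    coarse space and the moduli space both carry the final topology of a surjection from [M];
    comparing them only requires that both surjections identify the same pairs of fans, namely those
    joined by an arrow. *)

Lemma near_eq_differentiable (V W : normedModType R) (f g : V -> W) (x : V) :
  {near x, f =1 g} -> differentiable f x -> differentiable g x.
Proof.
(* The difference [h] is a germ of the zero function, hence differentiable with differential 0, and
   [g = f + h]. *)
move=> fg df; pose h := g - f.
have h0 : \near x, h x = 0.
  by apply: filterS fg => y fgy; rewrite /h !fctE fgy subrr.
have hx : h x = 0 := nbhs_singleton h0.
suff dh : differentiable h x.
  by rewrite (_ : g = f + h); [exact: differentiableD|rewrite /h addrC subrK].
have key : h \o shift x = cst (h x) + (\0 : V -> W) +o_ 0 id.
  have h0s : \forall y \near 0, h (y + x) = 0.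
    by move: h0; rewrite (near_shift 0) /= subr0.
  apply/eqaddoP => _/posnumP[e]; near=> y.
  rewrite !fctE /= hx addr0 subr0 (near h0s y)//.
  by rewrite normr0 mulr_ge0.
apply/diff_locallyP; rewrite (@diff_unique R V W h (\0 : {linear V -> W})) //.
- by split=> // y; exact: cst_continuous.
- exact: cst_continuous.
Unshelve. all: by end_near. Qed.

(** The counterpart of [Ck] for scalar functions, where products and inverses are available;
    [Ck_coordP] reduces vector-valued maps to their coordinates. *)
Fixpoint scalarCk (m k : nat) (A : set 'rV[R]_m) (f : 'rV[R]_m -> R) : Prop :=
  if k is k'.+1 then
    (forall x, A x -> differentiable f x) /\
    (forall v, scalarCk k' A (fun x => 'D_v f x))
  else forall x, A x -> {for x, continuous f}.

Lemma scalarCk_sub m k (A B : set 'rV[R]_m) f :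
  A `<=` B -> scalarCk k B f -> scalarCk k A f.
Proof.
move=> AB; elim: k f => [|k IHk] f /=; first by move=> cf x /AB /cf.
by case=> df Df; split=> [x /AB /df//|v]; exact: IHk.
Qed.

Lemma scalarCk_eq m k (A : set 'rV[R]_m) f g : open A ->
  {in A, f =1 g} -> scalarCk k A f -> scalarCk k A g.
Proof.
move=> oA; have nA P x : (forall y, A y -> P y) -> A x -> \forall y \near x,
  P y.
  by move=> AP Ax; apply: filterS AP _; exact: open_nbhs_nbhs.
elim: k f g => [|k IHk] f g fg /=.
  move=> cf x Ax; have fgx : {near x, f =1 g}.
    by apply: nA => // y Ay; rewrite fg // inE.
  change (g @ x --> g x); rewrite -fg ?inE//; apply: cvg_trans (cf x Ax).
  exact: (near_eq_cvg fgx).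
case=> df Df; split=> [x Ax|v].
  apply: near_eq_differentiable (df x Ax).
  by apply: nA => // y Ay; rewrite fg // inE.
apply: IHk (Df v) => x; rewrite inE => Ax; apply: near_eq_derive.
by apply: nA => // y Ay; rewrite fg // inE.
Qed.

Lemma scalarCkW m k (A : set 'rV[R]_m) f : scalarCk k.+1 A f -> scalarCk k A f.
Proof.
elim: k f => [|k IHk] f [df Df].
  by move=> x Ax; exact/differentiable_continuous/df.
by split=> // v; exact: IHk.
Qed.

Lemma scalarCk_cst m k (A : set 'rV[R]_m) a : scalarCk k A (fun=> a).
Proof.
elim: k a => [|k IHk] a /=; first by move=> x _; exact: cst_continuous.
split=> [x _|v]; first exact: differentiable_cst.
have -> : (fun x => 'D_v (fun=> a) x) = (fun=> 0) :> ('rV[R]_m -> R).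
  by apply/funext => x; exact: derive_cst.
exact: IHk.
Qed.

Lemma scalarCk_coord m k (A : set 'rV[R]_m) j : scalarCk k A (fun x => x 0 j).
Proof.
case: k => [|k] /=; first by move=> x _; exact: coord_continuous.
split=> [x _|v]; first exact: differentiable_coord.
rewrite (_ : (fun x => _) = fun=> v 0 j); first exact: scalarCk_cst.
apply/funext => x; have := derive_mx (@derivable_id _ _ x v).
by rewrite derive_id => /matrixP/(_ 0 j); rewrite mxE.
Qed.

Lemma scalarCkD m k (A : set 'rV[R]_m) f g : open A ->
  scalarCk k A f -> scalarCk k A g -> scalarCk k A (fun x => f x + g x).
Proof.
move=> oA; elim: k f g => [|k IHk] f g /=.
  by move=> cf cg x Ax; apply: continuousD; [exact: cf|exact: cg].
move=> [df Df] [dg Dg]; split=> [x Ax|v].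
  by apply: (@differentiableD _ _ _ f g); [exact: df|exact: dg].
apply: scalarCk_eq (IHk _ _ (Df v) (Dg v)) => // x; rewrite inE => Ax.
by rewrite -(deriveD (f := f))//; apply: diff_derivable; [exact: df|exact: dg].
Qed.

Lemma scalarCkM m k (A : set 'rV[R]_m) f g : open A ->
  scalarCk k A f -> scalarCk k A g -> scalarCk k A (fun x => f x * g x).
Proof.
move=> oA; elim: k f g => [|k IHk] f g.
  by move=> cf cg x Ax; apply: continuousM; [exact: cf|exact: cg].
move=> Cf Cg; have [df Df] := Cf; have [dg Dg] := Cg; split=> [x Ax|v].
  by apply: (@differentiableM _ _ f g); [exact: df|exact: dg].
apply: (@scalarCk_eq _ _ _ (fun x => f x * 'D_v g x + g x * 'D_v f x)) => //.
  move=> x; rewrite inE => Ax.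
  by rewrite (@deriveM _ _ f g) //; apply: diff_derivable;
    [exact: df|exact: dg].
by apply: scalarCkD => //; apply: IHk;
  first [exact: scalarCkW|exact: Df|exact: Dg].
Qed.

Lemma scalarCk_sum m k (A : set 'rV[R]_m) I (r : seq I) (P : pred I)
    (f : I -> 'rV[R]_m -> R) : open A -> (forall i,
      P i -> scalarCk k A (f i)) ->
  scalarCk k A (fun x => \sum_(i <- r | P i) f i x).
Proof.
move=> oA Cf; elim: r => [|i r IHr].
  rewrite (_ : (fun=> _) = fun=> 0); first exact: scalarCk_cst.
  by apply/funext => x; rewrite big_nil.
case Pi : (P i); last first.
  rewrite (_ : (fun=> _) = fun x => \sum_(i <- r | P i) f i x) //.
  by apply/funext => x; rewrite big_cons Pi.
rewrite (_ : (fun=> _) = fun x => f i x + \sum_(i <- r | P i) f i x).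
  by apply: scalarCkD => //; exact: Cf.
by apply/funext => x; rewrite big_cons Pi.
Qed.

Lemma scalarCk_prod m k (A : set 'rV[R]_m) I (r : seq I) (P : pred I)
    (f : I -> 'rV[R]_m -> R) : open A -> (forall i,
      P i -> scalarCk k A (f i)) ->
  scalarCk k A (fun x => \prod_(i <- r | P i) f i x).
Proof.
move=> oA Cf; elim: r => [|i r IHr].
  rewrite (_ : (fun=> _) = fun=> 1); first exact: scalarCk_cst.
  by apply/funext => x; rewrite big_nil.
case Pi : (P i); last first.
  rewrite (_ : (fun=> _) = fun x => \prod_(i <- r | P i) f i x) //.
  by apply/funext => x; rewrite big_cons Pi.
rewrite (_ : (fun=> _) = fun x => f i x * \prod_(i <- r | P i) f i x).
  by apply: scalarCkM => //; exact: Cf.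
by apply/funext => x; rewrite big_cons Pi.
Qed.

Lemma scalarCkV m k (A : set 'rV[R]_m) f : open A ->
  (forall x, A x -> f x != 0) ->
  scalarCk k A f -> scalarCk k A (fun x => (f x)^-1).
Proof.
move=> oA f0; elim: k f f0 => [|k IHk] f f0 Cf.
  by move=> x Ax; apply: continuousV (Cf x Ax); exact: f0.
have [df Df] := Cf; split=> [x Ax|v].
  by apply: differentiableV; [exact: df|exact: f0].
apply: (@scalarCk_eq _ _ _ (fun x =>
  -1 * ((f x)^-1 * ((f x)^-1 * 'D_v f x)))) => //.
  move=> x; rewrite inE => Ax.
  rewrite deriveV ?f0//; last exact/diff_derivable/df.
  by rewrite expr2 invfM /GRing.scale /= !mulNr mul1r mulrA.
apply: scalarCkM => //; first exact: scalarCk_cst.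
have CV : scalarCk k A (fun x => (f x)^-1) by apply: IHk => //;
  exact: scalarCkW.
by do 2![apply: scalarCkM => //]; exact: Df.
Qed.

Lemma differentiable_rVP (V : normedModType R) n (f : V -> 'rV[R]_n) x :
  differentiable f x <-> forall j, differentiable (fun x => f x 0 j) x.
Proof.
split=> [df j|df].
  exact: (differentiable_comp df (@differentiable_coord R 1 n _ 0 j)).
rewrite (_ : f = \sum_j (fun x => f x 0 j *: delta_mx 0 j)); last first.
  by apply/funext => y; rewrite fct_sumE; exact: row_sum_delta.
by apply: differentiable_sum => j; exact: differentiableZl.
Qed.

Lemma continuous_mxP (T : topologicalType) m n (f : T -> 'M[R]_(m, n)) x :
  {for x, continuous f} <->
  forall i j, {for x, continuous (fun x => f x i j)}.
Proof.
split=> [cf i j|cf].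
  exact: (continuous_comp cf (@coord_continuous R m n i j _)).
move=> A [P Pf PA]; apply: (@filterS _ _ _
  [set y | forall i j, P i j (f y i j)]) => [y|]; first exact: PA.
by apply: filter_forall => i; apply: filter_forall => j; exact/cf/Pf.
Qed.

Lemma Ck_coordP m n k (A : set 'rV[R]_m) (f : 'rV[R]_m -> 'rV[R]_n) : open A ->
  Ck k A f <-> forall j, scalarCk k A (fun x => f x 0 j).
Proof.
move=> oA; elim: k f => [|k IHk] f /=.
  split=> [cf j x Ax|cf x Ax]; first by have/continuous_mxP := cf x Ax.
  by apply/continuous_mxP => i j; rewrite ord1; exact: cf.
have Dcoord v j : (forall x, A x -> differentiable f x) ->
    {in A, (fun x => ('D_v f x) 0 j) =1 (fun x => 'D_v (fun x => f x 0 j) x)}.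
  move=> df x; rewrite inE => Ax.
  by rewrite derive_mx ?mxE//; exact/diff_derivable/df.
split=> [[df Df] j|Cf].
  split=> [x Ax|v]; first by have/differentiable_rVP := df x Ax.
  by apply: scalarCk_eq (Dcoord v j df) _ => //; have /IHk := Df v; apply.
have df x : A x -> differentiable f x.
  by move=> Ax; apply/differentiable_rVP => j; have [+ _] := Cf j; apply.
split=> // v; apply/IHk => j.
have [_ /(_ v)] := Cf j; apply: scalarCk_eq => // x Ax.
by rewrite -Dcoord.
Qed.

Lemma scalarCk_comp m n k (A : set 'rV[R]_m) (B : set 'rV[R]_n)
    (f : 'rV[R]_m -> 'rV[R]_n) (g : 'rV[R]_n -> R) : open A -> open B ->
  (forall x, A x -> B (f x)) -> Ck k A f -> scalarCk k B g ->
  scalarCk k A (g \o f).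
Proof.
move=> oA oB AB; elim: k g => [|k IHk] g Cf Cg.
  by move=> x Ax; apply: continuous_comp; [exact: Cf|exact/Cg/AB].
have [df Df] := Cf; have [dg Dg] := Cg; split=> [x Ax|v].
  by apply: differentiable_comp; [exact: df|exact/dg/AB].
have Cfj := (Ck_coordP k.+1 f oA).1 Cf.
have {}Cf : Ck k A f by apply/Ck_coordP => // j; exact/scalarCkW/Cfj.
(* The direction ['D_v f x] varies with [x], while the hypothesis on [g] concerns fixed directions.
   Expanding it in the standard basis leaves products of functions of class [C^k] only. *)
apply: (@scalarCk_eq _ _ _
    (fun x => \sum_j ('D_v f x) 0 j * ('D_(delta_mx 0 j) g \o f) x)) => //.
  move=> x; rewrite inE => Ax; have dgx := dg _ (AB _ Ax).
  have dfx := df _ Ax; transitivity ('d g (f x) ('D_v f x)).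
    rewrite [in RHS](row_sum_delta ('D_v f x)) linear_sum.
    by apply: eq_bigr => j _; rewrite linearZ /= (deriveE _ dgx).
  have dgf : differentiable (g \o f) x.
    exact: (differentiable_comp dfx dgx).
  by rewrite (deriveE _ dgf) (deriveE _ dfx) (diff_comp dfx dgx).
apply: scalarCk_sum => // j _; apply: scalarCkM => //.
  exact: (Ck_coordP k _ oA).1 (Df v) j.
exact: IHk _ Cf (Dg _).
Qed.

Lemma Cinfty_comp m n l (A : set 'rV[R]_m) (B : set 'rV[R]_n)
    (f : 'rV[R]_m -> 'rV[R]_n) (g : 'rV[R]_n -> 'rV[R]_l) : open A -> open B ->
  (forall x, A x -> B (f x)) -> Cinfty A f -> Cinfty B g -> Cinfty A (g \o f).
Proof.
move=> oA oB AB Cf Cg k; apply/Ck_coordP => // j.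
apply: (@scalarCk_comp _ _ _ _ B f (fun x => g x 0 j)) => //.
exact: (Ck_coordP k _ oB).1 (Cg k) j.
Qed.

Lemma Cinfty_eq m n (A : set 'rV[R]_m) (f g : 'rV[R]_m -> 'rV[R]_n) : open A ->
  {in A, f =1 g} -> Cinfty A f -> Cinfty A g.
Proof.
move=> oA fg Cf k; apply/Ck_coordP => // j.
have := (Ck_coordP k _ oA).1 (Cf k) j; apply: scalarCk_eq => // x Ax.
by rewrite fg.
Qed.

Lemma Cinfty_id m (A : set 'rV[R]_m) : open A -> Cinfty A id.
Proof. by move=> oA k; apply/Ck_coordP => // j; exact: scalarCk_coord. Qed.

(** [Ck] tests the points of its set one at a time, with derivatives taken in the ambient space; so
    [B] may be any set through [x]. *)
Lemma Cinfty_local m n (A : set 'rV[R]_m) (f : 'rV[R]_m -> 'rV[R]_n) :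
  (forall x, A x -> exists2 B, B x & Cinfty B f) -> Cinfty A f.
Proof.
move=> Af k; have {}Af x : A x -> exists2 B, B x & Ck k B f.
  by move=> /Af[B Bx /(_ k)]; exists B.
elim: k f Af => [|k IHk] f Af /=; first by move=> x /Af[B Bx]; apply.
split=> [x /Af[B Bx [+ _]]|v]; first exact.
by apply: IHk => x /Af[B Bx [_ /(_ v)]]; exists B.
Qed.

Lemma Cinfty_sub m n (A B : set 'rV[R]_m) (f : 'rV[R]_m -> 'rV[R]_n) :
  A `<=` B -> Cinfty B f -> Cinfty A f.
Proof. by move=> AB Cf; apply: Cinfty_local => x /AB Bx; exists B. Qed.

End calculus.

(** * Smooth maps between manifolds *)

Section manifolds.
Variable R : realType.
Implicit Types S T V : manifold R.

Lemma open_setI_preimage (X Y : topologicalType) (f : X -> Y) A B : open A ->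
  (forall x, A x -> {for x, continuous f}) -> open B -> open (A `&` f @^-1` B).
Proof.
move=> oA cf oB; rewrite openE => x [Ax Bfx].
apply: filterI; first exact: open_nbhs_nbhs.
by apply: (cf x Ax); exact: open_nbhs_nbhs.
Qed.

Lemma open_nearP (X : topologicalType) (P : X -> Prop) x :
  (\near x, P x) <-> exists A : set X, [/\ open A, A x & A `<=` P].
Proof.
split=> [|[A [oA Ax AP]]]; last first.
  by apply: filterS AP _; exact: open_nbhs_nbhs.
by rewrite -nbhs_nearE nbhsE => -[A [oA Ax] AP]; exists A.
Qed.

Lemma chart_image_open (X : topologicalType) n (c : chart R X n) (A : set X) :
  open A -> A `<=` cdom c -> open (cmap c @` A).
Proof.
move=> oA Ac.
rewrite (_ : _ @` A = (cmap c @` cdom c) `&` cinv c @^-1` A).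
  by apply: open_setI_preimage oA; [exact: cmap_open|exact: cinv_cont].
apply/seteqP; split=> [_ [x Ax <-]|_ [[x cx <-]]] /=.
  by split; [exists x => //; exact: Ac|rewrite cmapK//; exact: Ac].
by rewrite cmapK// => Ax; exists x.
Qed.

(** Smoothness of a germ. It holds near every point where it holds, so it combines with [\near]
    statements. *)
Definition smooth_at S T (f : S -> T) (x : S) : Prop :=
  exists A, [/\ open A, A x & smooth_on A f].

Lemma smooth_at_near S T (f : S -> T) x :
  smooth_at f x -> \forall y \near x, smooth_at f y.
Proof. by move=> [A [oA Ax fA]]; apply/open_nearP; exists A; split=> // y Ay;
  exists A. Qed.

Lemma smooth_at_cont S T (f : S -> T) x :
  smooth_at f x -> {for x, continuous f}.
Proof. by move=> [A [_ Ax [cf _]]]; exact: cf. Qed.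

Lemma smooth_at_preimage S T (f : S -> T) x (P : T -> Prop) :
  smooth_at f x -> (\forall y \near f x, P y) -> \forall y \near x, P (f y).
Proof. by move=> /smooth_at_cont cf Pf; exact: (cf _ Pf). Qed.

Lemma smooth_onP S T (A : set S) (f : S -> T) : open A ->
  smooth_on A f <-> forall x, A x -> smooth_at f x.
Proof.
move=> oA; split=> [fA x Ax|fA]; first by exists A.
split=> [x /fA/smooth_at_cont//|c c' Ac Ac'].
apply: Cinfty_local => _ [x [[Ax cx] c'x] <-].
have [B [oB Bx [_ /(_ _ _ Ac Ac') fB]]] := fA x Ax.
by exists (cmap c @` (B `&` cdom c `&` f @^-1` cdom c')) => //; exists x.
Qed.

Lemma smoothP S T (f : S -> T) : smooth f <-> forall x, smooth_at f x.
Proof.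
rewrite /smooth (smooth_onP _ (@openT S)).
by split=> fx x //; exact: fx.
Qed.

(** One pair of charts suffices: for another pair [e], [e'] the coordinate expression is sandwiched
    between two transition maps. *)
Lemma smooth_at_charts S T (f : S -> T) x c c' (A : set S) :
  atlas c -> atlas c' -> open A -> A x -> A `<=` cdom c ->
  (forall y, A y -> cdom c' (f y)) ->
  (forall y, A y -> {for y, continuous f}) ->
  Cinfty (cmap c @` A) (cmap c' \o f \o cinv c) -> smooth_at f x.
Proof.
move=> ac ac' oA Ax Ac fAc' cf Cf; exists A; split=> //; split=> // e e' ae ae'.
pose B := A `&` cdom e `&` f @^-1` cdom e'.
have BA : B `<=` A by move=> y [[]].
have oB : open B.
  apply: open_setI_preimage; [|by move=> y [Ay _]; exact: cf|exact: cdom_open].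
  by apply: openI => //; exact: cdom_open.
have oeB : open (cmap e @` B) by apply: chart_image_open => // y [[]].
have ocB : open (cmap c @` B) by apply: chart_image_open => // y /BA/Ac.
have oc'e' : open (cmap c' @` (cdom c' `&` cdom e')).
  apply: chart_image_open; last by move=> y [].
  by apply: openI; exact: cdom_open.
apply: (@Cinfty_eq _ _ _ _
  ((cmap e' \o cinv c') \o ((cmap c' \o f \o cinv c) \o (cmap c \o cinv e)))).
- exact: oeB.
- move=> _ /[!inE] -[y By <-] /=; have [[Ay ey] e'y] := By.
  by rewrite (cmapK ey) (cmapK (Ac _ Ay)) (cmapK (fAc' _ Ay)).
apply: (@Cinfty_comp _ _ _ _ _ (cmap c' @` (cdom c' `&` cdom e'))) => //.
- move=> _ [y By <-] /=; have [[Ay ey] e'y] := By.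
  rewrite (cmapK ey) (cmapK (Ac _ Ay)); exists (f y) => //; split => //.
  exact: fAc'.
- apply: (@Cinfty_comp _ _ _ _ _ (cmap c @` B)) => //.
  + move=> _ [y By <-] /=; have [[Ay ey] e'y] := By.
    by rewrite (cmapK ey); exists y.
  + apply: Cinfty_sub (atlas_compat ae ac) => _ [y [[Ay ey] _] <-].
    by exists y => //; split => //; exact: Ac.
  by apply: Cinfty_sub Cf => _ [y /BA Ay <-]; exists y.
exact: atlas_compat.
Qed.

Lemma smooth_at_comp S T V (f : S -> T) (g : T -> V) x :
  smooth_at f x -> smooth_at g (f x) -> smooth_at (g \o f) x.
Proof.
move=> [A0 [oA0 A0x [cf Cf]]] [B0 [oB0 B0x [cg Cg]]].
have [c ac cx] := atlas_cover x.
have [c' ac' c'x] := atlas_cover (f x).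
have [c'' ac'' c''x] := atlas_cover (g (f x)).
pose B := B0 `&` cdom c' `&` g @^-1` cdom c''.
have oB : open B.
  apply: open_setI_preimage; [|by move=> y [By _]; exact: cg|exact: cdom_open].
  by apply: openI => //; exact: cdom_open.
pose A := A0 `&` cdom c `&` f @^-1` B.
have oA : open A.
  apply: open_setI_preimage => //; last by move=> y [Ay _]; exact: cf.
  by apply: openI => //; exact: cdom_open.
apply: (@smooth_at_charts _ _ _ _ c c'' A) => //.
- by move=> y [[]].
- by move=> y [_ []].
- move=> y [[Ay _] [[By _] _]].
  by apply: continuous_comp; [exact: cf|exact: cg].
have oc : open (cmap c @` A) by apply: chart_image_open => // y [[]].
apply: (@Cinfty_eq _ _ _ _
  ((cmap c'' \o g \o cinv c') \o (cmap c' \o f \o cinv c))) => //.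
  move=> _ /[!inE] -[y [[Ay cy] [[By c'y] c''y]] <-] /=.
  by rewrite (cmapK cy) (cmapK c'y).
apply: (@Cinfty_comp _ _ _ _ _ (cmap c' @` B)) => //.
- by apply: chart_image_open => // y [[]].
- move=> _ [y [[Ay cy] By] <-] /=; rewrite (cmapK cy); by exists (f y).
- apply: Cinfty_sub (Cf _ _ ac ac') => _ [y [[Ay cy] [[By c'y] c''y]] <-].
  by exists y.
exact: Cg.
Qed.

Lemma smooth_at_eq S T (f g : S -> T) x :
  {near x, f =1 g} -> smooth_at f x -> smooth_at g x.
Proof.
move=> /open_nearP[B [oB Bx fg]] [A0 [oA0 A0x [cf Cf]]].
have [c ac cx] := atlas_cover x.
have [c' ac' c'x] := atlas_cover (f x).
pose A := (A0 `&` B) `&` cdom c `&` f @^-1` cdom c'.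
have oA : open A.
  apply: open_setI_preimage; [|by move=> y [[Ay _] _];
    exact: cf|exact: cdom_open].
  by apply: openI; [exact: openI|exact: cdom_open].
apply: (@smooth_at_charts _ _ _ _ c c' A) => //.
- by move=> y [[]].
- by move=> y [[[_ /fg <-]]].
- move=> y [[[Ay By] _] _]; change (g @ y --> g y); rewrite -(fg _ By).
  apply: cvg_trans (cf y Ay); apply: near_eq_cvg.
  by apply/open_nearP; exists B.
have oc : open (cmap c @` A) by apply: chart_image_open => // y [[]].
apply: (@Cinfty_eq _ _ _ _ (cmap c' \o f \o cinv c)) => //.
  move=> _ /[!inE] -[y [[[Ay By] cy] c'y] <-] /=.
  by rewrite (cmapK cy) (fg _ By).
apply: Cinfty_sub (Cf _ _ ac ac') => _ [y [[[Ay By] cy] c'y] <-].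
by exists y.
Qed.

Lemma smooth_at_id S (x : S) : smooth_at (@id S) x.
Proof.
have [c ac cx] := atlas_cover x.
have oc := @cdom_open _ _ _ c.
apply: (@smooth_at_charts _ _ _ _ c c (cdom c)) => //.
  by move=> y _; exact: cvg_id.
apply: (@Cinfty_sub _ _ _ _ (cmap c @` (cdom c `&` cdom c))).
  by rewrite setIid.
exact: atlas_compat.
Qed.

Lemma smooth_id S : smooth (@id S).
Proof. by apply/smoothP => x; exact: smooth_at_id. Qed.

Lemma smooth_comp S T V (f : S -> T) (g : T -> V) :
  smooth f -> smooth g -> smooth (g \o f).
Proof. by move=> /smoothP sf /smoothP sg; apply/smoothP => x;
  exact: smooth_at_comp. Qed.

Lemma smooth_preimage S T (f : S -> T) x (P : T -> Prop) :
  smooth f -> (\forall y \near f x, P y) -> \forall y \near x, P (f y).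
Proof. by move=> /smoothP sf; exact: smooth_at_preimage. Qed.

Lemma etale_section S T (f : S -> T) x : etale f ->
  exists g : T -> S, [/\ smooth_at g (f x), (\forall y \near x, g (f y) = y) &
    \forall t \near f x, f (g t) = t].
Proof.
move=> [_ /(_ x)[A [g [[oA Ax] ofA sg gf]]]]; exists g.
have fAx : (f @` A) (f x) by exists x.
split; first by exists (f @` A).
  by apply/open_nearP; exists A.
by apply/open_nearP; exists (f @` A); split=> // _ [y Ay <-]; rewrite gf.
Qed.

(** Etale maps are open: a property observed upstairs is carried down along the local section. This
    is how local statements on [S] are checked on the members of a covering. *)
Lemma etale_image_near S T (f : S -> T) x (P : T -> Prop) : etale f ->
  (\forall y \near x, P (f y)) -> \forall t \near f x, P t.
Proof.
move=> /(etale_section x)[g [sg gf fg]] Pf.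
have {}Pf : \forall t \near f x, P (f (g t)).
  apply: (smooth_at_preimage (P := fun y => P (f y)) sg).
  by rewrite (nbhs_singleton gf).
by apply: filterS2 fg Pf => t ->.
Qed.

End manifolds.

(** * Etale spaces over a manifold *)

(* [esec k] is the section of a local homeomorphism onto its [k]-th sheet.
   [esec_neq_open] is what makes the total space Hausdorff. *)
Record etale_data (R : realType) (S : manifold R) := EtaleData {
  epoint :> choiceType;
  eproj : epoint -> S;
  eindex : countType;
  edom : eindex -> set S;
  esec : eindex -> S -> epoint;
  edom_open : forall k, open (edom k);
  esecK : forall k s, edom k s -> eproj (esec k s) = s;
  esec_cover : forall e, exists2 k, edom k (eproj e) & esec k (eproj e) = e;
  esec_eq_open : forall k l,
    open [set s | [/\ edom k s, edom l s & esec k s = esec l s]];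
  esec_neq_open : forall k l,
    open [set s | [/\ edom k s, edom l s & esec k s <> esec l s]]
}.

Arguments eproj {R S D} _ : rename.

Definition etale_space (R : realType) (S : manifold R) (D : etale_data S) :
  Type := D.

Section etale_space.
Variables (R : realType) (S : manifold R) (D : etale_data S).
Local Notation E := (etale_space D).
Implicit Types (k l : eindex D) (B : set E).

(** The final topology of the sections over their domains. As two sections agree on an open set, the
    sheets themselves are open. *)
Definition etale_open B : Prop :=
  forall k, open [set s | edom k s /\ B (esec k s)].

Lemma etale_openT : etale_open setT.
Proof.
move=> k; rewrite (_ : [set _ | _] = edom k); first exact: edom_open.
by apply/seteqP; split=> s // [].
Qed.

Lemma etale_openI : setI_closed etale_open.
Proof.
move=> A B oA oB k; rewrite (_ : [set _ | _] =
  [set s | edom k s /\ A (esec k s)] `&` [set s | edom k s /\ B (esec k s)]).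
  exact: openI.
by apply/seteqP; split=> [s [? []]|s [[? ?] []]].
Qed.

Lemma etale_open_bigU (I : Type) (g : I -> set E) :
  (forall i, etale_open (g i)) -> etale_open (\bigcup_i g i).
Proof.
move=> og k; rewrite (_ : [set _ | _] =
  \bigcup_i [set s | edom k s /\ g i (esec k s)]).
  by apply: bigcup_open => i _; exact: og.
by apply/seteqP; split=> [s [? [i _ ?]]|s [i _ [? ?]]];
  [exists i|split=> //; exists i].
Qed.

HB.instance Definition _ := Choice.on E.
HB.instance Definition _ :=
  isOpenTopological.Build E etale_openT etale_openI etale_open_bigU.

Lemma etale_openP B : open B <-> etale_open B.
Proof. by []. Qed.

Lemma eproj_continuous : continuous (eproj : E -> S).
Proof.
apply/continuousP => A oA; apply/etale_openP => k.
rewrite (_ : [set _ | _] = edom k `&` A);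
  first by apply: openI (edom_open k) oA.
by apply/seteqP; split=> s [ks]; rewrite /= esecK.
Qed.

Lemma esec_continuous k s : edom k s -> {for s, continuous (esec k : S -> E)}.
Proof.
move=> ks A; rewrite nbhsE => -[B [oB Bs] BA].
apply/open_nearP; exists [set s | edom k s /\ B (esec k s)]; split=> //.
by move=> t [_ /BA].
Qed.

Definition esheet k (W : set S) : set E :=
  [set e | [/\ edom k (eproj e), W (eproj e) & esec k (eproj e) = e]].

Lemma esheet_open k W : open W -> open (esheet k W).
Proof.
move=> oW; apply/etale_openP => l; rewrite (_ : [set _ | _] =
  [set s | [/\ edom k s, edom l s & esec k s = esec l s]] `&` W).
  by apply: openI oW; exact: esec_eq_open.
apply/seteqP; split=> s /=.
  by move=> [ls [ks Ws kl]]; move: ks Ws kl; rewrite esecK.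
by move=> [[ks ls kl] Ws]; split=> //; split; rewrite esecK.
Qed.

Section chart.
Variables (k : eindex D) (c : chart R S (mdim S)).
Let dom := esheet k (cdom c).
Let map : E -> 'rV[R]_(mdim S) := cmap c \o eproj.
Let inv : 'rV[R]_(mdim S) -> E := esec k \o cinv c.

Lemma etale_map_image : map @` dom = cmap c @` (edom k `&` cdom c).
Proof.
apply/seteqP; split=> [_ [e [ke ce _] <-]|_ [s [ks cs] <-]].
  by exists (eproj e).
by exists (esec k s); rewrite /map /dom /esheet /= esecK.
Qed.

Lemma etale_map_open : open (map @` dom).
Proof.
rewrite etale_map_image; apply: chart_image_open; last by move=> s [].
by apply: openI; [exact: edom_open|exact: cdom_open].
Qed.

Lemma etale_mapK e : dom e -> inv (map e) = e.
Proof. by move=> [ke ce kE]; rewrite /inv /map /= cmapK. Qed.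

Lemma etale_map_cont e : dom e -> {for e, continuous map}.
Proof.
move=> [_ ce _]; apply: continuous_comp; first exact: eproj_continuous.
exact: cmap_cont.
Qed.

Lemma etale_inv_cont y : (map @` dom) y -> {for y, continuous inv}.
Proof.
rewrite etale_map_image => -[s [ks cs] <-]; apply: continuous_comp.
  by apply: cinv_cont; exists s.
by rewrite cmapK//; exact: esec_continuous.
Qed.

Definition etale_chart : chart R E (mdim S) :=
  @Chart R E (mdim S) dom map inv (esheet_open k (cdom_open c)) etale_map_open
    etale_mapK etale_map_cont etale_inv_cont.
End chart.

Definition etale_atlas_set : set (chart R E (mdim S)) :=
  [set C | exists k c, atlas c /\ C = etale_chart k c].

(** Points over distinct base points are separated downstairs. Two points of one fibre lie on two
    sheets, which are disjoint over the open set where the two sections differ. *)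
Lemma etale_hausdorff : hausdorff_space E.
Proof.
rewrite open_hausdorff => e e' ee'.
have [pp|pp] := eqVneq (eproj e) (eproj e'); last first.
  have := @manifold_hausdorff R S; rewrite open_hausdorff.
  move=> /(_ _ _ pp)[[A B] /= [eA e'B] [oA oB AB]].
  exists (eproj @^-1` A, eproj @^-1` B) => /=.
    by move: eA e'B; rewrite !inE.
  have /continuousP cp := eproj_continuous; split; [exact: cp|exact: cp|].
  by rewrite -preimage_setI (eqP AB) preimage_set0.
have [k ke kE] := esec_cover e; have [l le' lE] := esec_cover e'.
set W := [set s | [/\ edom k s, edom l s & esec k s <> esec l s]].
have oW : open W by exact: esec_neq_open.
have We : W (eproj e).
  by split=> //; [rewrite pp|rewrite kE pp lE; exact/eqP].
exists (esheet k W, esheet l W) => /=.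
  by rewrite !inE; split; split=> //; rewrite -pp.
split; [exact: esheet_open|exact: esheet_open|].
by apply/eqP/seteqP; split=> // z [[_ [_ _ +] kz] [_ _ lz]]; rewrite kz lz.
Qed.

Lemma etale_second_countable : @second_countable E.
Proof.
have [B cB [oB bB]] := @manifold_second_countable R S.
exists [set A | exists k, exists2 b, B b & A = esheet k b].
  rewrite (_ : [set _ | _] =
    (fun p => esheet p.1 p.2) @` ([set: eindex D] `*` B)).
    by apply: sub_countable (card_image_le _ _) _; exact: countableX.
  apply/seteqP; split=> [A [k [b Bb ->]]|A [[k b] [_ Bb] <-]].
    by exists (k, b).
  by exists k, b.
split=> [_ [k [b Bb ->]]|e A].
  by apply: esheet_open; exact: oB.
rewrite nbhsE => -[U [oU Ue] UA].
have [k ke kE] := esec_cover e.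
have [b [Bb be] bO] := bB (eproj e) [set s | edom k s /\ U (esec k s)]
  (open_nbhs_nbhs (conj ((etale_openP U).1 oU k) (conj ke (eq_ind_r U Ue kE)))).
exists (esheet k b) => //=; first by split; [exists k, b|].
by move=> z [_ /bO[_ +] kz]; rewrite kz => /UA.
Qed.

Lemma etale_atlas_cover (e : E) : exists2 C, etale_atlas_set C & cdom C e.
Proof.
have [k ke kE] := esec_cover e; have [c ac ce] := atlas_cover (eproj e).
by exists (etale_chart k c); [exists k, c|].
Qed.

Lemma etale_atlas_compat C C' : etale_atlas_set C -> etale_atlas_set C' ->
  Cinfty (cmap C @` (cdom C `&` cdom C')) (cmap C' \o cinv C).
Proof.
move=> [k [c [ac ->]]] [l [c' [ac' ->]]] /=.
have oi : open (cmap (etale_chart k c) @`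
    (cdom (etale_chart k c) `&` cdom (etale_chart l c'))).
  apply: chart_image_open; last by move=> e [].
  by apply: openI; exact: cdom_open.
apply: (@Cinfty_eq _ _ _ _ (cmap c' \o cinv c)) => //.
  by move=> _ /[!inE] -[e [[ke ce kE] _] <-] /=; rewrite (cmapK ce) kE.
apply: Cinfty_sub (atlas_compat ac ac').
by move=> _ [e [[ke ce kE] [le c'e lE]] <-]; exists (eproj e).
Qed.

Definition etale_manifold : manifold R :=
  @Manifold R E (mdim S) etale_atlas_set etale_hausdorff
    etale_second_countable etale_atlas_cover etale_atlas_compat.

Lemma esec_smooth k s : edom k s -> smooth_at (esec k : S -> etale_manifold) s.
Proof.
move=> ks; have [c ac cs] := atlas_cover s.
pose A := edom k `&` cdom c.
have oA : open A by apply: openI; [exact: edom_open|exact: cdom_open].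
apply: (@smooth_at_charts _ S etale_manifold (esec k) s c (etale_chart k c) A)
  => //.
- by exists k, c.
- by move=> t [].
- by move=> t [kt ct]; split; rewrite esecK.
- by move=> t [kt _]; exact: esec_continuous.
have oc : open (cmap c @` A) by apply: chart_image_open => // t [].
apply: (@Cinfty_eq _ _ _ _ id) => //; last exact: Cinfty_id.
by move=> _ /[!inE] -[t [kt ct] <-] /=; rewrite (cmapK ct) esecK.
Qed.

Lemma eproj_smooth : smooth (eproj : etale_manifold -> S).
Proof.
apply/smoothP => e.
have [k ke kE] := esec_cover e; have [c ac ce] := atlas_cover (eproj e).
have oc := @cdom_open _ _ _ (etale_chart k c).
apply: (@smooth_at_charts _ etale_manifold S eproj e (etale_chart k c) c
  (cdom (etale_chart k c))) => //.
- by exists k, c.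
- by move=> f [].
- by move=> f _; exact: eproj_continuous.
have oi : open (cmap (etale_chart k c) @` cdom (etale_chart k c)).
  exact: chart_image_open.
apply: (@Cinfty_eq _ _ _ _ id) => //; last exact: Cinfty_id.
by move=> _ /[!inE] -[f [kf cf kE'] <-] /=; rewrite (cmapK cf) esecK.
Qed.

Lemma eproj_etale : etale (eproj : etale_manifold -> S).
Proof.
split=> [|e]; first exact: eproj_smooth.
have [k ke kE] := esec_cover e.
have im : eproj @` esheet k setT = edom k.
  apply/seteqP; split=> [_ [f [kf _ _] <-] //|s ks].
  by exists (esec k s); rewrite /esheet /= esecK.
exists (esheet k setT), (esec k); rewrite im; split.
- by split=> //; exact/esheet_open/openT.
- exact: edom_open.
- by apply/smooth_onP; [exact: edom_open|move=> s; exact: esec_smooth].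
by move=> f [].
Qed.
End etale_space.

(** * Open submanifolds, as etale spaces with a single sheet *)

Section open_submanifold.
Variables (R : realType) (S : manifold R) (A : set S) (oA : open A).
Variables (x0 : S) (Ax0 : A x0).

Definition open_point : Type := {x : S | `[< A x >]}.
HB.instance Definition _ := Choice.on open_point.

Definition open_incl (x : open_point) : S := val x.

(** A section has to be a total function on [S]; outside [A] it takes the default value [x0]. *)
Definition open_retract (_ : unit) (s : S) : open_point :=
  insubd (exist _ x0 (asboolT Ax0) : open_point) s.

Lemma open_retractK k s : A s -> open_incl (open_retract k s) = s.
Proof. by move=> As; rewrite /open_incl insubdK//; exact/asboolP. Qed.

Lemma open_retract_cover (x : open_point) :
  exists2 k : unit, A (open_incl x) & open_retract k (open_incl x) = x.
Proof. by exists tt; [exact/asboolP/(valP x)|exact: valKd]. Qed.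

Lemma open_retract_eq (k l : unit) :
  open [set s | [/\ A s, A s & open_retract k s = open_retract l s]].
Proof.
rewrite (_ : [set _ | _] = A) //; apply/seteqP; split=> s; first by case.
by case: k l => [] [].
Qed.

Lemma open_retract_neq (k l : unit) :
  open [set s | [/\ A s, A s & open_retract k s <> open_retract l s]].
Proof.
rewrite (_ : [set _ | _] = set0); first exact: open0.
by apply/seteqP; split=> s // [_ _]; case: k l => [] [].
Qed.

Definition open_data : etale_data S := @EtaleData R S open_point open_incl
  unit (fun=> A) open_retract (fun=> oA) open_retractK open_retract_cover
  open_retract_eq open_retract_neq.

(** Descent data speak only of maps defined on whole manifolds. A map known to be smooth only near
    [x0] becomes such a map after restriction to [T]. *)
Lemma open_submanifold : exists (T : manifold R) (i : T -> S) (r : S -> T),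
  [/\ smooth i, forall t, A (i t), (forall s, A s -> smooth_at r s),
      (forall s, A s -> i (r s) = s) & forall t, r (i t) = t].
Proof.
exists (etale_manifold open_data), (@eproj _ _ open_data), (open_retract tt).
split.
- exact: eproj_smooth.
- by move=> t; exact/asboolP/(valP t).
- by move=> s; exact: (@esec_smooth _ _ open_data tt).
- by move=> s; exact: open_retractK.
- by move=> t; exact: valKd.
Qed.
End open_submanifold.

(** * The quotient stack of an etale groupoid *)

(** [arr g m n] reads: the arrow with label [g] and source [m] has target [n]. For fixed [g] this is
    the graph of a partial map with open domain, smooth by [arr_etale] and with inverse labelled by
    the inverse of [g]. *)
Record etale_groupoid (R : realType) (G : finGroupType) (M : manifold R) :=
  EtaleGroupoid {
    arr : G -> M -> M -> Prop;
    arr1 : forall m, arr 1%g m m;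
    arrM : forall g h m n o, arr g m n -> arr h n o -> arr (g * h)%g m o;
    arrV : forall g m n, arr g m n -> arr g^-1%g n m;
    arr_fun : forall g m n n', arr g m n -> arr g m n' -> n = n';
    arr_etale : forall g m n, arr g m n -> exists phi : M -> M,
      smooth_at phi m /\ \forall m' \near m, arr g m' (phi m')
  }.

Section groupoid_stack.
Variables (R : realType) (G : finGroupType) (M : manifold R).
Variable H : etale_groupoid G M.
Implicit Types S T V : manifold R.
Local Notation "a ** b" := (a * b)%g (at level 40, left associativity).

Definition arrow_from (g : G) (m : M) := exists n, arr H g m n.

(* [fval] need not be continuous.  [floc s l] says that relabelling [fval] by
   [l] makes it smooth near [s]; by [floc_const] and [floc_mul] the germs at [s]
   of such labellings are the fibre at [s] of a torsor under the groupoid. *)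
Record qmap S := QMap {
  fval : S -> M;
  floc : S -> set (S -> G);
  floc_ex : forall s, exists l, floc s l;
  floc_near : forall s l, floc s l -> \forall t \near s, floc t l;
  floc_smooth : forall s l, floc s l -> exists phi : S -> M,
    smooth_at phi s /\ \forall t \near s, arr H (l t) (fval t) (phi t);
  floc_const : forall s l k, floc s l -> floc s k ->
    exists g, \forall t \near s, k t = l t ** g;
  floc_mul : forall s l k, floc s l -> arrow_from (k s) (fval s) ->
    (exists g, \forall t \near s, k t = l t ** g) -> floc s k
}.

Lemma floc_arrow S (x : qmap S) s l : floc x s l -> arrow_from (l s) (fval x s).
Proof.
move=> /floc_smooth[phi [_ /nbhs_singleton a]]; by exists (phi s).
Qed.

Lemma floc_eq S (x : qmap S) s l k :
  floc x s l -> (\forall t \near s, k t = l t) -> floc x s k.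
Proof.
move=> xl kl; apply: (floc_mul xl).
  by rewrite (nbhs_singleton kl); exact: floc_arrow.
by exists 1%g; apply: filterS kl => t ->; rewrite mulg1.
Qed.

(** Since [l s] and [l s ** g] both start at [fval x s], there is an arrow labelled [g] starting at
    [phi s]. Its local extension composed with [phi] is the function sought. *)
Lemma floc_shift S (x : qmap S) s l g :
  floc x s l -> arrow_from (l s ** g) (fval x s) ->
  exists phi : S -> M,
    smooth_at phi s /\ \forall t \near s, arr H (l t ** g) (fval x t) (phi t).
Proof.
move=> /floc_smooth[phi [sphi phiE]] [n an].
have ag : arr H g (phi s) n.
  by have := arrM (arrV (nbhs_singleton phiE)) an; rewrite mulKg.
have [psi [spsi psiE]] := arr_etale ag.
exists (psi \o phi); split; first exact: smooth_at_comp.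
have {}psiE : \forall t \near s, arr H g (phi t) (psi (phi t)).
  exact: (smooth_at_preimage sphi psiE).
by apply: filterS2 phiE psiE => t; exact: arrM.
Qed.

Lemma floc_shift_near S (x : qmap S) s l g :
  floc x s l -> arrow_from (l s ** g) (fval x s) ->
  \forall t \near s, arrow_from (l t ** g) (fval x t).
Proof.
move=> xl /(floc_shift xl)[phi [_ phiE]].
by apply: filterS phiE => t a; exists (phi t).
Qed.

(** [flab] is no more continuous than [fval]. The clause [flab_loc] says that it carries labellings
    of the target to labellings of the source, that is, that it is a map of torsors. *)
Record farrow S T (x : qmap S) (y : qmap T) := FArrow {
  fbase : S -> T;
  flab : S -> G;
  fbase_smooth : smooth fbase;
  flab_arr : forall s, arr H (flab s) (fval x s) (fval y (fbase s));
  flab_loc : forall s l, floc y (fbase s) l ->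
    floc x s (fun t => flab t ** l (fbase t))
}.

Lemma farrow_eq S T (x : qmap S) (y : qmap T) (u v : farrow x y) :
  fbase u = fbase v -> flab u = flab v -> u = v.
Proof.
case: u v => [f l sf al ll] [f' l' sf' al' ll'] /= ff' lll'.
move: sf' al' ll'; rewrite -ff' -lll' => sf' al' ll'.
by congr FArrow; exact: Prop_irrelevance.
Qed.

Program Definition farrow_id S (x : qmap S) : farrow x x :=
  @FArrow S S x x id (fun=> 1%g) (@smooth_id R S) _ _.
Next Obligation. by move=> S x s; exact: arr1. Qed.
Next Obligation.
move=> S x s l xl; apply: floc_eq xl _.
by apply: filterE => t; rewrite mul1g.
Qed.

Program Definition farrow_comp S T V (x : qmap S) (y : qmap T)
    (z : qmap V) (u : farrow x y) (v : farrow y z) : farrow x z :=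
  @FArrow S V x z (fbase v \o fbase u)
    (fun s => flab u s ** flab v (fbase u s))
    (smooth_comp (fbase_smooth u) (fbase_smooth v)) _ _.
Next Obligation. by move=> *; apply: arrM; exact: flab_arr. Qed.
Next Obligation.
move=> S T V x y z u v s l /(flab_loc (f := v))/(flab_loc (f := u)) xl.
by apply: floc_eq xl _; apply: filterE => t; rewrite mulgA.
Qed.

Section pullback.
Variables (S T : manifold R) (f : S -> T) (sf : smooth f) (y : qmap T).

(** The composites [l \o f] are closed up under right translation and under changes away from [s],
    as [floc_mul] demands; the result need not factor through [f]. *)
Definition pull_loc (s : S) (k : S -> G) : Prop :=
  exists l, [/\ floc y (f s) l, arrow_from (k s) (fval y (f s)) &
    exists g, \forall t \near s, k t = l (f t) ** g].

Let fcont (s : S) (P : T -> Prop) :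
  (\forall t \near f s, P t) -> \forall t \near s, P (f t).
Proof. exact: smooth_preimage. Qed.

Lemma pull_loc_ex s : exists l, pull_loc s l.
Proof.
have [l yl] := floc_ex y (f s); exists (l \o f), l; split=> //.
  exact: (floc_arrow yl).
by exists 1%g; apply: filterE => t; rewrite mulg1.
Qed.

Lemma pull_loc_near s l : pull_loc s l -> \forall t \near s, pull_loc t l.
Proof.
move=> [k [yk al [g lk]]].
have yk' := fcont (floc_near yk).
rewrite (nbhs_singleton lk) in al.
have al' := fcont (floc_shift_near yk al).
near=> t; exists k; split.
- by near: t.
- rewrite (near lk t)//; by near: t.
by exists g; near: t; exact: near_join.
Unshelve. all: by end_near. Qed.

Lemma pull_loc_smooth s l : pull_loc s l -> exists phi : S -> M,
  smooth_at phi s /\ \forall t \near s, arr H (l t) (fval y (f t)) (phi t).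
Proof.
move=> [k [yk al [g lk]]]; rewrite (nbhs_singleton lk) in al.
have [phi [sphi /fcont phiE]] := floc_shift yk al.
exists (phi \o f); split.
  by apply: smooth_at_comp => //; move: s {yk al lk sphi phiE}; exact/smoothP.
by apply: filterS2 lk phiE => t ->.
Qed.

Lemma pull_loc_const s l k : pull_loc s l -> pull_loc s k ->
  exists g, \forall t \near s, k t = l t ** g.
Proof.
move=> [l' [yl _ [g lE]]] [k' [yk _ [h kE]]].
have [c /fcont cE] := floc_const yl yk.
exists (g^-1 ** c ** h); near=> t.
rewrite (near lE t)// (near kE t)// (near cE t)// !mulgA.
by rewrite -(mulgA _ g) mulgV mulg1.
Unshelve. all: by end_near. Qed.

Lemma pull_loc_mul s l k : pull_loc s l -> arrow_from (k s) (fval y (f s)) ->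
  (exists g, \forall t \near s, k t = l t ** g) -> pull_loc s k.
Proof.
move=> [l' [yl _ [g lE]]] ak [h kE]; exists l'; split=> //.
by exists (g ** h); apply: filterS2 lE kE => t -> ->; rewrite mulgA.
Qed.

Definition pull : qmap S := @QMap S (fval y \o f) pull_loc pull_loc_ex
  pull_loc_near pull_loc_smooth pull_loc_const pull_loc_mul.

Lemma pull_arrow_loc s l : floc y (f s) l ->
  floc pull s (fun t => 1%g ** l (f t)).
Proof.
move=> yl; exists l; split=> //; first by rewrite mul1g; exact: (floc_arrow yl).
by exists 1%g; apply: filterE => t; rewrite mul1g mulg1.
Qed.

Definition pull_arrow : farrow pull y :=
  @FArrow S T pull y f (fun=> 1%g) sf (fun s => arr1 H _) pull_arrow_loc.
End pullback.

(** Labels live in a group, so the equation [farrow_comp w u = v] forces the label of [w]. *)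
Lemma farrow_cartesian S T V (x : qmap S) (y : qmap T) (z : qmap V)
    (u : farrow y z) (v : farrow x z) (f : S -> T) :
  smooth f -> fbase v = fbase u \o f ->
  exists! w : farrow x y, fbase w = f /\ farrow_comp w u = v.
Proof.
move=> sf vE.
pose lab s := flab v s ** (flab u (f s))^-1.
have alab s : arr H (lab s) (fval x s) (fval y (f s)).
  apply: arrM (flab_arr v s) _; rewrite vE; exact/arrV/flab_arr.
have llab s l : floc y (f s) l -> floc x s (fun t => lab t ** l (f t)).
  (* A labelling [k] of [z] is pulled back to [y] along [u] and to [x] along [v]. On [y] it differs
     from [l] by a constant [g], and the same [g] serves on [x]. *)
  move=> yl; have [k zk] := floc_ex z (fbase u (f s)).
  have [g gE] := floc_const (flab_loc zk) yl.
  have xk : floc x s (fun t => flab v t ** k (fbase v t)).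
    by apply: flab_loc; rewrite vE.
  apply: (floc_mul xk).
    by have [n an] := floc_arrow yl; exists n; exact: arrM an.
  exists g; have {}gE : \forall t \near s,
      l (f t) = flab u (f t) ** k (fbase u (f t)) ** g.
    exact: (smooth_preimage sf gE).
  by apply: filterS gE => t ->; rewrite vE /lab /= !mulgA mulgKV.
exists (FArrow sf alab llab); split.
  split=> //; apply: farrow_eq => //=; apply/funext => s /=.
  by rewrite /lab mulgKV.
move=> w [wf wv]; apply: farrow_eq => //=; apply/funext => s.
by rewrite /lab -wv /= -wf mulgK.
Qed.

Program Definition groupoid_cfg : cfg R :=
  @Cfg R qmap farrow farrow_id farrow_comp _ _ _ fbase
    (fun S T x y u => fbase_smooth u) _ _ _ farrow_cartesian.
Next Obligation.
by move=> S T x y u; apply: farrow_eq => //=; apply/funext => s; rewrite mul1g.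
Qed.
Next Obligation.
by move=> S T x y u; apply: farrow_eq => //=; apply/funext => s; rewrite mulg1.
Qed.
Next Obligation.
by move=> *; apply: farrow_eq => //=; apply/funext => s; rewrite mulgA.
Qed.
Next Obligation. by []. Qed.
Next Obligation. by []. Qed.
Next Obligation.
by move=> S T f y sf; exists (pull sf y), (pull_arrow sf y).
Qed.

End groupoid_stack.

Arguments qmap {R G M} H S.

(** * Descent of arrows and of objects *)

Section gluing.
Variables (R : realType) (G : finGroupType) (M : manifold R).
Variable H : etale_groupoid G M.
Implicit Types S T V : manifold R.
Local Notation "a ** b" := (a * b)%g (at level 40, left associativity).
Local Notation pt := (point_manifold R).
Local Notation pt0 := (0 : 'rV[R]_0).
Local Notation X := (groupoid_cfg H).

(** On a one-point manifold any two labellings differ by a right translation, so only the arrow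
    condition remains. *)
Lemma floc_point (z : qmap H pt) s k :
  arrow_from H (k s) (fval z s) -> floc z s k.
Proof.
move=> ak; have [l zl] := floc_ex z s; apply: (floc_mul zl ak).
by exists ((l s)^-1 ** k s)%g; apply: filterE => t;
  rewrite (rV0_all t s) mulKVg.
Qed.

Section point_arrow.
Variables (z : qmap H pt) (T : manifold R) (y : qmap H T) (t : T) (g : G).
Hypothesis a : arr H g (fval z pt0) (fval y t).

Lemma point_arrow_arr (s : pt) : arr H g (fval z s) (fval y t).
Proof. by rewrite (rV0_all s 0). Qed.

Lemma point_arrow_loc (s : pt) (l : T -> G) :
  floc y t l -> floc z s (fun=> g ** l t).
Proof.
move=> /floc_arrow[n an]; apply: floc_point; exists n.
exact: arrM (point_arrow_arr s) an.
Qed.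

(** Over a point every groupoid element gives an arrow. These arrows are the probes by which global
    data are read off label by label. *)
Definition point_arrow : farrow z y :=
  @FArrow _ _ _ H pt T z y (fun=> t) (fun=> g) (smooth_cst _ t)
    point_arrow_arr point_arrow_loc.
End point_arrow.

Definition fibre T (y : qmap H T) (t : T) : qmap H pt :=
  pull (smooth_cst pt t) y.

Definition fibre_arrow T (y : qmap H T) (t : T) : farrow (fibre y t) y :=
  pull_arrow (smooth_cst pt t) y.

Lemma covering_smooth S I (U : I -> manifold R) (f : forall i, U i -> S) i :
  covering f -> smooth (f i).
Proof. by move=> [/(_ i)[[]]]. Qed.

(** The required equation fixes the label at [f i t] to be [q i t]. What has to be shown is that
    this does not depend on the preimage [t], and that the result is a map of torsors. *)
Lemma groupoid_glue_arrows : glue_arrows X.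
Proof.
move=> S I U f x y x' u v cf uf vf uv.
have [ef fsurj] := cf.
pose q i t := (flab (u i) t)^-1%g ** flab (v i) t.
have au i t : arr H (flab (u i) t) (fval (x' i) t) (fval x (f i t)).
  by rewrite -uf; exact: flab_arr.
have av i t : arr H (flab (v i) t) (fval (x' i) t) (fval y (f i t)).
  by rewrite -vf; exact: flab_arr.
(* Apply the compatibility hypothesis to two arrows out of the fibre at [t]: the canonical one, and
   a point arrow to [x' j] whose label makes the two composites to [x] equal. *)
have qE i j t t' : f i t = f j t' -> q i t = q j t'.
  move=> ff; pose z := fibre (x' i) t.
  have ab : arr H (flab (u i) t ** (flab (u j) t')^-1%g) (fval z pt0)
      (fval (x' j) t').
    by apply: arrM (au i t) _; rewrite ff; exact: arrV.
  have := uv i j pt z (fibre_arrow (x' i) t) (point_arrow ab).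
  have -> : Defs.comp (c := X) (fibre_arrow (x' i) t) (u i) =
            Defs.comp (c := X) (point_arrow ab) (u j).
    apply: farrow_eq; apply/funext => s /=.
      by rewrite (uf i : fbase (u i) = _) (uf j : fbase (u j) = _).
    by rewrite mul1g mulgKV.
  move=> /(_ erefl)/(congr1 (fun w : farrow z y => flab w pt0)) /=.
  by rewrite mul1g -mulgA /q => ->; rewrite mulKg.
pose lab s := let it := cid (fsurj s) in q (projT1 it) (projT1 (cid (projT2
  it))).
have labE i t : lab (f i t) = q i t.
  by rewrite /lab; case: cid => j pj /=; case: cid => t' /= ft'; exact: qE.
have alab s : arr H (lab s) (fval x s) (fval y s).
  have [i [t <-]] := fsurj s; rewrite labE.
  exact: arrM (arrV (au i t)) (av i t).
have llab s l : floc y s l -> floc x s (fun t => lab t ** l t).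
  have [i [t <-]] := fsurj s => yl.
  (* Labellings [l] of [y] and [k] of [x] both pull back to labellings of [x' i], so they differ
     there by a constant [g]; the etale map [f i] carries this relation down to [S]. *)
  have [k xk] := floc_ex x (f i t).
  have vl : floc (x' i) t (fun t' => flab (v i) t' ** l (f i t')).
    have := @flab_loc _ _ _ _ _ _ _ _ (v i) t l.
    by rewrite (vf i : fbase (v i) = _); exact.
  have uk : floc (x' i) t (fun t' => flab (u i) t' ** k (f i t')).
    have := @flab_loc _ _ _ _ _ _ _ _ (u i) t k.
    by rewrite (uf i : fbase (u i) = _); exact.
  have [g gE] := floc_const uk vl.
  apply: (floc_mul xk).
    by have [n an] := floc_arrow yl; exists n; apply: arrM an; exact: alab.
  exists g; apply: (etale_image_near (P := fun s =>
    lab s ** l s = k s ** g) (ef i).1).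
  apply: filterS gE => t' gE; rewrite labE /q -mulgA gE.
  by rewrite -mulgA mulKg.
exists (@FArrow _ _ _ H S S x y id lab (@smooth_id R S) alab llab); split.
  split=> // i; apply: farrow_eq => /=;
    first by rewrite (uf i : fbase (u i) = _) (vf i : fbase (v i) = _).
  apply/funext => t; rewrite /= (uf i : fbase (u i) = _) labE /q.
  by rewrite mulKVg.
move=> w [wid wE]; apply: farrow_eq => //=; apply/funext => s.
have [i [t <-]] := fsurj s; rewrite labE /q -(wE i) /=.
by rewrite (uf i : fbase (u i) = _) mulKg.
Qed.

Section glue_objects.
Variables (S : manifold R) (I : Type) (U : I -> manifold R).
Variables (f : forall i, U i -> S) (x : forall i, qmap H (U i)).
Variable E : forall i j (T : manifold R) (z : qmap H T),
  farrow z (x i) -> farrow z (x j) -> Prop.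
Hypothesis cf : covering f.
Hypothesis dd : @descent_datum R X S I U f x E.

(** The label of the transition isomorphism at the point [(t, t')] of the overlap, read off on the
    fibre over the one-point manifold. *)
Definition transition i (t : U i) j (t' : U j) (g : G) : Prop :=
  exists b : farrow (fibre (x i) t) (x j),
    [/\ fbase b = (fun=> t'), flab b = (fun=> g) &
        E (fibre_arrow (x i) t) b].

Lemma transition_ex i (t : U i) j (t' : U j) :
  f t = f t' -> exists g, transition t t' g.
Proof.
move=> ff.
have [||b [[bb Eb] _]] := @descent_fun _ _ _ _ _ _ _ _ dd i j pt _
  (fibre_arrow (x i) t) (fun=> t'); first exact: smooth_cst.
  by apply/funext => s /=.
exists (flab b pt0), b; split=> //.
by apply/funext => s; rewrite (rV0_all s 0).
Qed.

Lemma transition_base i (t : U i) j (t' : U j) g :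
  transition t t' g -> f t = f t'.
Proof.
move=> [b [bb _ Eb]]; have := congr1 (@^~ pt0) (descent_base dd Eb).
by rewrite /= bb.
Qed.

Lemma transition_arr i (t : U i) j (t' : U j) g :
  transition t t' g -> arr H g (fval (x i) t) (fval (x j) t').
Proof.
by move=> [b [bb lb _]]; have := flab_arr b pt0; rewrite bb lb.
Qed.

Lemma transition_fun i (t : U i) j (t' : U j) g h :
  transition t t' g -> transition t t' h -> g = h.
Proof.
move=> tg th; have ff := transition_base tg.
have [||c [_ cu]] := @descent_fun _ _ _ _ _ _ _ _ dd i j pt _
  (fibre_arrow (x i) t) (fun=> t'); first exact: smooth_cst.
  by apply/funext => s /=.
have [b [bb lb Eb]] := tg; have [b' [bb' lb' Eb']] := th.
have bb'E : b = b' by rewrite -(cu b (conj bb Eb)) -(cu b' (conj bb' Eb')).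
by have := congr1 (@^~ pt0) lb; rewrite bb'E lb'.
Qed.

Lemma transition_comp i (t : U i) j (t' : U j) k (t'' : U k) g h :
  transition t t' g -> transition t' t'' h -> transition t t'' (g ** h).
Proof.
move=> tg [c [cb lc Ec]]; have ag := transition_arr tg.
have [b [bb lb Eb]] := tg.
have e : arr H g (fval (fibre (x i) t) pt0) (fval (fibre (x j) t') pt0) by [].
pose e' := point_arrow e.
exists (farrow_comp e' c); split.
- by rewrite /= cb.
- by rewrite /= lc.
(* [b] factors through the fibre at [t'], so naturality along [e'] puts both relations on the fibre
   at [t], where the cocycle condition applies. *)
have be : b = farrow_comp e' (fibre_arrow (x j) t').
  apply: farrow_eq; rewrite ?bb ?lb //.
  by apply/funext => s /=; rewrite mulg1.
apply: (descent_cocycle dd) Eb _.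
by rewrite be; exact: (descent_natural dd e' Ec).
Qed.

(** Naturality along the point arrow labelled by the inverse of [flab a s] turns [a] into the
    canonical arrow of the fibre at [fbase a s]. *)
Lemma transitionE i j T (z : qmap H T) (a : farrow z (x i))
    (b : farrow z (x j)) (s : T) : E a b ->
  transition (fbase a s) (fbase b s) ((flab a s)^-1%g ** flab b s).
Proof.
move=> Eab.
have e : arr H (flab a s)^-1%g (fval (fibre (x i) (fbase a s)) pt0) (fval z s).
  exact/arrV/flab_arr.
exists (farrow_comp (point_arrow e) b); split=> //.
have -> : fibre_arrow (x i) (fbase a s) = farrow_comp (point_arrow e) a.
  by apply: farrow_eq => //=; apply/funext => r; rewrite /= mulVg.
exact: (descent_natural dd (point_arrow e) Eab).
Qed.

(** Labels at single points know nothing of smoothness. Here the descent datum is applied to a whole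
    neighbourhood of [t0], mapped to [U j] through a local section of [f j]; the last clause is
    [flab_loc] of the arrow so obtained. *)
Lemma transition_smooth i (t0 : U i) j (t0' : U j) : f t0 = f t0' ->
  exists (g : U i -> U j) (b : U i -> G), [/\ g t0 = t0',
    \forall t \near t0, transition t (g t) (b t) &
    forall l, floc (x j) t0' l -> floc (x i) t0 (fun t => b t ** l (g t))].
Proof.
move=> ff.
have [ef fsurj] := cf.
have [r [sr rf fr]] := etale_section t0' (ef j).1.
rewrite -ff in sr fr.
have sfi := covering_smooth i cf.
have [A [oA At0 Ar]] : exists A : set (U i), [/\ open A, A t0 &
    A `<=` [set t | smooth_at r (f t) /\ f (r (f t)) = f t]].
  apply/open_nearP.
  apply: (smooth_preimage (P := fun s => smooth_at r s /\ f (r s) = s) sfi).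
  near=> s; split; last by near: s.
  by near: s; exact: smooth_at_near.
(* On [V] the composite of [r] and [f i] is smooth and lies over [S], so [descent_fun] lifts it to
   an arrow [b] out of the restriction [z] of [x i]. *)
have [V [inc [ret [sinc Ainc sret incK retK]]]] := open_submanifold oA At0.
pose z := pull sinc (x i); pose a : farrow z (x i) := pull_arrow sinc (x i).
have srfi : smooth (fun v => r (f (inc v))).
  apply/smoothP => v; apply: (@smooth_at_comp _ _ _ _ (fun v => f (inc v)) r).
    by move: v; apply/smoothP/smooth_comp.
  by have [] := Ar _ (Ainc v).
have [|b [[bb Eb] _]] := @descent_fun _ _ _ _ _ _ _ _ dd i j V z a _ srfi.
  by apply/funext => v /=; have [_ ->] := Ar _ (Ainc v).
exists (r \o f (i := i)), (flab b \o ret); split.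
- by rewrite /= ff (nbhs_singleton rf).
- apply: filterS (open_nbhs_nbhs (conj oA At0)) => t At.
  have := transitionE (ret t) Eb.
  by rewrite (bb : fbase b = _) /= incK// invg1 mul1g.
move=> l xl.
have := @flab_loc _ _ _ _ _ _ _ _ b (ret t0) l.
rewrite (bb : fbase b = _) incK// ff (nbhs_singleton rf) => /(_ xl).
move=> [k [xk ak [g gE]]]; rewrite /= incK// in xk ak.
have rt0 : smooth_at ret t0 by exact: sret.
have nA : \forall t \near t0, A t by exact: open_nbhs_nbhs.
apply: (floc_mul xk).
  exact: ak.
exists g; have {}gE := smooth_at_preimage rt0 gE.
by apply: filterS2 gE nA => t; rewrite /= => + At; rewrite incK.
Unshelve. all: by end_near. Qed.

Lemma cover_point (s : S) : {i : I & {t : U i | f t = s}}.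
Proof.
by have [_ /(_ s)/cid[i /cid[t ft]]] := cf; exists i, t.
Qed.

Let ci (s : S) : I := projT1 (cover_point s).
Let ct (s : S) : U (ci s) := projT1 (projT2 (cover_point s)).

Let ctE s : f (ct s) = s.
Proof. exact: (projT2 (projT2 (cover_point s))). Qed.

Lemma glued_lab_ex i (t : U i) : exists g, transition t (ct (f t)) g.
Proof. by apply: transition_ex; rewrite ctE. Qed.

Definition glued_lab i (t : U i) : G := projT1 (cid (glued_lab_ex t)).

Lemma glued_labP i (t : U i) s :
  f t = s -> transition t (ct s) (glued_lab t).
Proof. by move=> <-; rewrite /glued_lab; case: cid. Qed.

Definition glued_val (s : S) : M := fval (x (ci s)) (ct s).

Lemma glued_lab_arr i (t : U i) :
  arr H (glued_lab t) (fval (x i) t) (glued_val (f t)).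
Proof. exact/transition_arr/glued_labP. Qed.

Lemma glued_lab_transition i (t : U i) j (t' : U j) g :
  transition t t' g -> glued_lab t = g ** glued_lab t'.
Proof.
move=> tg; have ff := transition_base tg.
exact: transition_fun (glued_labP ff) (transition_comp tg (glued_labP erefl)).
Qed.

Definition glued_loc (s : S) (l : S -> G) : Prop := forall i (t : U i),
  f t = s -> floc (x i) t (fun t' => glued_lab t' ** l (f t')).

(** One preimage suffices. Near another preimage [t'], [transition_smooth] transports the labelling,
    and the transported labels are right because [glued_lab] is multiplicative along transitions. *)
Lemma glued_locP i (t : U i) l :
  floc (x i) t (fun t' => glued_lab t' ** l (f t')) -> glued_loc (f t) l.
Proof.
move=> xl j t' ff.
have [g [b [gt' trg gbl]]] := transition_smooth ff.
apply: floc_eq (gbl _ xl) _.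
apply: filterS trg => t1 tr1.
by rewrite (glued_lab_transition tr1) mulgA (transition_base tr1).
Qed.

Lemma glued_loc_ex s : exists l, glued_loc s l.
Proof.
have [i [t <-]] := cf.2 s.
have [r [sr rf fr]] := etale_section t (cf.1 i).1.
have [l xl] := floc_ex (x i) t.
(* The factor [glued_lab] is cancelled in advance, so that the pullback to [U i] is [l] itself near
   [t]. *)
exists (fun s => (glued_lab (r s))^-1%g ** l (r s)); apply: glued_locP.
by apply: floc_eq xl _; apply: filterS rf => t' ->; rewrite mulKVg.
Qed.

Lemma glued_loc_near s l : glued_loc s l -> \forall t \near s, glued_loc t l.
Proof.
have [i [t <-]] := cf.2 s => yl.
apply: (etale_image_near (P := fun s => glued_loc s l) (cf.1 i).1).
apply: filterS (floc_near (yl i t erefl)) => t'; exact: glued_locP.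
Qed.

Lemma glued_loc_smooth s l : glued_loc s l -> exists phi : S -> M,
  smooth_at phi s /\ \forall t \near s, arr H (l t) (glued_val t) (phi t).
Proof.
have [i [t <-]] := cf.2 s => /(_ i t erefl)/floc_smooth[phi [sphi phiE]].
have [r [sr rf fr]] := etale_section t (cf.1 i).1.
exists (phi \o r); split.
  by apply: smooth_at_comp => //; rewrite (nbhs_singleton rf).
apply: (etale_image_near (P := fun s => arr H (l s) (glued_val s) (phi (r s)))
  (cf.1 i).1).
apply: filterS2 rf phiE => t' -> at'.
by have := arrM (arrV (glued_lab_arr t')) at'; rewrite mulKg.
Qed.

Lemma glued_loc_const s l k : glued_loc s l -> glued_loc s k ->
  exists g, \forall t \near s, k t = l t ** g.
Proof.
have [i [t <-]] := cf.2 s => yl yk.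
have [g gE] := floc_const (yl i t erefl) (yk i t erefl).
exists g; apply: (etale_image_near (P := fun s => k s = l s ** g) (cf.1 i).1).
by apply: filterS gE => t'; rewrite -mulgA => /mulgI.
Qed.

Lemma glued_loc_mul s l k : glued_loc s l -> arrow_from H (k s) (glued_val s) ->
  (exists g, \forall t \near s, k t = l t ** g) -> glued_loc s k.
Proof.
move=> yl [n an] [g gE] i t ft; rewrite -ft in an gE.
apply: (floc_mul (yl i t ft)).
  by exists n; apply: arrM an; exact: glued_lab_arr.
exists g; have {}gE := smooth_preimage (covering_smooth i cf) gE.
by apply: filterS gE => t' ->; rewrite mulgA.
Qed.

Definition glued : qmap H S := @QMap _ _ _ H S glued_val glued_loc
  glued_loc_ex glued_loc_near glued_loc_smooth glued_loc_const glued_loc_mul.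

Definition glued_arrow i : farrow (x i) glued :=
  @FArrow _ _ _ H (U i) S (x i) glued (f (i := i)) (@glued_lab i)
    (covering_smooth i cf) (@glued_lab_arr i)
    (fun t l (yl : glued_loc (f t) l) => yl i t erefl).

Lemma glued_arrowE i j T (z : qmap H T) (a : farrow z (x i))
    (b : farrow z (x j)) : E a b ->
  farrow_comp a (glued_arrow i) = farrow_comp b (glued_arrow j).
Proof.
move=> Eab; apply: farrow_eq; first exact: (descent_base dd Eab).
apply/funext => s /=; rewrite (glued_lab_transition (transitionE s Eab)).
by rewrite mulgA mulKVg.
Qed.
End glue_objects.

Lemma groupoid_is_stack : is_stack X.
Proof.
split; first exact: groupoid_glue_arrows.
move=> S I U f x E cf dd; exists (glued cf dd), (glued_arrow cf dd); split=> //.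
by move=> i j T z a b; exact: glued_arrowE.
Qed.
End gluing.

(** * The etale atlas and the coarse space *)

Section atlas.
Variables (R : realType) (G : finGroupType) (M : manifold R).
Variable H : etale_groupoid G M.
Implicit Types S T V : manifold R.
Local Notation "a ** b" := (a * b)%g (at level 40, left associativity).
Local Notation pt := (point_manifold R).
Local Notation pt0 := (0 : 'rV[R]_0).
Local Notation X := (groupoid_cfg H).

(** The underlying map of the atlas is the identity, which is smooth already; its labellings are
    therefore the locally constant ones. *)
Definition atlas_loc (m : M) (k : M -> G) : Prop :=
  exists g, arrow_from H g m /\ \forall t \near m, k t = g.

Lemma arrow_from_near g m :
  arrow_from H g m -> \forall t \near m, arrow_from H g t.
Proof.
move=> [n /arr_etale[phi [_ phiE]]].
by apply: filterS phiE => t a; exists (phi t).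
Qed.

Lemma atlas_loc_ex m : exists l, atlas_loc m l.
Proof.
exists (fun=> 1%g), 1%g; split; last exact: filterE.
by exists m; exact: arr1.
Qed.

Lemma atlas_loc_near m l : atlas_loc m l -> \forall t \near m, atlas_loc t l.
Proof.
move=> [g [/arrow_from_near ag lg]]; near=> t; exists g; split.
  by near: t.
by near: t; exact: near_join.
Unshelve. all: by end_near. Qed.

Lemma atlas_loc_smooth m l : atlas_loc m l -> exists phi : M -> M,
  smooth_at phi m /\ \forall t \near m, arr H (l t) t (phi t).
Proof.
move=> [g [[n /arr_etale[phi [sphi phiE]]] lg]]; exists phi; split=> //.
by apply: filterS2 lg phiE => t ->.
Qed.

Lemma atlas_loc_const m l k : atlas_loc m l -> atlas_loc m k ->
  exists g, \forall t \near m, k t = l t ** g.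
Proof.
move=> [g [_ lg]] [h [_ kh]]; exists (g^-1 ** h)%g.
by apply: filterS2 lg kh => t -> ->; rewrite mulKVg.
Qed.

Lemma atlas_loc_mul m l k : atlas_loc m l -> arrow_from H (k m) m ->
  (exists g, \forall t \near m, k t = l t ** g) -> atlas_loc m k.
Proof.
move=> [g [_ lg]] ak [h kh].
have {}kh : \forall t \near m, k t = g ** h.
  by apply: filterS2 lg kh => t -> ->.
by exists (g ** h); split=> //; rewrite -(nbhs_singleton kh).
Qed.

Definition atlas_qmap : qmap H M := @QMap _ _ _ H M id atlas_loc atlas_loc_ex
  atlas_loc_near atlas_loc_smooth atlas_loc_const atlas_loc_mul.

(** * The fibre product of a map with the atlas *)

Section total_space.
Variables (S : manifold R) (x : qmap H S).

(** Labellings are chosen only for those members of a countable base on which a single labelling is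
    valid everywhere. They still cover [S], and countably many of them keep the total space second
    countable. *)
Lemma qmap_cover : exists (b : nat -> set S) (l : nat -> S -> G),
  [/\ forall n, open (b n), forall n t, b n t -> floc x t (l n) &
      forall s, exists n, b n s].
Proof.
have [B /countable_injP[q qinj] [oB bB]] := @manifold_second_countable R S.
(* The injection [q] numbers the base, so at most one member is good for a given [n]; when there is
   none, [n] receives the empty set. *)
pose good n b := [/\ B b, q b = n & exists l, forall t, b t -> floc x t l].
have goodP n : exists bl : set S * (S -> G),
    [/\ open bl.1, forall t, bl.1 t -> floc x t bl.2 &
        forall b, good n b -> b = bl.1].
  have [[b gb]|nb] := pselect (exists b, good n b); last first.
    exists (set0, fun=> 1%g); split=> //; first exact: open0.
    by move=> b gb; case: nb; exists b.
  have [Bb qb [l bl]] := gb; exists (b, l); split=> //; first exact: oB.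
  by move=> b' [Bb' qb' _]; apply: qinj; rewrite ?inE// qb qb'.
exists (fun n => (sval (cid (goodP n))).1), (fun n => (sval (cid (goodP n))).2).
split=> [n|n|s].
- by case: cid => -[b l] [].
- by case: cid => -[b l] [].
have [l xl] := floc_ex x s.
have [b [Bb bs] bl] := bB s _ (floc_near xl).
exists (q b); case: cid => -[b' l'] /= [_ _ /(_ b) <-] //.
by split=> //; exists l.
Qed.

(* The points of the 2-fibre product of [S] and the atlas [M]. *)
Definition total_point : Type :=
  {p : S * G | `[< arrow_from H p.2 (fval x p.1) >]}.
HB.instance Definition _ := Choice.on total_point.

Definition total_proj (e : total_point) : S := (val e).1.
Definition total_lab (e : total_point) : G := (val e).2.

Lemma total_labP e : arrow_from H (total_lab e) (fval x (total_proj e)).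
Proof. exact/asboolP/(valP e). Qed.

Lemma total_unit_subproof s : `[< arrow_from H (s, 1%g).2 (fval x (s, 1%g :
  G).1) >].
Proof. by apply/asboolP; exists (fval x s); exact: arr1. Qed.

(** For an inadmissible [g] the label falls back to 1, so the projection is [s] in every case. *)
Definition total_pair (s : S) (g : G) : total_point :=
  insubd (exist _ (s, 1%g) (total_unit_subproof s) : total_point) (s, g).

Lemma total_pairE s g : arrow_from H g (fval x s) ->
  val (total_pair s g) = (s, g).
Proof. by move=> ag; rewrite insubdK//; exact/asboolP. Qed.

Lemma total_proj_pair s g : total_proj (total_pair s g) = s.
Proof. by rewrite /total_proj /total_pair val_insubd; case: ifP. Qed.

Lemma total_pairK e : total_pair (total_proj e) (total_lab e) = e.
Proof. by rewrite /total_pair -surjective_pairing valKd. Qed.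

Let b : nat -> set S := sval (cid qmap_cover).
Let l : nat -> S -> G := sval (cid (svalP (cid qmap_cover))).

Let blP : [/\ forall n, open (b n), forall n t, b n t -> floc x t (l n) &
  forall s, exists n, b n s].
Proof. exact: (svalP (cid (svalP (cid qmap_cover)))). Qed.

Definition total_dom (k : nat * G) : set S :=
  [set t | b k.1 t /\ arrow_from H (l k.1 t ** k.2) (fval x t)].

(** A sheet follows a fixed right translate of a labelling, so the target of the corresponding arrow
    varies smoothly along it. *)
Definition total_sec (k : nat * G) (t : S) : total_point :=
  total_pair t (l k.1 t ** k.2).

Lemma total_dom_open k : open (total_dom k).
Proof.
have [ob bl _] := blP; rewrite openE => s [bs als].
apply: filterI; first by apply: open_nbhs_nbhs.
exact: floc_shift_near (bl _ _ bs) als.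
Qed.

Lemma total_secK k s : total_dom k s -> total_proj (total_sec k s) = s.
Proof. by move=> _; exact: total_proj_pair. Qed.

Lemma total_cover (e : total_point) : exists2 k,
  total_dom k (total_proj e) & total_sec k (total_proj e) = e.
Proof.
have [_ _ /(_ (total_proj e))[n bn]] := blP.
exists (n, (l n (total_proj e))^-1%g ** total_lab e);
  rewrite /total_dom /total_sec /=.
  by split=> //; rewrite mulKVg; exact: total_labP.
by rewrite mulKVg total_pairK.
Qed.

Lemma total_sec_eqP k k' s : total_dom k s -> total_dom k' s ->
  total_sec k s = total_sec k' s <-> l k.1 s ** k.2 = l k'.1 s ** k'.2.
Proof.
move=> [_ a] [_ a']; split=> [/(congr1 val)|].
  by rewrite !total_pairE// => -[].
by rewrite /total_sec => ->.
Qed.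

(** By [floc_const] the two labellings differ by a constant, which cancels: whether the sheets meet
    is locally independent of the point. Hence agreement and disagreement are both open. *)
Lemma total_sec_near k k' s : total_dom k s -> total_dom k' s ->
  \forall t \near s, (total_sec k t = total_sec k' t) =
                     (total_sec k s = total_sec k' s).
Proof.
move=> ks k's; have [_ bl _] := blP.
have [g gE] := floc_const (bl _ _ ks.1) (bl _ _ k's.1).
have near_dom j : total_dom j s -> \forall t \near s, total_dom j t.
  by move=> js; apply: open_nbhs_nbhs; split=> //; exact: total_dom_open.
near=> t; apply/propext.
rewrite !total_sec_eqP//; last 2 first.
- by near: t; exact: near_dom.
- by near: t; exact: near_dom.
rewrite (near gE t)// (nbhs_singleton gE) -!mulgA.
by split=> /mulgI ->.
Unshelve. all: by end_near. Qed.

Lemma total_sec_eq_open k k' : open [set s |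
  [/\ total_dom k s, total_dom k' s & total_sec k s = total_sec k' s]].
Proof.
rewrite openE => s [ks k's kk'].
have near_dom j : total_dom j s -> \forall t \near s, total_dom j t.
  by move=> js; apply: open_nbhs_nbhs; split=> //; exact: total_dom_open.
apply: filterS3 (near_dom _ ks) (near_dom _ k's) (total_sec_near ks k's).
by move=> t ? ? tE; split=> //; rewrite tE.
Qed.

Lemma total_sec_neq_open k k' : open [set s |
  [/\ total_dom k s, total_dom k' s & total_sec k s <> total_sec k' s]].
Proof.
rewrite openE => s [ks k's kk'].
have near_dom j : total_dom j s -> \forall t \near s, total_dom j t.
  by move=> js; apply: open_nbhs_nbhs; split=> //; exact: total_dom_open.
apply: filterS3 (near_dom _ ks) (near_dom _ k's) (total_sec_near ks k's).
by move=> t ? ? tE; split=> //; rewrite tE.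
Qed.

Definition total_data : etale_data S := @EtaleData R S total_point total_proj
  (nat * G)%type total_dom total_sec total_dom_open total_secK total_cover
  total_sec_eq_open total_sec_neq_open.

Definition total_space : manifold R := etale_manifold total_data.

Let proj : total_space -> S := total_proj.
Let sproj : smooth proj := eproj_smooth total_data.

Lemma total_lab_near (e : total_space) : exists k, [/\ total_dom k (proj e),
  total_lab e = l k.1 (proj e) ** k.2, floc x (proj e) (l k.1) &
  \forall e' \near e, total_lab e' = l k.1 (proj e') ** k.2 ].
Proof.
have [k ke kE] := total_cover e; exists k.
have labE (e' : total_space) : total_dom k (proj e') ->
    total_sec k (proj e') = e' -> total_lab e' = l k.1 (proj e') ** k.2.
  move=> [_ ak] kE'; rewrite -[in LHS]kE' /total_lab /total_sec.
  by rewrite total_pairE.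
split=> //; first exact: labE.
  by have [_ bl _] := blP; exact/bl/ke.1.
have oe : open (esheet (D := total_data) k setT).
  exact/esheet_open/openT.
have : \forall e' \near e, esheet (D := total_data) k setT e'.
  by apply: open_nbhs_nbhs; split=> //; split.
by apply: filterS => e' [ke' _ kE']; exact: labE.
Qed.

(** The second projection of the fibre product, to the atlas. *)
Definition total_map (e : total_space) : M := projT1 (cid (total_labP e)).

Lemma total_mapP (e : total_space) :
  arr H (total_lab e) (fval x (proj e)) (total_map e).
Proof. exact: projT2 (cid (total_labP e)). Qed.

Lemma total_map_smooth : smooth total_map.
Proof.
apply/smoothP => e; have [k [[_ ak] labe xl lab]] := total_lab_near e.
have [phi [sphi phiE]] := floc_shift xl ak.
have sphie : smooth_at (phi \o proj) e.
  by apply: smooth_at_comp => //; move/smoothP: sproj; apply.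
apply: smooth_at_eq sphie.
have {}phiE := smooth_preimage sproj phiE.
apply: filterS2 lab phiE => e' le' ae'.
by apply: arr_fun ae' _; rewrite -le'; exact: total_mapP.
Qed.

Definition total_qmap : qmap H total_space := pull sproj x.

Lemma total_lab_loc (e : total_space) k : atlas_loc (total_map e) k ->
  pull_loc proj x e (fun e' => total_lab e' ** k (total_map e')).
Proof.
move=> [h [[n an] kh]]; have [j [_ labe xl lab]] := total_lab_near e.
exists (l j.1); split=> //.
  exists n; apply: arrM (total_mapP e) _.
  by rewrite (nbhs_singleton kh).
exists (j.2 ** h).
have {}kh := smooth_preimage total_map_smooth kh.
by apply: filterS2 lab kh => e' -> ->; rewrite mulgA.
Qed.

Definition total_arrow : farrow total_qmap atlas_qmap :=
  @FArrow _ _ _ H total_space M total_qmap atlas_qmap total_map total_lab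
    total_map_smooth total_mapP total_lab_loc.

(** At [s], the inverse of the arrow of [a] followed by that of [b'] leads from [fval x (fbase a s)]
    to [fbase b' s]; its source index and label are the point [F s] of the fibre product. *)
Lemma total_universal T (t : qmap H T) (a : farrow t x)
    (b' : farrow t atlas_qmap) :
  exists! h : farrow t total_qmap,
    farrow_comp h (pull_arrow sproj x) = a /\ farrow_comp h total_arrow = b'.
Proof.
have [ob bl cb] := blP.
pose F s : total_space := total_pair (fbase a s) ((flab a s)^-1 ** flab b' s)%g.
have aF s : arr H ((flab a s)^-1 ** flab b' s)%g (fval x (fbase a s)) (fbase b'
  s).
  by apply: arrM (arrV (flab_arr a s)) (flab_arr b' s).
have FE s : val (F s) = (fbase a s, (flab a s)^-1 ** flab b' s)%g.
  by apply: total_pairE; exists (fbase b' s).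
have projF s : proj (F s) = fbase a s by rewrite /proj /total_proj FE.
have labF s : total_lab (F s) = ((flab a s)^-1 ** flab b' s)%g.
  by rewrite /total_lab FE.
have mapF s : total_map (F s) = fbase b' s.
  apply: arr_fun (total_mapP (F s)) _; rewrite labF projF; exact: aF.
(* A labelling of [x] pulled back along [a] and the constant labelling pulled back along [b'] differ
   by a constant. So [F] stays in a single sheet near [s0], where it is a section composed with
   [fbase a]. *)
have sF : smooth F.
  apply/smoothP => s0; have [k [dk labe xl _]] := total_lab_near (F s0).
  rewrite projF in dk labe xl; rewrite labF in labe.
  have ta := flab_loc xl.
  have tb : floc t s0 (fun s => flab b' s ** 1%g).
    apply: (@flab_loc _ _ _ _ _ _ _ _ b' s0 (fun=> 1%g)).
    by exists 1%g; split; [eexists; exact: arr1|exact: filterE].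
  have [g gE] := floc_const ta tb.
  have {}gE : \forall s \near s0,
      (flab a s)^-1 ** flab b' s = l k.1 (fbase a s) ** g.
    apply: filterS gE => s; rewrite mulg1 => ->.
    by rewrite -!mulgA mulKg.
  have gk : g = k.2 by have := nbhs_singleton gE; rewrite labe => /mulgI.
  have ss : smooth_at (total_sec k \o fbase a : T -> total_space) s0.
    apply: smooth_at_comp.
      by move: s0 {dk labe xl ta tb gE}; apply/smoothP/fbase_smooth.
    exact: (@esec_smooth _ _ total_data).
  apply: smooth_at_eq ss; apply: filterS gE => s gE.
  by rewrite /= /total_sec /F gE gk.
have [h [[hF ha] hu]] : exists! w : farrow t total_qmap,
    fbase w = F /\ farrow_comp w (pull_arrow sproj x) = a.
  apply: farrow_cartesian => //; apply/funext => s /=; by rewrite projF.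
exists h; split.
  split=> //; apply: farrow_eq; apply/funext => s; first by rewrite /= hF mapF.
  rewrite /= hF labF -[in flab a s]ha /=.
  by rewrite mulg1 mulKVg.
move=> h' [h'a h'b]; apply: hu; split=> //.
apply/funext => s; apply: val_inj; rewrite FE.
rewrite [LHS]surjective_pairing -h'a -h'b /= mulg1 mulKg.
by [].
Qed.
End total_space.

Lemma groupoid_etale_atlas : @etale_atlas R X M atlas_qmap.
Proof.
move=> S x; exists (total_space x), (total_qmap x).
exists (pull_arrow (eproj_smooth (total_data x)) x), (total_arrow x); split.
- exact: (eproj_etale (total_data x)).
- by move=> s; exists (total_pair x s 1%g); exact: total_proj_pair.
exact: total_universal.
Qed.

Lemma groupoid_isotropy_finite (x : ob X pt) : finite_set (isotropy (X :=
  X) (x := x)).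
Proof.
have inj : {in isotropy (X := X) (x := x) &,
    injective (fun u : farrow x x => flab u pt0)}.
  move=> u v; rewrite !inE => ui vi uv; apply: farrow_eq.
    by apply: (etrans ui); exact/esym.
  by apply/funext => s; rewrite (rV0_all s 0).
by rewrite -(eq_finite_set (inj_card_eq inj)); exact: finite_finset.
Qed.

Definition groupoid_orbifold n (Mn : mdim M = n) : orbifold R n :=
  @Orbifold R n X (groupoid_is_stack H) M Mn atlas_qmap groupoid_etale_atlas
    groupoid_isotropy_finite.

(** * The points of the coarse space *)

Section coarse.
Variables (n : nat) (Mn : mdim M = n).
Local Notation Y := (groupoid_orbifold Mn).

Lemma opoint_isoP (x y : opoint Y) : opoint_iso x y <->
  exists g, arr H g (fval (x : qmap H pt) pt0) (fval (y : qmap H pt) pt0).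
Proof.
split=> [/asboolP[u ub]|[g a]].
  exists (flab u pt0); have := flab_arr u pt0.
  by rewrite (rV0_all (fbase u pt0) 0).
apply/asboolP; exists (point_arrow a).
by apply/funext => s; exact: rV0_all.
Qed.

Lemma ofibre_arr (t : M) : exists g,
  arr H g (fval (ofibre (X := Y) t : qmap H pt) pt0) t.
Proof.
rewrite /ofibre; case: cid => x /= [u ub].
exists (flab u pt0); have := flab_arr u pt0.
by rewrite (ub : fbase u = _).
Qed.

Lemma oclassP (t t' : M) :
  oclass (X := Y) t = oclass (X := Y) t' <-> exists g, arr H g t t'.
Proof.
have [g a] := ofibre_arr t; have [g' a'] := ofibre_arr t'.
split=> [/eqmodP/opoint_isoP[h ah]|[h ah]].
  by exists (g^-1 ** h ** g')%g; apply: arrM a'; apply: arrM ah; exact: arrV.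
apply/eqmodP/opoint_isoP.
exists (g ** h ** g'^-1)%g; apply: arrM (arrV a'); exact: arrM ah.
Qed.

Lemma oclass_surj (q : {eq_quot @opoint_equiv R n Y}) :
  exists t : M, oclass (X := Y) t = q.
Proof.
elim/quotP: q => x _; exists (fval (x : qmap H pt) pt0).
have [g a] := ofibre_arr (fval (x : qmap H pt) pt0).
by apply/eqmodP/opoint_isoP; exists g.
Qed.
End coarse.
End atlas.

Lemma final_topology_homeomorphic (T : topologicalType) (Q Q' : choiceType)
    (f : T -> Q) (f' : T -> Q') :
  (forall q, exists t, f t = q) -> (forall q, exists t, f' t = q) ->
  (forall t t', f t = f t' <-> f' t = f' t') ->
  homeomorphic (final_topology f) (final_topology f').
Proof.
move=> sf sf' ff'.
pose g (q : final_topology f) : final_topology f' := f' (sval (cid (sf q))).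
pose g' (q : final_topology f') : final_topology f := f (sval (cid (sf' q))).
have gf t : g (f t) = f' t by rewrite /g; case: cid => t' /= /ff'.
have gf' t : g' (f' t) = f t by rewrite /g'; case: cid => t' /= /ff'.
exists g, g'; split.
- apply/continuousP => A oA; change (open (f @^-1` (g @^-1` A))).
  by rewrite (_ : _ @^-1` _ = f' @^-1` A)//; apply/funext => t /=; rewrite gf.
- apply/continuousP => A oA; change (open (f' @^-1` (g' @^-1` A))).
  by rewrite (_ : _ @^-1` _ = f @^-1` A)//; apply/funext => t /=; rewrite gf'.
- by move=> q; have [t <-] := sf q; rewrite gf gf'.
by move=> q; have [t <-] := sf' q; rewrite gf' gf.
Qed.

Lemma groupoid_coarse_homeomorphic (R : realType) (G : finGroupType)
    (M : manifold R) (H : etale_groupoid G M) n (Mn : mdim M = n)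
    (Q : choiceType) (f : M -> Q) : (forall q, exists t, f t = q) ->
  (forall t t', f t = f t' <-> exists g, arr H g t t') ->
  homeomorphic (coarse_space (groupoid_orbifold H Mn)) (final_topology f).
Proof.
move=> sf fE; apply: final_topology_homeomorphic => //;
  first exact: oclass_surj.
by move=> t t'; rewrite fE; exact: oclassP.
Qed.

(** * Simplicial cones and fans *)

Section simplicial_cones.
Variables (R : realType) (d m : nat).
Implicit Types (w : 'I_m -> 'rV[R]_d) (I J : {set 'I_m}) (a b c : 'I_m -> R).

Definition lincomb w c : 'rV[R]_d := \sum_i c i *: w i.

Definition indep w I : Prop := forall c,
  (forall i, i \notin I -> c i = 0) -> lincomb w c = 0 -> forall i, c i = 0.

Lemma lincombB w a b : lincomb w a - lincomb w b = lincomb w (fun i =>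
  a i - b i).
Proof. by rewrite -sumrB; apply: eq_bigr => i _; rewrite scalerBl. Qed.

Lemma lincombD w a b : lincomb w a + lincomb w b = lincomb w (fun i =>
  a i + b i).
Proof. by rewrite -big_split; apply: eq_bigr => i _; rewrite scalerDl. Qed.

Lemma lincomb_delta w i r : lincomb w (fun j => r *+ (j == i)) = r *: w i.
Proof.
rewrite /lincomb (bigD1 i)//= eqxx mulr1n big1 ?addr0// => j /negPf ->.
by rewrite mulr0n scale0r.
Qed.

Lemma lincomb_mulmx w c (u : 'cV[R]_d) :
  (lincomb w c *m u) 0 0 = \sum_i c i * (w i *m u) 0 0.
Proof.
rewrite mulmx_suml summxE; apply: eq_bigr => i _.
by rewrite -scalemxAl mxE.
Qed.

Lemma coneP w I x : cone w I x <-> exists a,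
  [/\ forall i, 0 <= a i, forall i, i \notin I -> a i = 0 & x = lincomb w a].
Proof.
split=> [[a a0 ->]|[a [a0 aI ->]]].
  exists (fun i => if i \in I then a i else 0); split.
  - by move=> i; case: ifP.
  - by move=> i /negPf ->.
  rewrite /lincomb [RHS](bigID (mem I)) /= [X in _ = _ + X]big1 ?addr0.
    by apply: eq_bigr => i ->.
  by move=> i /negPf ->; rewrite scale0r.
exists a => //; rewrite /lincomb (bigID (mem I)) /= [X in _ + X = _]big1
  ?addr0//.
by move=> i /aI ->; rewrite scale0r.
Qed.

Lemma cone_sub w I J : I \subset J -> cone w I `<=` cone w J.
Proof.
move=> IJ x /coneP[a [a0 aI ->]]; apply/coneP; exists a; split=> // i iJ.
by apply: aI; apply: contra iJ; exact: (fintype.subsetP IJ).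
Qed.

Lemma cone_gen w I i : i \in I -> cone w I (w i).
Proof.
move=> iI; apply/coneP; exists (fun j => 1 *+ (j == i)); split.
- by move=> j; case: eqP; rewrite ?mulr1n ?mulr0n.
- by move=> j jI; case: eqP => [ji|]; [rewrite ji iI in jI|rewrite mulr0n].
by rewrite lincomb_delta scale1r.
Qed.

Lemma cone0 w : cone w finset.set0 = [set 0].
Proof.
apply/seteqP; split=> [x [a _ ->]|x ->]; first by rewrite big_set0.
by exists (fun=> 0) => //; rewrite big_set0.
Qed.

Lemma cone1 w i : cone w [set i]%SET = ray (w i).
Proof.
apply/seteqP; split=> [x [a a0 ->]|x [r r0 ->]].
  by rewrite big_set1; exists (a i).
by exists (fun=> r) => //; rewrite big_set1.
Qed.

Lemma cone_addr w I x y : cone w I x -> cone w I y -> cone w I (x + y).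
Proof.
move=> /coneP[a [a0 aI ->]] /coneP[b [b0 bI ->]]; apply/coneP.
exists (fun i => a i + b i); split; last exact: lincombD.
- by move=> i; rewrite addr_ge0.
- by move=> i iI; rewrite aI// bI// addr0.
Qed.

Lemma cone_scale w I r x : 0 <= r -> cone w I x -> cone w I (r *: x).
Proof.
move=> r0 [a a0 ->]; exists (fun i => r * a i) => [i|].
  by rewrite mulr_ge0.
by rewrite scaler_sumr; apply: eq_bigr => i _; rewrite scalerA.
Qed.

Lemma cone_in0 w I : cone w I 0.
Proof.
exists (fun=> 0) => //; rewrite big1// => i _; exact: scale0r.
Qed.

Lemma indep_sub w I J : J \subset I -> indep w I -> indep w J.
Proof.
move=> JI wI c cJ; apply: wI => i iI; apply: cJ.
by apply: contra iI; exact: (fintype.subsetP JI).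
Qed.

Lemma indep_neq0 w I i : indep w I -> i \in I -> w i != 0.
Proof.
move=> wI iI; apply/eqP => wi0.
have := wI (fun j => 1 *+ (j == i)) _ _ i.
rewrite eqxx mulr1n lincomb_delta scale1r => /(_ _ wi0) h.
have /eqP : 1 = 0 :> R.
  by apply: h => j; case: eqP => [->|]; rewrite ?iI ?mulr0n.
by rewrite oner_eq0.
Qed.

(** The matrix of the independent vectors has a right inverse; [u] is this inverse applied to the
    prescribed values. *)
Lemma indep_functional w I b : indep w I ->
  exists u : 'cV[R]_d, forall i, i \in I -> (w i *m u) 0 0 = b i.
Proof.
move=> wI; pose A := \matrix_(k < #|I|) w (enum_val k).
have : row_free A.
  apply: inj_row_free => v vA; apply/rowP => k; rewrite mxE.
  pose c i : R := \sum_(k < #|I|) v 0 k *+ (i == enum_val k).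
  have ck k' : c (enum_val k') = v 0 k'.
    rewrite /c (bigD1 k')//= eqxx mulr1n big1 ?addr0// => j jk.
    rewrite (_ : (_ == _) = false) ?mulr0n//; apply/negbTE.
    by apply: contra jk => /eqP/enum_val_inj ->.
  rewrite -ck; apply: wI => [i iI|].
    rewrite /c big1// => j _; rewrite (_ : (_ == _) = false) ?mulr0n//.
    by apply/negbTE; apply: contra iI => /eqP ->; exact: enum_valP.
  rewrite -[RHS]vA mulmx_sum_row /lincomb.
  under eq_bigr do rewrite scaler_suml.
  rewrite exchange_big; apply: eq_bigr => j _ /=; rewrite rowK.
  rewrite (bigD1 (enum_val j))//= eqxx mulr1n big1 ?addr0// => i /negPf ->.
  by rewrite mulr0n scale0r.
move=> /row_freeP[B AB]; exists (B *m \col_k b (enum_val k)) => i iI.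
have : A *m (B *m \col_k b (enum_val k)) = \col_k b (enum_val k).
  by rewrite mulmxA AB mul1mx.
move=> /matrixP/(_ (enum_rank_in iI i) 0).
rewrite [RHS]mxE enum_rankK_in// => <-.
have -> : w i = row (enum_rank_in iI i) A by rewrite rowK enum_rankK_in.
by rewrite -row_mul mxE.
Qed.

(** A nonnegative combination killed by [u] can only involve generators killed by [u], as a sum of
    nonnegative terms vanishes termwise. *)
Lemma face_cone w I t : is_face t (cone w I) ->
  exists J : {set 'I_m}, J \subset I /\ t = cone w J.
Proof.
move=> [u u0 ->]; exists [set i in I | (w i *m u) 0 0 == 0]%SET.
have wu0 i : i \in I -> 0 <= (w i *m u) 0 0 by move=> iI; exact/u0/cone_gen.
split; first by apply/fintype.subsetP => i; rewrite inE => /andP[].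
apply/seteqP; split=> x.
  move=> [/coneP[a [a0 aI ->]] xu]; apply/coneP; exists a; split=> // i.
  rewrite inE negb_and => /orP[/aI //|wi].
  have [iI|/aI //] := boolP (i \in I).
  have : \sum_i a i * (w i *m u) 0 0 = 0 by rewrite -lincomb_mulmx xu mxE.
  move=> /eqP; rewrite psumr_eq0 => [/allP/(_ i)|j _]; last first.
    have [jI|/aI ->] := boolP (j \in I); last by rewrite mul0r.
    by rewrite mulr_ge0// wu0.
  by rewrite mem_index_enum mulf_eq0 (negbTE wi) orbF => /(_ isT)/eqP.
move=> /coneP[a [a0 aJ ->]]; split.
  apply/coneP; exists a; split=> // i iI; apply: aJ.
  by rewrite inE (negbTE iI).
apply/matrixP => i j; rewrite !ord1 lincomb_mulmx mxE big1// => k _.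
have [|/aJ ->] := boolP (k \in [set i in I | (w i *m u) 0 0 == 0]%SET).
  by rewrite inE => /andP[_ /eqP ->]; rewrite mulr0.
by rewrite mul0r.
Qed.

(** The functional with value 0 on [J] and 1 on the rest of [I] cuts out the face. *)
Lemma cone_face w I J : indep w I -> J \subset I ->
  is_face (cone w J) (cone w I).
Proof.
move=> wI JI.
have [u uE] := indep_functional (fun i => (i \notin J)%:R) wI.
have cu a : (forall i, i \notin I -> a i = 0) ->
    (lincomb w a *m u) 0 0 = \sum_i a i * (i \notin J)%:R.
  move=> aI; rewrite lincomb_mulmx; apply: eq_bigr => i _.
  by have [iI|/aI ->] := boolP (i \in I); [rewrite uE|rewrite !mul0r].
exists u => [x /coneP[a [a0 aI ->]]|].
  by rewrite cu//; apply: sumr_ge0 => i _; rewrite mulr_ge0.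
apply/seteqP; split=> [x xJ|x [/coneP[a [a0 aI ->]] xu]].
  split; first exact: cone_sub xJ.
  move: xJ => /coneP[a [a0 aJ ->]].
  apply/matrixP => i j; rewrite !ord1 cu.
    rewrite mxE big1// => k _; have [|/aJ ->] := boolP (k \in J).
      by rewrite mulr0.
    by rewrite mul0r.
  by move=> k kI; apply: aJ; apply: contra kI; exact: (fintype.subsetP JI).
apply/coneP; exists a; split=> // i iJ.
have : \sum_i a i * (i \notin J)%:R = 0 by rewrite -cu// xu mxE.
move=> /eqP; rewrite psumr_eq0 => [/allP/(_ i)|j _]; last by rewrite mulr_ge0.
by rewrite mem_index_enum iJ mulr1 => /(_ isT)/eqP.
Qed.

Lemma ray_gen (x : 'rV[R]_d) : ray x x.
Proof. by exists 1; rewrite ?scale1r. Qed.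

Lemma cone_is_ray w I : indep w I -> is_ray (cone w I) ->
  exists2 i, i \in I & cone w I = ray (w i).
Proof.
move=> wI [x x0 cE].
have wx i : i \in I -> exists2 r, r != 0 & w i = r *: x.
  move=> iI; have := cone_gen w iI; rewrite cE => -[r r0 wi]; exists r => //.
  by apply: contraNneq (indep_neq0 wI iI) => r00; rewrite wi r00 scale0r.
have [I0|[i iI]] := set_0Vmem I.
  have : cone w I x by rewrite cE; exact: ray_gen.
  by rewrite I0 cone0 => /eqP; rewrite (negbTE x0).
suff -> : I = [set i]%SET by exists i; rewrite ?inE// cone1.
apply/setP => j; rewrite inE; apply/idP/eqP => [jI|-> //].
apply: contrapT => /eqP ji.
have [r r0 wi] := wx _ iI; have [s s0 wj] := wx _ jI.
have := wI (fun k => s *+ (k == i) - r *+ (k == j)) _ _ i.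
rewrite eqxx eq_sym (negbTE ji) mulr1n mulr0n subr0 => h.
move/eqP: s0; apply; apply: h => [k kI|].
  have [ki|_] := eqVneq k i; first by rewrite ki iI in kI.
  have [kj|_] := eqVneq k j; first by rewrite kj jI in kI.
  by rewrite !mulr0n subrr.
rewrite -(lincombB w (fun k => s *+ (k == i)) (fun k => r *+ (k == j))).
by rewrite !lincomb_delta wi wj !scalerA mulrC subrr.
Qed.

Lemma ray_is_ray (x : 'rV[R]_d) : x != 0 -> is_ray (ray x).
Proof. by exists x. Qed.

Lemma indep_ray_faces w I s : indep w I ->
  (is_face s (cone w I) /\ is_ray s) <-> exists2 i, i \in I & s = ray (w i).
Proof.
move=> wI; split=> [[/face_cone[J [JI ->]] sr]|[i iI ->]].
  have [i iJ ->] := cone_is_ray (indep_sub JI wI) sr.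
  by exists i => //; exact: (fintype.subsetP JI).
split; last by apply: ray_is_ray; exact: indep_neq0 iI.
by rewrite -cone1; apply: cone_face => //; rewrite finset.sub1set.
Qed.
End simplicial_cones.

(** * Realizations of an abstract simplicial complex *)

Section realizations.
Variables (R : realType) (d m : nat).
Implicit Types (w : 'I_m -> 'rV[R]_d) (I J : {set 'I_m}) (a b c : 'I_m -> R).
Implicit Types D : {set {set 'I_m}}.

Lemma cone_subset n (v : 'I_n -> 'rV[R]_d) (K : {set 'I_n}) w I :
  (forall i, i \in I -> cone v K (w i)) -> cone w I `<=` cone v K.
Proof.
move=> wv x [a a0 ->]; apply: (big_ind (cone v K)).
- exact: cone_in0.
- exact: cone_addr.
- by move=> i iI; apply: cone_scale => //; exact: wv.
Qed.

Lemma indep_ray_inj w I i j : indep w I -> i \in I -> j \in I ->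
  ray (w i) = ray (w j) -> i = j.
Proof.
move=> wI iI jI wij; apply: contrapT => /eqP nij.
have [u uE] := indep_functional (fun k => (k == i)%:R) wI.
have : ray (w j) (w i) by rewrite -wij; exact: ray_gen.
move=> [r _ wi]; have := uE _ iI.
rewrite wi -scalemxAl mxE uE// eqxx eq_sym (negbTE nij) mulr0 => /esym/eqP.
by rewrite oner_eq0.
Qed.

Definition posset c : {set 'I_m} := [set i | 0 < c i]%SET.
Definition negset c : {set 'I_m} := [set i | c i < 0]%SET.

(* Equivalently, the linear map from the abstract cone complex
   [{a : 'I_m -> R | a >= 0, supp a \in D}] sending the [i]-th basis vector to
   [w i] is injective: apply the last clause to differences. *)
Definition realizes D w : Prop :=
  [/\ finset.set0 \in D, forall I J, J \subset I -> I \in D -> J \in D,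
      forall i, [set i]%SET \in D &
      forall c, posset c \in D -> negset c \in D -> lincomb w c = 0 ->
        forall i, c i = 0].

(** Apply the injectivity clause to [a - b], whose positive support lies in [I] and whose negative
    support lies in [J]. *)
Lemma realizes_diff D w I J a b : realizes D w -> I \in D -> J \in D ->
  (forall i, 0 <= a i) -> (forall i, 0 <= b i) ->
  (forall i, i \notin I -> a i = 0) -> (forall i, i \notin J -> b i = 0) ->
  lincomb w a = lincomb w b -> a =1 b.
Proof.
move=> [_ subD _ inj] ID JD a0 b0 aI bJ ab i; apply/eqP; rewrite -subr_eq0.
apply/eqP; apply: (inj (fun i => a i - b i)).
- apply: subD ID; apply/fintype.subsetP => j; rewrite inE subr_gt0 => ba.
  by apply: contraLR ba => /aI ->; rewrite -leNgt.
- apply: subD JD; apply/fintype.subsetP => j; rewrite inE subr_lt0 => ba.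
  by apply: contraLR ba => /bJ ->; rewrite -leNgt.
- by rewrite -lincombB ab subrr.
Qed.

Lemma realizes_indep D w I : realizes D w -> I \in D -> indep w I.
Proof.
move=> [_ subD _ inj] ID c cI c0; apply: inj => //; apply: subD ID;
  apply/fintype.subsetP => j; rewrite inE => cj;
  by apply: contraLR cj => /cI ->; rewrite ltxx.
Qed.

Lemma realizes_inter D w I J : realizes D w -> I \in D -> J \in D ->
  cone w I `&` cone w J = cone w (I :&: J)%SET.
Proof.
move=> wD ID JD; apply/seteqP; split=> x; last first.
  by move=> xIJ; split; apply: cone_sub xIJ; [exact: subsetIl|exact: subsetIr].
move=> [/coneP[a [a0 aI ->]] /coneP[b [b0 bJ ab]]].
have abE := realizes_diff wD ID JD a0 b0 aI bJ ab.
apply/coneP; exists a; split=> // i; rewrite inE negb_and => /orP[/aI //|iJ].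
by rewrite abE bJ.
Qed.
End realizations.

(** * A simplicial fan realizes its combinatorial type *)

Section fan_combinatorics.
Variables (R : realType) (d p : nat) (F : qfan R d p).
Hypothesis sF : simplicial F.
Local Notation v := (qgen F).
Implicit Types I J : {set 'I_p}.

Lemma qray i : qcones F (ray (v i)).
Proof. by have [] := (qgen_ray F (ray (v i))).2 (ex_intro _ i erefl). Qed.

Lemma ray_set_inj I J :
  (forall s, (exists2 i, i \in I & s = ray (v i)) <->
             (exists2 i, i \in J & s = ray (v i))) -> I = J.
Proof.
move=> IJ; apply/setP => i; apply/idP/idP => iI.
  have [|j jJ /qgen_inj ->//] := (IJ (ray (v i))).1; by exists i.
by have [|j jJ /qgen_inj ->//] := (IJ (ray (v i))).2; exists i.
Qed.

Lemma combP I : I \in comb F <-> qcones F (cone v I) /\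
  forall s, (is_face s (cone v I) /\ is_ray s) <->
            exists2 i, i \in I & s = ray (v i).
Proof. by rewrite inE; split=> [/asboolP|?]; last exact/asboolP. Qed.

Lemma indep_comb I : qcones F (cone v I) -> indep v I -> I \in comb F.
Proof. by move=> cI vI; apply/combP; split=> // s; exact: indep_ray_faces. Qed.

(** The independent generators [w k] of the cone span rays of the fan, so each is a positive
    multiple of some [qgen F i]. Rescaling and reindexing by [io] then expresses the cone through
    the generators of the fan. *)
Lemma qcone_comb s : qcones F s ->
  exists I, [/\ I \in comb F, indep v I & s = cone v I].
Proof.
move=> Fs; have [m [w [fw sE]]] := sF Fs.
have wT : indep w [set: 'I_m]%SET.
  move=> c _ wc i; have := row_free_inj fw (x1 := \row_i c i) (x2 := 0).
  rewrite mul0mx mulmx_sum_row => h.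
  have /rowP/(_ i) : \row_i c i = 0.
    by apply: h; rewrite -[RHS]wc; apply: eq_bigr => j _; rewrite rowK mxE.
  by rewrite !mxE.
have wray k : exists i, ray (w k) = ray (v i).
  apply/(qgen_ray F (ray (w k))).1.
  have [|fk rk] := (indep_ray_faces (ray (w k)) wT).2; first by exists k.
  by split=> //; apply: qcones_face fk; rewrite -sE.
pose io k := projT1 (cid (wray k)).
have ioE k : ray (w k) = ray (v (io k)) by rewrite /io; case: cid.
have io_inj : injective io.
  by move=> k l kl; apply: (indep_ray_inj wT) => //; rewrite !ioE kl.
have vio k : exists2 r, 0 < r & v (io k) = r *: w k.
  have : ray (w k) (v (io k)) by rewrite ioE; exact: ray_gen.
  move=> [r r0 vE]; exists r => //; rewrite lt_neqAle r0 andbT eq_sym.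
  by apply: contraNneq (qgen_neq0 F (io k)) => r00; rewrite vE r00 scale0r.
pose r k := sval (cid2 (vio k)).
have r0 k : 0 < r k by rewrite /r; case: cid2.
have rE k : v (io k) = r k *: w k by rewrite /r; case: cid2.
pose I := [set io k | k in [set: 'I_m]]%SET.
have vI : indep v I.
  move=> c cI vc i; have [/imsetP[k _ ->]|/cI //] := boolP (i \in I).
  have : r k * c (io k) = 0.
    apply: (wT (fun k => r k * c (io k))) => [j|]; first by rewrite inE.
    rewrite -[RHS]vc /lincomb [RHS](bigID (mem I)) /=.
    rewrite [X in _ = _ + X]big1 ?addr0 => [|j /cI ->]; last exact: scale0r.
    rewrite /I big_imset /=; last by move=> ? ? _ _; exact: io_inj.
    by apply: eq_big => [j|j _]; rewrite ?inE// rE scalerA mulrC.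
  by move/eqP; rewrite mulf_eq0 gt_eqF//= => /eqP.
have sI : s = cone v I.
  rewrite sE; apply/seteqP; split; apply: cone_subset => k kI.
    have -> : w k = (r k)^-1 *: v (io k).
      by rewrite rE scalerA mulVf ?scale1r// gt_eqF.
    apply: cone_scale; first by rewrite invr_ge0 ltW.
    by apply: cone_gen; apply/imsetP; exists k.
  move: kI => /imsetP[{}k _ ->]; rewrite rE; apply: cone_scale;
    first exact: ltW.
  exact: cone_gen.
by exists I; split=> //; apply: indep_comb => //; rewrite -sI.
Qed.

(** The cone has independent generators indexed by some [J], and its rays determine the index set,
    so [I = J]. *)
Lemma comb_indep I : I \in comb F -> indep v I.
Proof.
move=> /combP[cI fI]; have [J [_ vJ IJ]] := qcone_comb cI.
suff -> : I = J by [].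
apply: ray_set_inj => s; rewrite -fI IJ; exact: indep_ray_faces.
Qed.

Lemma qconesP s : qcones F s <-> exists2 I, I \in comb F & s = cone v I.
Proof.
split=> [/qcone_comb[I [IF _ sE]]|[I /combP[cI _] ->] //].
by exists I.
Qed.

Lemma cone_comb_inj I J : I \in comb F -> J \in comb F ->
  cone v I = cone v J -> I = J.
Proof.
move=> /combP[_ fI] /combP[_ fJ] IJ; apply: ray_set_inj => s.
by rewrite -fI -fJ IJ.
Qed.

Lemma comb_sub I J : J \subset I -> I \in comb F -> J \in comb F.
Proof.
move=> JI IF; have vI := comb_indep IF; apply: indep_comb.
  by apply: qcones_face (cone_face vI JI); have [] := (combP I).1 IF.
exact: indep_sub vI.
Qed.

(** The relation exhibits a relative interior point of the cone on [posset c] that also lies in the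
    cone on [negset c]. The intersection is a face of the former through an interior point, hence
    all of it; so it is a face of the latter, and its index set is contained in [negset c]. *)
Lemma comb_pos_cone_sub c : posset c \in comb F -> negset c \in comb F ->
  lincomb v c = 0 -> posset c \subset negset c.
Proof.
move=> PF NF vc; set P := posset c; set N := negset c.
(* [a] and [b] are the positive and negative parts of [c], and [lincomb v a = lincomb v b] is the
   common point. *)
pose a i := if i \in P then c i else 0.
pose b i := if i \in N then - c i else 0.
have a0 i : 0 <= a i by rewrite /a inE; case: ifP => // /ltW.
have b0 i : 0 <= b i by rewrite /b inE; case: ifP => //;
  rewrite oppr_ge0 => /ltW.
have ab : lincomb v a = lincomb v b.
  apply/eqP; rewrite -subr_eq0 lincombB -[X in _ == X]vc; apply/eqP.
  apply: eq_bigr => i _; congr (_ *: _); rewrite /a /b !inE.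
  by case: (ltgtP (c i) 0) => [|_|->]; rewrite ?subr0 ?subrr ?opprK ?add0r.
have aP i : i \notin P -> a i = 0 by rewrite /a => /negPf ->.
have bN i : i \notin N -> b i = 0 by rewrite /b => /negPf ->.
have [cP _] := (combP P).1 PF; have [cN _] := (combP N).1 NF.
have [[u u0 uE] fN] := qcones_inter cP cN.
have xPN : (cone v P `&` cone v N) (lincomb v a).
  by split; apply/coneP; [exists a|exists b].
have := xPN; rewrite uE => -[_ xu].
(* All coefficients of the common point on [P] are strictly positive, so the face functional [u]
   vanishes on each of these generators. *)
have vu0 i : i \in P -> v i *m u = 0.
  move=> iP; have : \sum_i a i * (v i *m u) 0 0 = 0.
    by rewrite -lincomb_mulmx xu mxE.
  move=> /eqP; rewrite psumr_eq0 => [/allP/(_ i)|j _]; last first.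
    have [jP|/aP ->] := boolP (j \in P); last by rewrite mul0r.
    by rewrite mulr_ge0//; apply/u0/cone_gen.
  rewrite mem_index_enum => /(_ isT); rewrite mulf_eq0 {1}/a iP.
  move: iP; rewrite inE => ci; rewrite gt_eqF//= => /eqP vu.
  by apply/matrixP => ? ?; rewrite !ord1 vu mxE.
have PN : cone v P `&` cone v N = cone v P.
  rewrite uE; apply/seteqP; split=> [x []//|x xP]; split=> //.
  move: xP => [e e0 ->]; rewrite mulmx_suml big1// => i iP.
  by rewrite -scalemxAl vu0// scaler0.
move: fN; rewrite PN => /face_cone[J [JN PJ]].
have PE : P = J := cone_comb_inj PF (comb_sub JN NF) PJ.
by rewrite PE.
Qed.

Lemma comb_realizes : realizes (comb F) v.
Proof.
split.
- have [I [IF _ I0]] := qcone_comb (qcones0 F).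
  apply: comb_sub IF; exact: finset.sub0set.
- by move=> I J; exact: comb_sub.
- move=> i; apply: indep_comb; first by rewrite cone1; exact: qray.
  move=> c ci vc j; have [|jni] := boolP (j \in [set i]%SET); last exact: ci.
  rewrite inE => /eqP ->; move: vc; rewrite /lincomb (bigD1 i)//= big1.
    by rewrite addr0 => /eqP; rewrite scaler_eq0 (negbTE (qgen_neq0 F i)) orbF
      => /eqP.
  by move=> k ki; rewrite ci ?inE// scale0r.
move=> c cP cN vc i.
have cPN := comb_pos_cone_sub cP cN vc.
(* The same argument for [-c]. The two supports are disjoint, so mutual inclusion makes both
   empty. *)
have cNP : negset c \subset posset c.
  have [pE nE] : posset (fun i => - c i) = negset c /\
                 negset (fun i => - c i) = posset c.
    by split; apply/setP => j; rewrite !inE (oppr_gt0, oppr_lt0).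
  rewrite -pE -nE; apply: comb_pos_cone_sub; rewrite ?pE ?nE//.
  rewrite /lincomb; under eq_bigr do rewrite scaleNr.
  by rewrite sumrN (vc : \sum_i c i *: v i = 0) oppr0.
case: (ltgtP (c i) 0) => // ci.
  have : i \in posset c by apply: (fintype.subsetP cNP); rewrite inE.
  by rewrite inE ltNge (ltW ci).
have : i \in negset c by apply: (fintype.subsetP cPN); rewrite inE.
by rewrite inE ltNge (ltW ci).
Qed.
End fan_combinatorics.

Lemma qfan_ext (R : realType) (d p : nat) (F F' : qfan R d p) :
  simplicial F -> gcomplete F -> simplicial F' -> gcomplete F' ->
  qgen F = qgen F' -> comb F = comb F' -> F = F'.
Proof.
move=> sF gF sF' gF' vE cE.
have coneE : qcones F = qcones F'.
  apply/funext => s; apply/propext; rewrite (qconesP sF) (qconesP sF').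
  by rewrite cE vE.
have groupE : qgroup F = qgroup F' by rewrite gF gF' vE.
case: F F' coneE groupE vE {sF gF sF' gF' cE}.
move=> g c v h1 h2 h3 h4 h5 h6 h7 h8 h9 h10 h11.
case=> g' c' v' k1 k2 k3 k4 k5 k6 k7 k8 k9 k10 k11 /= cE gE vE.
move: k1 k2 k3 k4 k5 k6 k7 k8 k9 k10 k11; rewrite -cE -gE -vE => *.
by congr QFan; exact: Prop_irrelevance.
Qed.

(** * The fan of a realization *)

Section realization_fan.
Variables (R : realType) (d p : nat) (D : {set {set 'I_p}}).
Variable v : 'I_p -> 'rV[R]_d.
Hypothesis vD : realizes D v.
Hypothesis v_span : spanning (zspan v).
Implicit Types I J : {set 'I_p}.

Let cones : set (set 'rV[R]_d) := [set s | exists2 I, I \in D & s = cone v I].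

Lemma zspan_gen i : zspan v (v i).
Proof.
exists (fun j => (j == i)%:Z); rewrite (bigD1 i)//= eqxx big1 ?addr0//.
by move=> j /negPf ->.
Qed.

Lemma zspan_in0 : zspan v 0.
Proof. by exists (fun=> 0); rewrite big1. Qed.

Lemma realization_gen s : cones s -> exists (m : nat) (w : 'I_m -> 'rV[R]_d),
  (forall i, zspan v (w i)) /\ s = cone w finset.setT.
Proof.
(* The generating family must be used in full, so generators outside [I] are replaced by 0. *)
move=> [I ID ->]; exists p, (fun i => if i \in I then v i else 0); split.
  by move=> i; case: ifP => _; [exact: zspan_gen|exact: zspan_in0].
apply/seteqP; split; apply: cone_subset => i iI.
  have -> : v i = (fun i => if i \in I then v i else 0) i by rewrite iI.
  by apply: cone_gen; rewrite inE.
by case: ifP => [{}iI|_]; [exact: cone_gen|exact: cone_in0].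
Qed.

Lemma realization_strong s : cones s -> strongly_convex s.
Proof.
move=> [I ID ->] x /coneP[a [a0 aI ->]] /coneP[b [b0 bI ab]].
have [c0 _ _ _] := vD.
have abE : (fun i => a i + b i) =1 (fun=> 0).
  apply: (realizes_diff vD ID ID) => //.
  - by move=> i; rewrite addr_ge0.
  - by move=> i iI; rewrite aI// bI// addr0.
  rewrite -lincombD -ab subrr; rewrite /lincomb big1// => i _; exact: scale0r.
rewrite /lincomb big1// => i _; have /eqP := abE i.
by rewrite paddr_eq0// => /andP[/eqP -> _]; rewrite scale0r.
Qed.

Lemma realization_0 : cones [set 0].
Proof. by have [D0 _ _ _] := vD; exists finset.set0 => //; rewrite cone0. Qed.

Lemma realization_face s t : cones s -> is_face t s -> cones t.
Proof.
have [_ subD _ _] := vD.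
by move=> [I ID ->] /face_cone[J [JI ->]]; exists J => //; exact: subD ID.
Qed.

Lemma realization_inter s t : cones s -> cones t ->
  is_face (s `&` t) s /\ is_face (s `&` t) t.
Proof.
move=> [I ID ->] [J JD ->]; rewrite (realizes_inter vD ID JD).
have vI := realizes_indep vD ID; have vJ := realizes_indep vD JD.
by split; apply: cone_face => //; [exact: subsetIl|exact: subsetIr].
Qed.

Lemma realization_neq0 i : v i != 0.
Proof.
have [_ _ /(_ i)D1 _] := vD; apply: (indep_neq0 (realizes_indep vD D1)).
by rewrite inE.
Qed.

Lemma realization_ray s : (cones s /\ is_ray s) <-> exists i, s = ray (v i).
Proof.
split=> [[[I ID ->] rI]|[i ->]].
  by have [i _ ->] := cone_is_ray (realizes_indep vD ID) rI; exists i.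
have [_ _ /(_ i)D1 _] := vD.
split; last exact/ray_is_ray/realization_neq0.
by exists [set i]%SET; rewrite ?cone1.
Qed.

Lemma realization_inj i j : ray (v i) = ray (v j) -> i = j.
Proof.
move=> ij; have [_ _ D1 _] := vD; apply: contrapT => nij.
have : (cone v [set i]%SET `&` cone v [set j]%SET) (v i).
  by rewrite !cone1 -ij; split; exact: ray_gen.
rewrite (realizes_inter vD (D1 i) (D1 j)).
rewrite (_ : _ :&: _ = finset.set0)%SET.
  by rewrite cone0 => /eqP; rewrite (negbTE (realization_neq0 i)).
apply/setP => k; rewrite !inE; apply/negbTE; apply/negP => /andP[/eqP -> /eqP].
exact: nij.
Qed.

Definition realization_fan : qfan R d p :=
  @QFan R d p (zspan v) cones v (ex_intro _ p (ex_intro _ v erefl)) v_span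
    realization_gen realization_strong realization_0 realization_face
    realization_inter zspan_gen realization_neq0 realization_ray
    realization_inj.

Lemma realization_simplicial : simplicial realization_fan.
Proof.
move=> _ [I ID ->]; exists #|I|, (fun k => v (enum_val k)).
have vI := realizes_indep vD ID; split.
  apply: inj_row_free => c cv; apply/rowP => k; rewrite mxE.
  have := (indep_functional (fun i => (i == enum_val k)%:R) vI).
  move=> [u uE]; have : (c *m (\matrix_k v (enum_val k)) *m u) 0 0 = 0.
    by rewrite cv mul0mx mxE.
  rewrite (mulmx_sum_row c) mulmx_suml summxE (bigD1 k)//= big1 => [|j jk].
    by rewrite addr0 -scalemxAl mxE rowK uE ?enum_valP// eqxx mulr1.
  rewrite -scalemxAl mxE rowK uE ?enum_valP//.
  by rewrite (_ : (_ == _) = false) ?mulr0//; apply/negbTE;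
    apply: contra jk => /eqP/enum_val_inj ->.
apply/seteqP; split; apply: cone_subset => k kI.
  rewrite -(enum_rankK_in kI kI).
  by apply: (cone_gen (fun k => v (enum_val k))); rewrite inE.
by apply: cone_gen; exact: enum_valP.
Qed.

Lemma realization_comb : comb realization_fan = D.
Proof.
have DF I : I \in D -> I \in comb realization_fan.
  move=> ID; apply: indep_comb; last exact: realizes_indep vD ID.
  by exists I.
apply/setP => I; apply/idP/idP => [IF|/DF //].
have [[J JD IJ] _] := (combP realization_fan I).1 IF.
by rewrite (cone_comb_inj IF (DF _ JD) IJ).
Qed.
End realization_fan.

(** Up to scaling, the forbidden relations at [x0] are the zeros of [lincomb (v x0)] on a compact
    set [K] that does not depend on the point of [X]; having no zero there is stable. *)
Lemma realizes_open (R : realType) (d m : nat) (D : {set {set 'I_m}})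
    (X : topologicalType) (v : X -> 'I_m -> 'rV[R]_d) :
  (forall i j, continuous (fun x => v x i 0 j)) ->
  open [set x | realizes D (v x)].
Proof.
move=> cv; rewrite openE => x0 [D0 subD D1 inj].
pose K := [set c : 'rV[R]_m | [/\ `|c| = 1, posset (c 0) \in D &
  negset (c 0) \in D]].
(* A strict inequality at [c] persists nearby, so supports can only grow near [c]. As [D] is closed
   under subsets, not being in [D] is an open condition. *)
have closedP (P : R -> bool) : open [set r | P r] ->
    closed [set c : 'rV[R]_m | [set i | P (c 0 i)]%SET \in D].
  move=> oP; rewrite -[X in closed X]setCK; apply: open_closedC.
  rewrite openE => c /negP nc.
  have Pn i : nbhs c [set c' : 'rV[R]_m | P (c 0 i) -> P (c' 0 i)].
    have [Pc|Pc] := boolP (P (c 0 i)); last exact: filterE.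
    have Pr : nbhs (c 0 i) [set r | P r] by exact: open_nbhs_nbhs.
    have cPr : nbhs c [set c' : 'rV[R]_m | P (c' 0 i)].
      exact: (@coord_continuous R 1 m 0 i c _ Pr).
    by apply: filterS cPr => c' /= Pc' _.
  have {}Pn : nbhs c [set c' : 'rV[R]_m | forall i, P (c 0 i) -> P (c' 0 i)].
    exact: filter_forall Pn.
  apply: filterS Pn => c' Pc'; apply/negP; apply: contra nc; apply: subD.
  by apply/fintype.subsetP => i; rewrite !inE; exact: Pc'.
have opos : open [set r : R | 0 < r] by exact: open_gt.
have oneg : open [set r : R | r < 0] by exact: open_lt.
have cK : compact K.
  apply: bounded_closed_compact.
    exists 1; split=> [|M M1 c [c1 _ _]]; first exact: num_real.
    by rewrite /= c1 ltW.
  rewrite (_ : K = [set c : 'rV[R]_m | `|c| = 1] `&` ([set c :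
    'rV[R]_m | posset (c 0) \in D] `&`
    [set c : 'rV[R]_m | negset (c 0) \in D])); last first.
    by apply/seteqP; split=> c; [case|move=> [? []]].
  apply: closedI; last apply: closedI.
  - apply: (@closed_comp _ _ (fun c : 'rV[R]_m => `|c|) [set 1]).
      by move=> c _; exact: norm_continuous.
    exact: closed_eq.
  - exact: closedP opos.
  exact: closedP oneg.
have wK c : K c -> lincomb (v x0) (c 0) != 0.
  move=> [c1 cP cN]; apply/eqP => c0.
  have : c = 0 by apply/rowP => i; rewrite mxE; exact: inj c0 i.
  by move=> cE; move: c1; rewrite cE normr0 => /esym/eqP; rewrite oner_eq0.
(* The tube lemma: the combination is jointly continuous in [(c, x)] and nonzero on [K] at [x0],
   hence nonzero on all of [K] for [x] near [x0]. *)
have : \forall x \near x0, K `<=` [set c : 'rV[R]_m | lincomb (v x) (c 0) != 0].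
  apply: (compact_near_coveringP K).1 => // c /wK wc.
  pose f (y : 'rV[R]_m * X) := lincomb (v y.2) (y.1 0).
  have cf : {for (c, x0), continuous f}.
    apply/continuous_mxP => i j; rewrite ord1.
    have -> : (fun y => f y 0 j) = (fun y => \sum_k y.1 0 k * v y.2 k 0 j).
      by apply/funext => y; rewrite summxE; apply: eq_bigr => k _; rewrite mxE.
    suff cc : continuous (fun y : 'rV[R]_m * X => \sum_k y.1 0 k * v y.2 k 0 j).
      exact: cc.
    apply: continuous_big => [|k _ y]; first exact: add_continuous.
    apply: continuousM.
      exact: (continuous_comp (@cvg_fst _ _ _ _ _) (@coord_continuous R 1 m 0 k
        _)).
    exact: (continuous_comp (@cvg_snd _ _ _ _ _) (cv k j _)).
  have f0 : nbhs (f (c, x0)) [set z : 'rV[R]_d | z != 0].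
    apply: open_nbhs_nbhs; split=> //; rewrite (_ : [set _ | _] = ~` [set 0]).
      exact/closed_openC/accessible_closed_set1/hausdorff_accessible/norm_hausdorff
        .
    by apply/seteqP; split=> z /eqP.
  exact: cf f0.
apply: filterS => x xK; split=> // c cP cN vc.
(* A nonzero relation at [x] is scaled to norm 1. This preserves the signs of its coefficients, so
   it would lie in [K]. *)
pose e := \row_i c i; have e0 i : e 0 i = c i by rewrite mxE.
apply: contrapT => /existsNP[i /eqP ci].
have ne : `|e| != 0 by rewrite normr_eq0; apply: contraNneq ci => e00;
  rewrite -e0 e00 mxE.
have ne0 : 0 < `|e|^-1 by rewrite invr_gt0 lt_neqAle eq_sym ne normr_ge0.
have := xK (`|e|^-1 *: e); rewrite /K /=;
  have -> : (`|e|^-1 *: e) 0 = fun i => `|e|^-1 * c i.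
  by apply/funext => k; rewrite mxE e0.
have -> : lincomb (v x) (fun i => `|e|^-1 * c i) = 0.
  rewrite -[RHS](scaler0 _ `|e|^-1) -vc /lincomb scaler_sumr.
  by apply: eq_bigr => k _; rewrite scalerA.
rewrite eqxx => xKe; suff: ~~ true by []; apply: xKe; split.
- by rewrite normrZ normfV normr_id mulVf.
- by rewrite (_ : posset _ = posset c)//; apply/setP => k;
  rewrite !inE pmulr_rgt0.
by rewrite (_ : negset _ = negset c)//; apply/setP => k;
  rewrite !inE pmulr_rlt0.
Qed.

(** * Generators of a standard fan in terms of its parameters *)

Section standard_generators.
Variables (R : realType) (d p : nat).
Implicit Types (T : 'M[R]_(p - d, d)) (i : 'I_p) (k : 'I_d) (j : 'I_(p - d)).

(** The standard basis followed by the rows of [T], the inverse construction to [tail]. By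
    [ord_splitP] the final value 0 is never reached. *)
Definition stdgen T i : 'rV[R]_d :=
  if insub (val i) is Some k then delta_mx 0 (k : 'I_d)
  else if insub (i - d)%N is Some j then row (j : 'I_(p - d)) T else 0.

Lemma stdgen_head T i k : i = k :> nat -> stdgen T i = delta_mx 0 k.
Proof. by move=> ik; rewrite /stdgen /= ik valK. Qed.

Lemma stdgen_tail T j : stdgen T (Ordinal (tail_ltn j)) = row j T.
Proof. by rewrite /stdgen /= insubF ?addKn ?valK// ltnNge leq_addr. Qed.

Variant ord_split_spec i : Prop :=
| OrdHead k of i = k :> nat
| OrdTail j of i = Ordinal (tail_ltn j).

Lemma ord_splitP i : ord_split_spec i.
Proof.
have [id|di] := ltnP i d; first by apply: (@OrdHead _ (Ordinal id)).
have ij : (i - d < p - d)%N by rewrite ltn_sub2r// (leq_ltn_trans di).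
by apply: (@OrdTail _ (Ordinal ij)); apply: val_inj; rewrite /= subnKC.
Qed.

Lemma stdgenP T (w : 'I_p -> 'rV[R]_d) :
  (forall i k, i = k :> nat -> w i = delta_mx 0 k) ->
  (forall j, w (Ordinal (tail_ltn j)) = row j T) -> w = stdgen T.
Proof.
move=> wh wt; apply/funext => i; case: (ord_splitP i) => [k ik|j ->].
  by rewrite (wh _ _ ik) (stdgen_head _ ik).
by rewrite wt stdgen_tail.
Qed.

Lemma standard_qgen (F : qfan R d p) : standard F -> qgen F = stdgen (tail F).
Proof.
by move=> sF; apply: stdgenP => // j; apply/rowP => k; rewrite !mxE.
Qed.
End standard_generators.

(** * Permutations acting on labelled combinatorial types *)

Section relabelling.
Variables (p : nat).
Implicit Types (g h : 'S_p) (I J : {set 'I_p}) (D : {set {set 'I_p}}).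

Definition relabel g D : {set {set 'I_p}} :=
  [set g @: (I : {set 'I_p}) | I in D]%SET.

Lemma mem_perm_imset g J i : (i \in g^-1%g @: J)%SET = (g i \in J).
Proof.
apply/imsetP/idP => [[j jJ ->]|gJ]; first by rewrite permKV.
by exists (g i); rewrite ?permK.
Qed.

Lemma perm_imsetK g J : (g @: (g^-1%g @: J))%SET = J.
Proof.
apply/setP => i; rewrite -{1}(invgK g) mem_perm_imset mem_perm_imset.
by rewrite permKV.
Qed.

Lemma mem_relabel g D J : (J \in relabel g D) = (g^-1%g @: J \in D)%SET.
Proof.
apply/imsetP/idP => [[I ID ->]|JD]; last by exists (g^-1%g @: J)%SET;
  rewrite ?perm_imsetK.
by have := perm_imsetK g^-1%g I; rewrite invgK => ->.
Qed.

Lemma relabelM g h D : relabel h (relabel g D) = relabel (g * h)%g D.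
Proof.
apply/setP => J; rewrite !mem_relabel invMg.
congr (_ \in D); apply/setP => i; rewrite !mem_perm_imset.
by rewrite -[(h^-1 * g^-1)%g]invgK invMg !invgK mem_perm_imset permM.
Qed.

Lemma relabel1 D : relabel 1%g D = D.
Proof.
apply/setP => J; rewrite mem_relabel; congr (_ \in D).
by apply/setP => i; rewrite mem_perm_imset perm1.
Qed.

Lemma comb_equiv_relabel g D D' :
  comb_equiv D D' -> comb_equiv (relabel g D) D'.
Proof.
move=> [s sD]; exists (g^-1 * s)%g; rewrite -[LHS]/(relabel _ _) relabelM.
by rewrite mulKVg.
Qed.

(** It serves to move [d] independent generators to the first [d] places. Places are filled one at a
    time by a transposition, which by injectivity of [f] does not disturb the earlier ones. *)
Lemma perm_of_inj d (hdp : (d <= p)%N) (f : 'I_d -> 'I_p) : injective f ->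
  exists s : 'S_p, forall k, s (f k) = widen_ord hdp k.
Proof.
move=> finj.
suff sP n : (n <= d)%N -> exists s : 'S_p,
    forall k : 'I_d, (k < n)%N -> s (f k) = widen_ord hdp k.
  by have [s sE] := sP d (leqnn d); exists s => k; exact: sE.
elim: n => [|n IHn] nd; first by exists 1%g.
have [s sE] := IHn (ltnW nd); pose k0 := Ordinal nd.
exists (s * tperm (s (f k0)) (widen_ord hdp k0))%g => k.
rewrite ltnS leq_eqVlt permM => /orP[/eqP kn|kn].
  by rewrite (_ : k = k0) ?tpermL//; exact: val_inj.
have kk0 : k != k0 by apply: contraTneq kn => ->; rewrite ltnn.
have sk := sE k kn; rewrite sk tpermD//.
  by rewrite -sk (inj_eq perm_inj) (inj_eq finj) eq_sym.
apply: contraNneq kk0 => /(congr1 val)/= k0k; apply/eqP/val_inj => /=.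
by rewrite -k0k.
Qed.
End relabelling.

(** * Isomorphisms of fans labelled by permutations of the rays *)

Section fan_arrows.
Variables (R : realType) (d p : nat).
Implicit Types (g h : 'S_p) (I J : {set 'I_p}) (D : {set {set 'I_p}}).
Implicit Types (w v : 'I_p -> 'rV[R]_d) (F : qfan R d p) (A : 'M[R]_d).

Lemma lincomb_relabel g A w v c : (forall i, w i *m A = v (g i)) ->
  lincomb w (c \o g) *m A = lincomb v c.
Proof.
move=> wv; rewrite mulmx_suml /lincomb [RHS](reindex_inj (@perm_inj _ g)) /=.
by apply: eq_bigr => i _; rewrite -scalemxAl wv.
Qed.

Lemma cone_relabel g A w v I : (forall i, w i *m A = v (g i)) ->
  cone v (g @: I)%SET = mulmxr A @` cone w I.
Proof.
move=> wv; apply/seteqP; split=> [x [a a0 ->]|_ [x [a a0 ->] <-]] /=.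
  exists (\sum_(i in I) a (g i) *: w i); first by exists (a \o g) => // i;
    exact: a0.
  rewrite /= mulmx_suml big_imset /=; last by move=> ? ? _ _; exact: perm_inj.
  by apply: eq_bigr => i _; rewrite -scalemxAl wv.
exists (fun j => a (g^-1%g j)) => [j|]; first exact: a0.
rewrite mulmx_suml big_imset /=; last by move=> ? ? _ _; exact: perm_inj.
by apply: eq_bigr => i _; rewrite -scalemxAl wv permK.
Qed.

Lemma indep_relabel g A w v I : A \in unitmx ->
  (forall i, w i *m A = v (g i)) -> indep w I -> indep v (g @: I)%SET.
Proof.
move=> uA wv wI c cI vc i; rewrite -(permKV g i).
apply: (wI (c \o g)) => [j jI|].
  by apply: cI; rewrite (mem_imset _ _ (@perm_inj _ g)).
by rewrite -[LHS](mulmxK uA) (lincomb_relabel c wv) vc mul0mx.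
Qed.

Lemma realizes_relabel g A D w v : A \in unitmx ->
  (forall i, w i *m A = v (g i)) -> realizes D w -> realizes (relabel g D) v.
Proof.
move=> uA wv [D0 subD D1 inj]; split.
- by rewrite mem_relabel imset0.
- move=> I J JI; rewrite !mem_relabel; apply: subD; exact: imsetS.
- by move=> i; rewrite mem_relabel imset_set1.
move=> c; rewrite !mem_relabel => cP cN vc i; rewrite -(permKV g i).
apply: (inj (c \o g)).
- rewrite (_ : posset _ = g^-1%g @: posset c)%SET//.
  by apply/setP => j; rewrite mem_perm_imset !inE.
- rewrite (_ : negset _ = g^-1%g @: negset c)%SET//.
  by apply/setP => j; rewrite mem_perm_imset !inE.
by rewrite -[LHS](mulmxK uA) (lincomb_relabel c wv) vc mul0mx.
Qed.

Lemma zspan_relabel g A w v : (forall i, w i *m A = v (g i)) ->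
  mulmxr A @` zspan w = zspan v.
Proof.
move=> wv; have mulmxz (x : 'rV[R]_d) n : (x *~ n) *m A = (x *m A) *~ n.
  exact: (raddfMz (mulmxr A)).
apply/seteqP; split=> [_ [x [c ->] <-]|x [c ->]] /=.
  exists (c \o g^-1%g); rewrite mulmx_suml [RHS](reindex_inj (@perm_inj _ g))
    /=.
  by apply: eq_bigr => i _; rewrite /= permK -wv mulmxz.
exists (\sum_i w i *~ c (g i)); first by exists (c \o g).
rewrite /= mulmx_suml [RHS](reindex_inj (@perm_inj _ g)) /=.
by apply: eq_bigr => i _; rewrite -wv mulmxz.
Qed.

(** For simplicial complete fans the generators and [comb] determine the group and the cones, so
    these clauses say that [A] is an isomorphism inducing [g] on the rays; see [fan_isoP]. *)
Definition fan_arr g F F' : Prop := exists A, [/\ A \in unitmx,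
  forall i, qgen F i *m A = qgen F' (g i) & comb F' = relabel g (comb F)].

Lemma fan_arr1 F : fan_arr 1%g F F.
Proof.
exists 1%:M; split; rewrite ?unitmx1 ?relabel1//.
by move=> i; rewrite mulmx1 perm1.
Qed.

Lemma fan_arrM g h F F' F'' :
  fan_arr g F F' -> fan_arr h F' F'' -> fan_arr (g * h)%g F F''.
Proof.
move=> [A [uA AE Ac]] [B [uB BE Bc]]; exists (A *m B); split.
- by rewrite unitmx_mul uA.
- by move=> i; rewrite mulmxA AE BE permM.
by rewrite Bc Ac relabelM.
Qed.

Lemma fan_arrV g F F' : fan_arr g F F' -> fan_arr g^-1%g F' F.
Proof.
move=> [A [uA AE Ac]]; exists (invmx A); split.
- by rewrite unitmx_inv.
- by move=> i; rewrite -{1}(permKV g i) -AE mulmxK.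
by rewrite Ac relabelM mulgV relabel1.
Qed.

Lemma fan_iso_comb g A F F' I : simplicial F -> A \in unitmx ->
  (forall s, qcones F s -> qcones F' (mulmxr A @` s)) ->
  (forall i, qgen F i *m A = qgen F' (g i)) ->
  I \in comb F -> (g @: I)%SET \in comb F'.
Proof.
move=> sF uA cF AE IF; apply: indep_comb.
  by rewrite (cone_relabel I AE); apply: cF; have [] := (combP F I).1 IF.
exact: indep_relabel uA AE (comb_indep sF IF).
Qed.

Lemma fan_isoP F F' : simplicial F -> gcomplete F -> simplicial F' ->
  gcomplete F' -> fan_iso F F' <-> exists g, fan_arr g F F'.
Proof.
move=> sF gF sF' gF'; split=> [[A [uA AF cF cF' [g AE]]]|[g [A [uA AE Ac]]]].
  exists g, A; split=> //; apply/setP => J; rewrite mem_relabel.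
  apply/idP/idP => [JF|/(fan_iso_comb sF uA cF AE)];
    last by rewrite perm_imsetK.
  apply: fan_iso_comb cF' _ JF => //; first by rewrite unitmx_inv.
  by move=> i; rewrite -{1}(permKV g i) -AE mulmxK.
exists A; split=> //.
- by rewrite gF gF'; exact: zspan_relabel AE.
- move=> s /(qconesP sF)[I IF ->]; apply/(qconesP sF'); exists (g @: I)%SET.
    by rewrite Ac; apply: imset_f.
  by rewrite (cone_relabel I AE).
- move=> s /(qconesP sF')[J JF' ->]; apply/(qconesP sF).
  exists (g^-1%g @: J)%SET; first by rewrite -mem_relabel -Ac.
  apply/esym/cone_relabel => i.
  by rewrite -{1}(permKV g i) -AE mulmxK.
by exists g.
Qed.
End fan_arrows.

(** * Moduli of standard fans *)

Section standard_fans.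
Variables (R : realType) (d p : nat) (D : {set {set 'I_p}}).
Hypothesis hdp : (d <= p)%N.
Local Notation stdfan := (@std_mfan R d p D).
Local Notation V := 'M[R]_(p - d, d).
Implicit Types (F : stdfan) (g : 'S_p) (T : V).

Definition sfan F : qfan R d p := sval (sval F).
Definition scomb F : {set {set 'I_p}} := comb (sfan F).
Definition stail F : V := tail (sfan F).

Lemma sfan_simplicial F : simplicial (sfan F).
Proof. by have [] := svalP (sval F). Qed.

Lemma sfan_complete F : gcomplete (sfan F).
Proof. by have [] := svalP (sval F). Qed.

Lemma scomb_equiv F : comb_equiv (scomb F) D.
Proof. by have [] := svalP (sval F). Qed.

Lemma sfan_gen F : qgen (sfan F) = stdgen (stail F).
Proof. exact: standard_qgen (svalP F). Qed.

Lemma sfan_head F (i : 'I_p) (k : 'I_d) : i = k :> nat ->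
  qgen (sfan F) i = delta_mx 0 k.
Proof. by move=> ik; rewrite sfan_gen (stdgen_head _ ik). Qed.

Lemma sfan_realizes F : realizes (scomb F) (stdgen (stail F)).
Proof. by rewrite -sfan_gen; exact/comb_realizes/sfan_simplicial. Qed.

Lemma sfan_ext F F' : scomb F = scomb F' -> stail F = stail F' -> F = F'.
Proof.
move=> cE tE; apply: eq_sig_hprop => [G|]; first exact: Prop_irrelevance.
apply: eq_sig_hprop => [G|]; first exact: Prop_irrelevance.
apply: qfan_ext; [exact: sfan_simplicial|exact: sfan_complete|
  exact: sfan_simplicial|exact: sfan_complete| |exact: cE].
by rewrite -!/(sfan _) !sfan_gen tE.
Qed.

Lemma stdgen_spanning T : spanning (zspan (stdgen T)).
Proof.
move=> x; exists d, (fun k => stdgen T (widen_ord hdp k)), (fun k => x 0 k).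
split=> [k|]; first exact: zspan_gen.
rewrite [LHS]row_sum_delta; apply: eq_bigr => k _.
by rewrite (@stdgen_head _ _ _ _ _ k).
Qed.

Lemma sfan_exists D' T : comb_equiv D' D -> realizes D' (stdgen T) ->
  exists F, scomb F = D' /\ stail F = T.
Proof.
move=> eD rT; have sT := stdgen_spanning T.
pose G := realization_fan rT sT.
have cG : comb G = D' := realization_comb rT sT.
have mG : [/\ simplicial G, gcomplete G & comb_equiv (comb G) D].
  by split; [exact: realization_simplicial|by []|rewrite cG].
have stG : standard (sval (exist _ G mG : @mfan R d p D)).
  by move=> i k ik; exact: stdgen_head ik.
exists (exist _ (exist _ G mG : @mfan R d p D) stG); split; first exact: cG.
by apply/matrixP => j k; rewrite mxE /= stdgen_tail mxE.
Qed.

(** Being a realization is invariant under invertible linear maps and relabelling. The assumption on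
    [A] makes the transported family standard, so its tail describes a point of the parameter
    space. *)
Lemma sfan_transport (F : qfan R d p) g (A : 'M[R]_d) :
  simplicial F -> comb_equiv (comb F) D -> A \in unitmx ->
  (forall (i : 'I_p) (k : 'I_d), g i = k :> nat ->
     qgen F i *m A = delta_mx 0 k) ->
  exists F' : stdfan, [/\ fan_arr g F (sfan F'),
    scomb F' = relabel g (comb F) &
    stail F' = \matrix_j (qgen F (g^-1%g (Ordinal (tail_ltn j))) *m A)].
Proof.
move=> sF cF uA hA; pose w i := qgen F (g^-1%g i) *m A.
pose T : V := \matrix_j w (Ordinal (tail_ltn j)).
have wE : w = stdgen T.
  apply: stdgenP => [i k ik|j]; last by rewrite rowK.
  by apply: hA; rewrite permKV.
have rw : realizes (relabel g (comb F)) (stdgen T).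
  rewrite -wE; apply: (realizes_relabel uA _ (comb_realizes sF)) => i.
  by rewrite /w permK.
have [F' [cF' tF']] := sfan_exists (comb_equiv_relabel g cF) rw.
exists F'; split=> //; exists A; split=> // i.
by rewrite sfan_gen tF' -wE /w permK.
Qed.

(** The generators that [g] moves to the first [d] places. Every arrow labelled [g] into a standard
    fan has the inverse of this matrix as its linear part, by [headmx_unique]. *)
Definition headmx g (v : 'I_p -> 'rV[R]_d) : 'M[R]_d :=
  \matrix_k v (g^-1%g (widen_ord hdp k)).

Lemma headmx_inv g v (i : 'I_p) (k : 'I_d) : headmx g v \in unitmx ->
  g i = k :> nat -> v i *m invmx (headmx g v) = delta_mx 0 k.
Proof.
move=> uB gi; have -> : v i = row k (headmx g v).
  by rewrite rowK; congr v; rewrite -[LHS](permK g); congr (_ _);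
    exact: val_inj.
by rewrite -row_mul mulmxV// row1.
Qed.

Lemma headmx_unique g v (A : 'M[R]_d) :
  (forall (i : 'I_p) (k : 'I_d), g i = k :> nat -> v i *m A = delta_mx 0 k) ->
  headmx g v \in unitmx /\ A = invmx (headmx g v).
Proof.
move=> hA; have BA : headmx g v *m A = 1%:M.
  by apply/row_matrixP => k; rewrite row_mul rowK row1 (hA _ k)// permKV.
have [uB _] := mulmx1_unit BA; split=> //.
by rewrite -[LHS](mulKmx uB) BA mulmx1.
Qed.

Lemma sfan_arr_fun g F F' F'' : fan_arr g (sfan F) (sfan F') ->
  fan_arr g (sfan F) (sfan F'') -> F' = F''.
Proof.
move=> [A [uA AE Ac]] [A' [uA' AE' Ac']].
have hA : forall (i : 'I_p) (k : 'I_d), g i = k :> nat ->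
    qgen (sfan F) i *m A = delta_mx 0 k.
  by move=> i k ik; rewrite AE; exact: sfan_head.
have hA' : forall (i : 'I_p) (k : 'I_d), g i = k :> nat ->
    qgen (sfan F) i *m A' = delta_mx 0 k.
  by move=> i k ik; rewrite AE'; exact: sfan_head.
have AA' : A = A' by rewrite (headmx_unique hA).2 (headmx_unique hA').2.
apply: sfan_ext; first by rewrite /scomb Ac Ac'.
apply/row_matrixP => j; rewrite !rowK.
by rewrite -[X in qgen _ X](permKV g) -AE AA' AE' permKV.
Qed.

Lemma spanning_row_full (m : nat) (v : 'I_m -> 'rV[R]_d) :
  spanning (zspan v) -> row_full (\matrix_i v i).
Proof.
move=> sv; apply/row_fullP.
have vS (x : 'rV[R]_d) : (x <= \matrix_i v i)%MS.
  have [n [w [a [wv ->]]]] := sv x; apply: summx_sub => k _.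
  apply: scalemx_sub; have [c ->] := wv k; apply: summx_sub => i _.
  rewrite -scaler_int; apply: scalemx_sub.
  by rewrite -[v i](rowK v); exact: row_sub.
have /submxP[B BE] : (1%:M <= \matrix_i v i)%MS.
  by apply/row_subP => k; exact: vS.
by exists B.
Qed.

(** Completeness makes the generators span, so [d] of them form a basis. A permutation brings these
    to the front and the inverse of their matrix sends them to the standard basis. *)
Lemma sfan_normal_form (F : qfan R d p) :
  simplicial F -> gcomplete F -> comb_equiv (comb F) D ->
  exists (g : 'S_p) (F' : stdfan), fan_arr g F (sfan F').
Proof.
move=> sF gF cF; have := qgroup_span F; rewrite gF => /spanning_row_full fF.
have [f [finj fE]] : exists f : 'I_d -> 'I_p, injective f /\
    (\matrix_k qgen F (f k) : 'M[R]_d) \in unitmx.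
  exists (fullrankfun fF); split; first exact: fullrankfun_inj.
  rewrite -row_full_unit; have := fullrowsub_full fF; congr row_full.
  by apply/row_matrixP => k; rewrite row_rowsub !rowK.
have [g gE] := perm_of_inj hdp finj.
have hE : headmx g (qgen F) = \matrix_k qgen F (f k).
  by apply/row_matrixP => k; rewrite !rowK -gE permK.
have uB : headmx g (qgen F) \in unitmx by rewrite hE.
have uA : invmx (headmx g (qgen F)) \in unitmx by rewrite unitmx_inv.
have [F' [FF' _ _]] := sfan_transport sF cF uA (fun i k => headmx_inv uB).
by exists g, F'.
Qed.

End standard_fans.

(** * Smoothness of determinants and inverse matrices *)

Section smooth_matrices.
Variables (R : realType) (m k : nat) (A : set 'rV[R]_m).
Hypothesis oA : open A.

Lemma scalarCk_det n (B : 'rV[R]_m -> 'M[R]_n) :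
  (forall i j, scalarCk k A (fun x => B x i j)) ->
  scalarCk k A (fun x => \det (B x)).
Proof.
move=> CB; apply: scalarCk_sum => // s _; apply: scalarCkM => //.
  exact: scalarCk_cst.
by apply: scalarCk_prod => // i _; exact: CB.
Qed.

Lemma scalarCk_invmx n (B : 'rV[R]_m -> 'M[R]_n) i j :
  (forall x, A x -> B x \in unitmx) ->
  (forall i j, scalarCk k A (fun x => B x i j)) ->
  scalarCk k A (fun x => invmx (B x) i j).
Proof.
move=> uB CB.
apply: (@scalarCk_eq _ _ _ _ (fun x =>
  (\det (B x))^-1 * cofactor (B x) j i)) => //.
  by move=> x; rewrite inE => Ax; rewrite /invmx uB// !mxE.
apply: scalarCkM => //.
  apply: scalarCkV => //; last exact: scalarCk_det.
  by move=> x Ax; rewrite -unitfE; have := uB x Ax; rewrite unitmxE.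
apply: scalarCkM => //; first exact: scalarCk_cst.
apply: scalarCk_det => i' j'.
have := CB (lift j i') (lift i j').
by congr scalarCk; apply/funext => x; rewrite !mxE.
Qed.
End smooth_matrices.

(** * The manifold of standard fans *)

Section standard_space.
Variables (R : realType) (d p : nat) (D : {set {set 'I_p}}).
Hypothesis hdp : (d <= p)%N.
Local Notation stdfan := (@std_mfan R d p D).
Local Notation space := (std_space R d D).
Local Notation V := 'M[R]_(p - d, d).
Local Notation dim := ((p - d) * d)%N.
Variable F0 : stdfan.
Implicit Types (F : stdfan) (g : 'S_p) (T : V).

(** The labelled type is a discrete coordinate, constant near [F]; neighbourhoods are thus tested on
    the tail alone. *)
Lemma space_nbhsP (F : space) (A : set space) : nbhs F A <->
  exists2 B : set V, nbhs (stail F) B &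
    forall F' : space, scomb F' = scomb F -> B (stail F') -> A F'.
Proof.
split=> [|[B FB BA]].
  rewrite nbhsE => -[_ [[C oC <-] CF] CA].
  have : nbhs (std_param F) C by exact: open_nbhs_nbhs.
  move=> [[B1 B2] /= [FB1 FB2] BC]; exists B2 => // F' cF' tF'.
  apply/CA/BC; split=> //=; rewrite -/(sfan _) -/(scomb _) cF'.
  exact: (nbhs_singleton FB1).
have nB : nbhs (std_param F) ([set scomb F] `*` B).
  by exists ([set scomb F], B) => //=; split=> //; exact: discrete_set1.
have nF : nbhs F (@std_param R d p D @^-1` ([set scomb F] `*` B)).
  exact: (@initial_continuous _ _ (@std_param R d p D) F _ nB).
by apply: filterS nF => F' [cF' tF']; exact: BA.
Qed.

Lemma scomb_near (F : space) : \forall F' \near F, scomb F' = scomb F.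
Proof. by apply/space_nbhsP; exists setT; [exact: filterT|]. Qed.

Lemma scomb_open D' : open [set F : space | scomb F = D'].
Proof.
by rewrite openE => F /= FD; apply: filterS (scomb_near F) => F' /= ->.
Qed.

Lemma stail_continuous : continuous (@stail R d p D : space -> V).
Proof. by move=> F A FA; apply/space_nbhsP; exists A. Qed.

Lemma space_continuous (X : topologicalType) (f : X -> space) x :
  (\forall y \near x, scomb (f y) = scomb (f x)) ->
  {for x, continuous (fun y => stail (f y))} -> {for x, continuous f}.
Proof.
move=> cf tf A /space_nbhsP[B FB BA].
by apply: filterS2 cf (tf _ FB) => y cy; exact: BA.
Qed.

Lemma mxvec_continuous : continuous (@mxvec R (p - d) d).
Proof.
move=> T; apply/continuous_mxP => i k; rewrite ord1.
case/mxvec_indexP: k => j l; rewrite (_ : (fun _ => _) = fun T : V => T j l).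
  exact: coord_continuous.
by apply/funext => U; rewrite mxvecE.
Qed.

Lemma vec_mx_continuous : continuous (@vec_mx R (p - d) d).
Proof.
move=> y; apply/continuous_mxP => i j.
rewrite (_ : (fun _ => _) = fun y : 'rV[R]_dim => y 0 (mxvec_index i j)).
  exact: coord_continuous.
by apply/funext => z; rewrite mxE.
Qed.

Section chart.
Variable D' : {set {set 'I_p}}.

Let dom : set space := [set F | scomb F = D'].
Let map (F : space) : 'rV[R]_dim := mxvec (stail F).

Definition space_image : set 'rV[R]_dim := [set y |
  comb_equiv D' D /\ realizes D' (stdgen (vec_mx y : V))].

(** A chart needs an inverse defined everywhere; off the realizable parameters it takes the default
    value [F0]. *)
Definition space_inv (y : 'rV[R]_dim) : space :=
  if pselect (exists F, scomb F = D' /\ stail F = vec_mx y) is left e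
  then projT1 (cid e) else F0.

Lemma space_invP y : space_image y ->
  scomb (space_inv y) = D' /\ stail (space_inv y) = vec_mx y.
Proof.
move=> [eD ry]; rewrite /space_inv; case: pselect => [e|[]].
  by case: cid.
exact: sfan_exists.
Qed.

Lemma space_map_image : map @` dom = space_image.
Proof.
apply/seteqP; split=> [_ [F FD <-]|y Yy].
  by rewrite /space_image /= mxvecK -FD; split;
    [exact: scomb_equiv|exact: sfan_realizes].
have [cy ty] := space_invP Yy; exists (space_inv y) => //.
by rewrite /map ty vec_mxK.
Qed.

Lemma stdgen_continuous i j : continuous (fun T : V => stdgen T i 0 j).
Proof.
case: (@ord_splitP d p i) => [k ik|k ->].
  rewrite (_ : (fun _ => _) = fun=> (delta_mx 0 k : 'rV[R]_d) 0 j).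
    exact: cst_continuous.
  by apply/funext => T; rewrite (stdgen_head _ ik).
rewrite (_ : (fun _ => _) = fun T : V => T k j); first exact: coord_continuous.
by apply/funext => T; rewrite stdgen_tail mxE.
Qed.

Lemma stdgen_scalarCk k i j :
  scalarCk k setT (fun y : 'rV[R]_dim => stdgen (vec_mx y : V) i 0 j).
Proof.
case: (@ord_splitP d p i) => [l il|l ->].
  rewrite (_ : (fun _ => _) = fun=> (delta_mx 0 l : 'rV[R]_d) 0 j).
    exact: scalarCk_cst.
  by apply/funext => y; rewrite (stdgen_head _ il).
rewrite (_ : (fun _ => _) = fun y : 'rV[R]_dim => y 0 (mxvec_index l j)).
  exact: scalarCk_coord.
by apply/funext => y; rewrite stdgen_tail !mxE.
Qed.

Lemma space_image_open : open space_image.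
Proof.
have [eD|nD] := pselect (comb_equiv D' D); last first.
  by rewrite (_ : space_image = set0) ?open0//; apply/seteqP; split=> y // [].
rewrite (_ : space_image =
    [set y | realizes D' (stdgen (vec_mx y : V))]); last first.
  by apply/seteqP; split=> y; [case|split].
apply: realizes_open => i j y.
apply: (@continuous_comp _ _ _ (@vec_mx R (p - d) d) (fun T : V =>
  stdgen T i 0 j)).
  exact: vec_mx_continuous.
exact: stdgen_continuous.
Qed.

Lemma space_mapK F : dom F -> space_inv (map F) = F.
Proof.
move=> FD; have : space_image (map F) by rewrite -space_map_image; exists F.
by move=> /space_invP[cF tF]; apply: sfan_ext; rewrite ?cF// tF mxvecK.
Qed.

Lemma space_map_cont F : dom F -> {for F, continuous map}.
Proof.
move=> _; apply: (@continuous_comp space V _ (@stail R d p D) (@mxvec R (p - d)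
  d)).
  exact: stail_continuous.
exact: mxvec_continuous.
Qed.

Lemma space_inv_cont y : space_image y -> {for y, continuous space_inv}.
Proof.
move=> Yy; have nY : \forall z \near y, space_image z.
  by apply: open_nbhs_nbhs; split=> //; exact: space_image_open.
apply: space_continuous.
  apply: filterS nY => z Yz.
  by rewrite (space_invP Yz).1 (space_invP Yy).1.
have ny : {near y, (@vec_mx R (p - d) d) =1 (fun z => stail (space_inv z))}.
  by apply: filterS nY => z Yz; rewrite (space_invP Yz).2.
change ((fun z => stail (space_inv z)) @ y --> stail (space_inv y)).
rewrite (space_invP Yy).2; apply: cvg_trans (@vec_mx_continuous y).
exact: (near_eq_cvg ny).
Qed.

Lemma space_map_open : open (map @` dom).
Proof. by rewrite space_map_image; exact: space_image_open. Qed.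

Lemma space_inv_cont' y : (map @` dom) y -> {for y, continuous space_inv}.
Proof. by rewrite space_map_image; exact: space_inv_cont. Qed.

Definition space_chart : chart R space dim :=
  @Chart R space dim dom map space_inv (@scomb_open D') space_map_open
    space_mapK space_map_cont space_inv_cont'.
End chart.

Definition space_atlas : set (chart R space dim) :=
  [set c | exists D', c = space_chart D'].

Lemma space_hausdorff : hausdorff_space space.
Proof.
move=> F F' FF'.
have cE : scomb F = scomb F'.
  have [G [/= GF GF']] := FF' _ _ (scomb_near F) (scomb_near F').
  by rewrite -GF GF'.
apply: sfan_ext => //; apply: (@norm_hausdorff _ V) => A B FA FB.
have [G [GA GB]] := FF' _ _ (stail_continuous FA) (stail_continuous FB).
by exists (stail G).
Qed.

Lemma space_second_countable : @second_countable space.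
Proof.
(* A countable base: for each labelled type, the boxes with rational centre and radius
   [1 / (n + 1)]. *)
pose box (q : {set {set 'I_p}} * 'M[rat]_(p - d, d) * nat) : set space :=
  [set F | scomb F = q.1.1 /\
    forall i j, `|stail F i j - ratr (q.1.2 i j)| < q.2.+1%:R^-1].
exists (range box).
  by apply: sub_countable (card_image_le _ _) _; exact: countableP.
split.
  move=> _ [[[D' Q] n] _ <-]; rewrite openE => F [/= FD FQ].
  have near_tail : \forall F' \near F,
      forall i j, `|stail F' i j - ratr (Q i j)| < n.+1%:R^-1.
    apply/space_nbhsP; exists [set T :
      V | forall i j, `|T i j - ratr (Q i j)| < n.+1%:R^-1] => //.
    exists (fun i j => [set x | `|x - ratr (Q i j)| < n.+1%:R^-1]) => // i j.
    have -> : [set x | `|x - ratr (Q i j)| < n.+1%:R^-1] = ball (ratr (Q i j) :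
      R) (n.+1%:R^-1 : R).
      by apply/seteqP; split=> x /=; rewrite /ball /= distrC.
    apply: open_nbhs_nbhs; split; first by apply: ball_open; rewrite invr_gt0.
    by rewrite /ball /= distrC.
  apply: filterS2 (scomb_near F) near_tail => F' cF' tF'.
  by split=> //=; rewrite cF'.
move=> F A /space_nbhsP[B FB BA].
have [e /= e0 eB] := (nbhs_ballP _ _).1 FB.
(* The radius stays below [e / 2], so that two points of one box are within [e] by the triangle
   inequality through its centre. *)
have [n ne] : exists n : nat, n.+1%:R^-1 < e / 2.
  have e2 : 0 < (e / 2)^-1 by rewrite invr_gt0 divr_gt0.
  exists (Num.bound (e / 2)^-1); rewrite invf_plt ?posrE ?divr_gt0//.
  apply: lt_le_trans (archi_boundP (ltW e2)) _.
  by rewrite ler_nat.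
have n0 : 0 < n.+1%:R^-1 :> R by rewrite invr_gt0.
have qP i j : exists q : rat, `|stail F i j - ratr q| < n.+1%:R^-1.
  have [|q] := @rat_in_itvoo R (stail F i j - n.+1%:R^-1) (stail F i j +
    n.+1%:R^-1).
    by rewrite ltrBlDr -addrA ltrDl addr_gt0.
  rewrite inE /= => /itvP h; exists q.
  by rewrite distrC ltr_distl !h.
pose Q := \matrix_(i, j) sval (cid (qP i j)).
have QE i j : `|stail F i j - ratr (Q i j)| < n.+1%:R^-1.
  by rewrite [Q i j]mxE; exact: (svalP (cid (qP i j))).
exists (box (scomb F, Q, n)); first by split=> //; exists (scomb F, Q, n).
move=> F' [/= cF' tF']; apply: BA => //; apply: eB; split=> // i j.
rewrite /ball /= -(subrKA (ratr (Q i j))) (le_lt_trans (ler_normD _ _))//.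
rewrite (splitr e) ltrD//; first exact: lt_trans (QE i j) ne.
by rewrite distrC; exact: lt_trans (tF' i j) ne.
Qed.

Lemma space_atlas_cover (F : space) : exists2 c, space_atlas c & cdom c F.
Proof. by exists (space_chart (scomb F)) => //; exists (scomb F). Qed.

(** Charts of different labelled types have disjoint domains, so a transition map is the identity
    wherever it has to be tested. *)
Lemma space_atlas_compat c c' : space_atlas c -> space_atlas c' ->
  Cinfty (cmap c @` (cdom c `&` cdom c')) (cmap c' \o cinv c).
Proof.
move=> [D1 ->] [D2 ->].
have oi : open (cmap (space_chart D1) @`
    (cdom (space_chart D1) `&` cdom (space_chart D2))).
  apply: chart_image_open; last by move=> e [].
  by apply: openI; exact: cdom_open.
apply: (@Cinfty_eq _ _ _ _ id) => //; last exact: Cinfty_id.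
by move=> _ /[!inE] -[F [F1 F2] <-]; rewrite /= space_mapK.
Qed.

Definition space_manifold : manifold R :=
  @Manifold R space dim space_atlas space_hausdorff space_second_countable
    space_atlas_cover space_atlas_compat.

Lemma space_arr_etale g (F F' : space_manifold) :
  fan_arr g (sfan F) (sfan F') ->
  exists phi : space_manifold -> space_manifold,
    smooth_at phi F /\ \forall G \near F, fan_arr g (sfan G) (sfan (phi G)).
Proof.
move=> FF'; pose head T := headmx hdp g (stdgen T).
(* The arrow [g] in coordinates: multiply the generators by the inverse of the head matrix and read
   off the relabelled tail. *)
pose psi (y : 'rV[R]_dim) : 'rV[R]_dim :=
  let T : V := vec_mx y in
  mxvec (\matrix_j (stdgen T (g^-1%g (Ordinal (tail_ltn j))) *m invmx (head
    T))).
(* Some target of the arrow [g], unique by [sfan_arr_fun]. The fallback value [G] does not occur on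
   [A], where [sfan_transport] supplies a target. *)
pose phi (G : space) : space :=
  if pselect (exists G' : space, fan_arr g (sfan G) (sfan G')) is left e
  then projT1 (cid e) else G.
pose A : set space := [set G | scomb G = scomb F /\ head (stail G) \in unitmx].
have uF : head (stail F) \in unitmx.
  have [B [uB BE _]] := FF'.
  rewrite /head -sfan_gen; have [] // :=
    @headmx_unique _ _ _ hdp g (qgen (sfan F)) B _.
  by move=> i k ik; rewrite BE; exact: sfan_head.
have phiP G : A G -> [/\ fan_arr g (sfan G) (sfan (phi G)),
    scomb (phi G) = relabel g (scomb F) &
    mxvec (stail (phi G)) = psi (mxvec (stail G))].
  move=> [cG uG]; rewrite -cG.
  have uA : invmx (headmx hdp g (qgen (sfan G))) \in unitmx.
    by rewrite unitmx_inv sfan_gen.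
  have [|G' [GG' cG' tG']] := sfan_transport hdp (sfan_simplicial (F :=
    G)) (scomb_equiv G) uA (g := g).
    by move=> i k; apply: headmx_inv; rewrite sfan_gen.
  have phiG : phi G = G'.
    rewrite /phi; case: pselect => [e|[]]; last by exists G'.
    by case: cid => G'' /= GG''; exact: (sfan_arr_fun hdp GG'' GG').
  by rewrite phiG; split=> //; rewrite tG' /psi mxvecK /head sfan_gen.
have Chead k B i j : scalarCk k B (fun y => head (vec_mx y) i j).
  apply: scalarCk_sub (@subsetT _ B) _.
  have := stdgen_scalarCk k (g^-1%g (widen_ord hdp i)) j.
  by congr scalarCk; apply/funext => y; rewrite /head mxE.
have oA : open A.
  have cdet : continuous (fun y : 'rV[R]_dim => \det (head (vec_mx y))).
    have := @scalarCk_det R dim 0 setT openT d (fun y =>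
      head (vec_mx y)) (Chead 0 setT).
    by move=> h y; exact: h.
  have od : open [set y : 'rV[R]_dim | \det (head (vec_mx y)) != 0].
    by move/continuousP: cdet => /(_ [set x | x != 0]); apply; exact: open_neq.
  have cm : continuous (fun G : space => mxvec (stail G)).
    by move=> G; exact: (@space_map_cont (scomb G)).
  rewrite (_ : A = [set G : space | scomb G = scomb F] `&`
      (fun G : space => mxvec (stail G)) @^-1`
        [set y : 'rV[R]_dim | \det (head (vec_mx y)) != 0]).
    by apply: openI; [exact: scomb_open|move/continuousP: cm; exact].
  apply/seteqP; split=> G [cG uG]; split=> //; move: uG;
    by rewrite /= mxvecK unitmxE unitfE.
have oim : open (cmap (space_chart (scomb F)) @` A).
  by apply: chart_image_open => // G [].
have Cpsi : Cinfty (cmap (space_chart (scomb F)) @` A) psi.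
  move=> k; apply/Ck_coordP => // l; case/mxvec_indexP: l => j l.
  apply: (@scalarCk_eq _ _ _ _ (fun y => \sum_m
      stdgen (vec_mx y : V) (g^-1%g (Ordinal (tail_ltn j))) 0 m *
      invmx (head (vec_mx y)) m l)) => //.
    by move=> y _; rewrite /psi mxvecE !mxE.
  apply: scalarCk_sum => // m _; apply: scalarCkM => //.
    exact: scalarCk_sub (@subsetT _ _) (stdgen_scalarCk _ _ _).
  apply: scalarCk_invmx => //.
  by move=> _ [G [_ uG] <-] /=; rewrite mxvecK.
exists phi; split; last first.
  have : \forall G \near (F : space), A G by apply: open_nbhs_nbhs.
  by apply: filterS => G /phiP[].
apply: (@smooth_at_charts _ space_manifold space_manifold phi F
  (space_chart (scomb F)) (space_chart (relabel g (scomb F))) A) => //.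
- by exists (scomb F).
- by exists (relabel g (scomb F)).
- by move=> G [].
- by move=> G /phiP[].
(* Having been defined by choice, [phi] is shown to be continuous by identifying it near [G] with
   [psi] between the chart of the source type and the inverse chart of the relabelled type. *)
- move=> G AG; have nA : \forall G' \near G, A G' by exact: open_nbhs_nbhs.
  have [_ cG tG] := phiP _ AG.
  have imG : space_image (relabel g (scomb F)) (psi (mxvec (stail G))).
    by rewrite -tG -space_map_image; exists (phi G).
  have phiE : {in A, (space_inv (relabel g (scomb F)) \o psi \o
      (fun G' : space => mxvec (stail G'))) =1 phi}.
    move=> G'; rewrite inE => /phiP[_ cG' tG'] /=.
    by rewrite -tG' space_mapK.
  have nphi : {near G, (space_inv (relabel g (scomb F)) \o psi \o
      (fun G' : space => mxvec (stail G'))) =1 phi}.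
    by apply: filterS nA => G' AG'; apply: phiE; rewrite inE.
  change (phi @ G --> phi G); rewrite -phiE ?inE//.
  apply: cvg_trans (near_eq_cvg nphi) _.
  apply: continuous_comp; first exact: (@space_map_cont (scomb G)).
  apply: continuous_comp; last exact: space_inv_cont.
  by apply: (Cpsi 0%N); exists G.
apply: (@Cinfty_eq _ _ _ _ psi) => // y; rewrite inE => -[G AG <-] /=.
rewrite space_mapK; last by have [] := AG.
by have [_ _ ->] := phiP _ AG.
Qed.

End standard_space.

(** * The groupoid of standard fans and the moduli space *)

Section moduli_groupoid.
Variables (R : realType) (d p : nat) (D : {set {set 'I_p}}).
Hypothesis hdp : (d <= p)%N.
Variable F0 : @std_mfan R d p D.
Local Notation M := (space_manifold hdp F0).

Definition fan_groupoid : etale_groupoid {perm 'I_p} M :=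
  @EtaleGroupoid R {perm 'I_p} M (fun g F F' => fan_arr g (sfan F) (sfan F'))
    (fun F => fan_arr1 (sfan F)) (fun g h F F' F'' => @fan_arrM R d p g h _ _ _)
    (fun g F F' => @fan_arrV R d p g _ _) (sfan_arr_fun hdp)
    (@space_arr_etale R d p D hdp F0).

Lemma std_classP (F F' : std_space R d D) :
  std_class F = std_class F' <-> exists g, fan_arr g (sfan F) (sfan F').
Proof.
have iso := fan_isoP (sfan_simplicial (F := F)) (sfan_complete F)
  (sfan_simplicial (F := F')) (sfan_complete F').
by split=> [/eqmodP/asboolP/iso|/iso FF']; last exact/eqmodP/asboolP.
Qed.

Lemma std_class_surj (q : {eq_quot @mfan_equiv R d p D}) :
  exists F : std_space R d D, std_class F = q.
Proof.
elim/quotP: q => -[F [sF gF cF]] _.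
have [g [F' FF']] := sfan_normal_form hdp sF gF cF.
exists F'; apply/eqmodP/asboolP/fan_iso_sym.
apply/(fan_isoP sF gF (sfan_simplicial (F := F')) (sfan_complete F')).
by exists g.
Qed.
End moduli_groupoid.

Theorem corollary11p13 (R : realType) (d p : nat) (D : {set {set 'I_p}})
    (hD : exists F : qfan R d p,
        [/\ simplicial F, gcomplete F & comb F = D]) :
  exists X : orbifold R (d * (p - d))%N,
    homeomorphic (coarse_space X) (moduli_space R d D).
Proof.
have [F [sF gF cF]] := hD.
have hdp : (d <= p)%N.
  have := qgroup_span F; rewrite gF => /spanning_row_full/eqP <-.
  exact: rank_leq_row.
have eF : comb_equiv (comb F) D by rewrite cF; exists 1%g; exact: relabel1.
(* The normal form of the given fan shows that the space of standard fans is inhabited; it provides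
   the default value of the inverse charts. *)
have [_ [F0 _]] := sfan_normal_form hdp sF gF eF.
have dimE : mdim (space_manifold hdp F0) = (d * (p - d))%N := mulnC _ _.
exists (groupoid_orbifold (fan_groupoid hdp F0) dimE).
apply: (@groupoid_coarse_homeomorphic R _ _ (fan_groupoid hdp F0) _ dimE _
  (@std_class R d p D)).
- exact: std_class_surj.
- exact: std_classP.
Qed.
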